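(* Let $(X_i)_{i\ge1}$ be i.i.d. real random variables on $(\Omega,\mathcal F,\mathbb P)$, $S_0:=0$, $S_n:=X_1+\cdots+X_n$, with $(S_n)$ recurrent and $S_n/A_n\to X$ in distribution for some positive reals $A_n$, where $X$ is a stable random variable of index $\alpha=1$ with density $f_X$. Assume the Cramér condition $\limsup_{|t|\to\infty}|\mathbb E[e^{itX_1}]|<1$. Let $S_0'$ be a real random variable, independent of $(S_n)_{n\ge0}$, with an arbitrary fixed distribution, and set $S_n':=S_0'+S_n$. Fix $x\in\mathbb R$, let $\tilde\tau^x_\varepsilon:=\inf\{m\ge1:|S'_m-x|<\varepsilon\}$ and $\Omega^*_x:=\{S'_n\ne x\ \forall n\ge1\}$. Let $\Omega^*:=\{S_n\ne0\ \forall n\ge1\}$, $\gamma:=2f_X(0)\,\mathbb P(\Omega^* )$, and let $G:[0,\infty)\to[0,\infty)$ be the continuous function with $G(0)=0$, $G(n)=\sum_{k=1}^n\frac1{A_k}$ for integers $n\ge1$, and affine on each interval $[n,n+1]$, $n\ge0$. Then for every $t>0$, \[ \lim_{\varepsilon\to0}\mathbb P\left(\gamma\,\varepsilon\,G(\tilde\tau^x_\varepsilon)\le t\ \middle|\ \Omega^*_x\right)=\frac{t}{1+t}. \] *)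

(* Defs.v *)
From HB Require Import structures.
From mathcomp Require Import all_boot all_order all_algebra.
From mathcomp Require Import all_classical all_reals all_analysis.
Import Order.TTheory GRing.Theory Num.Theory.
Import numFieldNormedType.Exports.
Set Implicit Arguments.
Unset Strict Implicit.
Unset Printing Implicit Defensive.
Local Open Scope classical_set_scope.
Local Open Scope ring_scope.

Section defs.
Context {R : realType} {d : measure_display} {T : measurableType d}.
Variable P : probability T R.

Definition pr (A : set T) : R := fine (P A).

Definition cond_pr (A B : set T) : R := pr (A `&` B) / pr B.

Definition mutually_independent (X : nat -> T -> R) : Prop :=
  forall (s : seq nat) (B : nat -> set R), uniq s ->
    (forall i, measurable (B i)) ->
    pr (\big[setI/setT]_(i <- s) (X i @^-1` B i)) =
    \prod_(i <- s) pr (X i @^-1` B i).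

Definition identically_distributed (X : nat -> T -> R) : Prop :=
  forall i (B : set R), measurable B -> pr (X i @^-1` B) = pr (X 0%N @^-1` B).

(* Y is independent of the process (S n)_n : independence of sigma(Y) from
   every finite-dimensional cylinder event of S (the generating pi-system of
   sigma(S_n : n >= 0)) *)
Definition indep_of_process (Y : T -> R) (S : nat -> T -> R) : Prop :=
  forall (A : set R) (s : seq nat) (B : nat -> set R), measurable A ->
    (forall i, measurable (B i)) ->
    pr (Y @^-1` A `&` \big[setI/setT]_(i <- s) (S i @^-1` B i)) =
    pr (Y @^-1` A) * pr (\big[setI/setT]_(i <- s) (S i @^-1` B i)).

(* the random walk: walk X n = X_1 + ... + X_n, where X_{i+1} is X i *)
Definition walk (X : nat -> T -> R) (n : nat) (w : T) : R :=
  \sum_(i < n) X i w.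

Definition recurrent (S : nat -> T -> R) : Prop :=
  forall eps : R, 0 < eps ->
    pr [set w | forall N, exists2 n, (N <= n)%N & `|S n w| < eps] = 1.

Definition charfun_re (Y : T -> R) (t : R) : R :=
  Rintegral P setT (fun w => cos (t * Y w)).
Definition charfun_im (Y : T -> R) (t : R) : R :=
  Rintegral P setT (fun w => sin (t * Y w)).

Definition cramer (Y : T -> R) : Prop :=
  exists c : R, c < 1 /\ exists M : R, forall t : R, M <= `|t| ->
    Num.sqrt (charfun_re Y t ^+ 2 + charfun_im Y t ^+ 2) <= c.

(* convergence in distribution of Z n to a law with (continuous) density f;
   the limit distribution function is continuous, so every point is a
   continuity point *)
Definition conv_in_distribution (Z : nat -> T -> R) (f : R -> R) : Prop :=
  forall y : R,
    (fun n => pr [set w | Z n w <= y]) @ \oo -->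
      Rintegral lebesgue_measure `]-oo, y]%classic f.

Definition never_hits (S' : nat -> T -> R) (x : R) : set T :=
  [set w | forall n, (1 <= n)%N -> S' n w != x].

Definition first_hit (S' : nat -> T -> R) (x eps : R) (w : T) (m : nat) : Prop :=
  [/\ (1 <= m)%N, `|S' m w - x| < eps &
      forall k, (1 <= k)%N -> (k < m)%N -> eps <= `|S' k w - x|].

End defs.

Section stable.
Context {R : realType}.

(* f is the (continuous) density of a stable law of index alpha = 1:
   its characteristic function is
   exp(i mu t - sigma |t| (1 + i beta (2/pi) sgn(t) ln|t|)),
   with sigma > 0, beta in [-1,1], mu real. *)
Definition stable1_density (f : R -> R) : Prop :=
  [/\ (forall x, 0 <= f x), continuous f,
      lebesgue_measure.-integrable setT (EFin \o f) &
      exists sigma beta mu : R,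
        [/\ 0 < sigma, -1 <= beta <= 1 &
          forall t : R,
            Rintegral lebesgue_measure setT (fun x => cos (t * x) * f x) =
              expR (- (sigma * `|t|)) *
              cos (mu * t - sigma * beta * (2 / pi) * t * ln `|t|) /\
            Rintegral lebesgue_measure setT (fun x => sin (t * x) * f x) =
              expR (- (sigma * `|t|)) *
              sin (mu * t - sigma * beta * (2 / pi) * t * ln `|t|)]].

Definition Gnat (A : nat -> R) (n : nat) : R := \sum_(1 <= k < n.+1) (A k)^-1.

(* G : [0,oo) -> [0,oo), G(0) = 0, G(n) = Gnat A n, affine on [n, n+1];
   (value 0 on negative arguments, which are never used) *)
Definition Gfun (A : nat -> R) (s : R) : R :=
  if s < 0 then 0 else
  let n := Num.truncn s in
  Gnat A n + (s - n%:R) * (Gnat A n.+1 - Gnat A n).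

End stable.

(* Main.v *)
(** Write S for the walk, F = f(0), and let h_k be the probability that
    |S'_k - x| < eps.  Comparing S_2n with two independent copies of S_n shows
    that A_(2n) ~ 2 A_n and that the limit law has no logarithmic term, so it
    is a Cauchy law.  Fourier inversion against Cauchy kernels (whose symbols
    exp(-l|t|) are integrable), a domination of |phi(u / A_n)|^n near 0 coming
    from a Potter-type bound, and Cramer's condition away from 0 give a local
    limit theorem with geometrically small error: uniformly in eps <= 1/4,
    h_k = (2 F + o(1)) eps / A_k + O(r^k).  Hence if eps G(N) -> t / gamma,
    then sum_(k <= N) h_k tends to sum_k P(S'_k = x) + 2 F t / gamma, and the
    same holds for the walk started anywhere in the window and counted from
    time 0.  Splitting visits at the first one squeezes P(tau_eps <= N)
    between the quotients of these sums up to N and up to 2N, whose limits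
    agree because G(2N) ~ G(N).  The same first-visit decomposition for exact
    hits gives 1 / sum_(k >= 0) P(S_k = 0) = P(S never returns to 0), and the
    limit becomes (1 - p + t) / (1 + t) with p = P(S' never hits x); removing
    the exact hits leaves p t / (1 + t).  That p > 0 holds because the walk can first be
    driven far away from 0 without hitting it. *)
Require Import Defs.
From HB Require Import structures.
From mathcomp Require Import all_boot all_order all_algebra.
From mathcomp Require Import all_classical all_reals all_analysis.
From mathcomp Require Import measurable_realfun ring lra zify.
Import Order.TTheory GRing.Theory Num.Theory.
Import numFieldNormedType.Exports.
Set Implicit Arguments.
Unset Strict Implicit.
Unset Printing Implicit Defensive.
Local Open Scope classical_set_scope.
Local Open Scope ring_scope.

(** * Probabilities as real numbers, independence *)

(** The window shrinks while the number of steps grows, so a local limit theorem at fixed width is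
    not enough: the errors must stay small after summation over all k up to N(eps), uniformly in
    eps. An error o(1) eps / A_k is harmless because eps G(N) stays bounded; an error O(r^k) is
    harmless because it is summable and the terms of small k converge one by one to atoms. The
    geometric form comes from smoothing the indicator of a window of half-width h at a scale l
    proportional to h: Cramer's condition leaves an error r^k / l on the smoothed density, and the
    width of the window cancels 1 / l. The relation A_(2n) ~ 2 A_n is read off |phi|^2, whose limit
    exp(-2 s u) does not see the phase and hence not the logarithmic term; only then are phases
    compared. Recurrence acts through the divergence of sum 1 / A_k, which also makes G(2N) ~ G(N).
    Atoms of the step law and an arbitrary start enter through the expected numbers of exact visits,
    which are finite because atoms decay geometrically. *)

Section real_integrable.
Context {R : realType} {d : measure_display} {T : measurableType d}.
Variables (m : {measure set T -> \bar R}) (D : set T).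
Hypothesis mD : measurable D.
Implicit Types f g : T -> R.

Lemma integrable_RZl (k : R) f : m.-integrable D (EFin \o f) ->
  m.-integrable D (EFin \o (fun w => k * f w)).
Proof. by move=> /(integrableZl mD k); apply: eq_integrable => // x _. Qed.

Lemma integrable_RD f g : m.-integrable D (EFin \o f) -> m.-integrable D (EFin \o g) ->
  m.-integrable D (EFin \o (fun w => f w + g w)).
Proof. by move=> /(integrableD mD) h /h; apply: eq_integrable => // x _. Qed.

Lemma integrable_RB f g : m.-integrable D (EFin \o f) -> m.-integrable D (EFin \o g) ->
  m.-integrable D (EFin \o (fun w => f w - g w)).
Proof. by move=> /(integrableB mD) h /h; apply: eq_integrable => // x _. Qed.

Lemma integrable_Rle f g : measurable_fun D f -> m.-integrable D (EFin \o g) ->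
  (forall x, D x -> `|f x| <= g x) -> m.-integrable D (EFin \o f).
Proof.
move=> mf ig fg; apply: (le_integrable mD _ _ ig); first exact/measurable_EFinP.
by move=> x Dx; rewrite /= lee_fin (le_trans (fg _ Dx))// ler_norm.
Qed.

Lemma Rintegral_norm_le f g : measurable_fun D f -> m.-integrable D (EFin \o g) ->
  (forall x, D x -> `|f x| <= g x) -> `|Rintegral m D f| <= Rintegral m D g.
Proof.
move=> mf ig fg; have if_ := integrable_Rle mf ig fg.
apply: (le_trans (le_normr_Rintegral mD if_)); apply: le_Rintegral => //.
apply: (@integrable_Rle _ g) => //; first exact: measurableT_comp.
by move=> x Dx; rewrite normr_id fg.
Qed.

Lemma Rdominated_cvg (f_ : nat -> T -> R) f g :
  (forall n, measurable_fun D (f_ n)) -> measurable_fun D f ->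
  (forall x, D x -> f_ n x @[n --> \oo] --> f x) ->
  m.-integrable D (EFin \o g) -> (forall n x, D x -> `|f_ n x| <= g x) ->
  Rintegral m D (f_ n) @[n --> \oo] --> Rintegral m D f.
Proof.
move=> mf_ mf f_f ig f_g.
have mEf_ n : measurable_fun D (EFin \o f_ n) by exact/measurable_EFinP.
have mEf : measurable_fun D (EFin \o f) by exact/measurable_EFinP.
have [||i_f _ h] := @dominated_convergence _ _ _ m D mD (fun n => EFin \o f_ n)
  (EFin \o f) (EFin \o g) mEf_ mEf _ ig _.
- by apply: aeW => x Dx /=; apply: cvg_EFin; [exact: nearW|exact: f_f].
- by apply: aeW => x n Dx /=; rewrite lee_fin f_g.
apply: fine_cvg; move: h; rewrite /= => h.
by rewrite fineK//; exact: integrable_fin_num.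
Qed.

End real_integrable.

Section bounded_integral.
Context {R : realType} {d : measure_display} {T : measurableType d}.
Variable P : probability T R.

Lemma integrable_of_bound (m : {measure set T -> \bar R}) (D : set T)
    (g : T -> R) (M : R) : measurable D -> (m D < +oo)%E ->
  measurable_fun D g -> (forall w, `|g w| <= M) -> m.-integrable D (EFin \o g).
Proof.
move=> mD mDoo mg gM; apply: measurable_bounded_integrable => //.
exists M; split; first exact: num_real.
by move=> x Mx w _ /=; rewrite (le_trans (gM w))// ltW.
Qed.

Lemma prob_integrable (g : T -> R) (M : R) :
  measurable_fun setT g -> (forall w, `|g w| <= M) -> P.-integrable setT (EFin \o g).
Proof.
move=> mg gM; apply: (integrable_of_bound _ _ mg gM) => //.
by rewrite ltey_eq fin_num_measure.
Qed.

Lemma prE (A : set T) : measurable A -> (pr P A)%:E = P A.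
Proof. by move=> mA; rewrite /pr fineK// fin_num_measure. Qed.

Lemma pr_ge0 (A : set T) : 0 <= pr P A.
Proof. exact: fine_ge0. Qed.

Lemma pr_setT : pr P setT = 1.
Proof. by rewrite /pr probability_setT. Qed.

Lemma pr_set0 : pr P set0 = 0.
Proof. by rewrite /pr measure0. Qed.

Lemma le_pr (A B : set T) : measurable A -> measurable B -> A `<=` B ->
  pr P A <= pr P B.
Proof.
by move=> mA mB AB; rewrite -lee_fin !prE//; apply: le_measure => //; rewrite inE.
Qed.

Lemma pr_le1 (A : set T) : measurable A -> pr P A <= 1.
Proof. by move=> mA; rewrite -lee_fin prE// probability_le1. Qed.

Lemma pr_setU (A B : set T) : measurable A -> measurable B -> A `&` B = set0 ->
  pr P (A `|` B) = pr P A + pr P B.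
Proof.
move=> mA mB AB; apply: EFin_inj; rewrite EFinD !prE//; last exact: measurableU.
by rewrite measureU.
Qed.

Lemma pr_setC (A : set T) : measurable A -> pr P (~` A) = 1 - pr P A.
Proof.
move=> mA; apply: EFin_inj; rewrite prE; last exact: measurableC.
by rewrite probability_setC// EFinB prE.
Qed.

Lemma pr_setIC (A B : set T) : measurable A -> measurable B ->
  pr P (A `&` ~` B) = pr P A - pr P (A `&` B).
Proof.
move=> mA mB; apply/eqP; rewrite eq_sym subr_eq -pr_setU.
- by rewrite -setIUr setUC setUv setIT.
- by apply: measurableI => //; exact: measurableC.
- exact: measurableI.
- by rewrite setIACA setICl setI0.
Qed.

Lemma pr_bigcup_cvg (F : nat -> set T) : (forall n, measurable (F n)) ->
  {homo F : n m / (n <= m)%N >-> n `<=` m} ->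
  pr P (F n) @[n --> \oo] --> pr P (\bigcup_n F n).
Proof.
move=> mF ndF; have mU : measurable (\bigcup_n F n) by exact: bigcupT_measurable.
rewrite /pr; apply: fine_cvg; rewrite fineK ?fin_num_measure//.
by apply: (@nondecreasing_cvg_mu _ _ _ P) => // n m nm; apply/subsetPset/ndF.
Qed.

Lemma pr_bigcap_cvg (F : nat -> set T) : (forall n, measurable (F n)) ->
  {homo F : n m / (n <= m)%N >-> m `<=` n} ->
  pr P (F n) @[n --> \oo] --> pr P (\bigcap_n F n).
Proof.
move=> mF niF; have mU : measurable (\bigcap_n F n) by exact: bigcapT_measurable.
rewrite /pr; apply: fine_cvg; rewrite fineK ?fin_num_measure//.
apply: (@nonincreasing_cvg_mu _ _ _ P) => //; last first.
  by move=> n m nm; apply/subsetPset/niF.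
by rewrite ltey_eq fin_num_measure.
Qed.

Lemma pr_sum (F : nat -> set T) (s : seq nat) : uniq s ->
  (forall n, measurable (F n)) -> trivIset setT F ->
  pr P (\big[setU/set0]_(i <- s) F i) = \sum_(i <- s) pr P (F i).
Proof.
move=> us mF tF; elim: s us => [|a s IH] /=; first by rewrite !big_nil pr_set0.
move=> /andP[as_ us]; rewrite !big_cons -IH// pr_setU//.
  by apply: bigsetU_measurable.
rewrite big_distrr/= big_seq big1// => i si; move/trivIsetP : tF; apply => //.
by apply/eqP => ai; move: as_; rewrite ai si.
Qed.

Lemma pr_bigsetU_le (F : nat -> set T) (s : seq nat) :
  (forall n, measurable (F n)) ->
  pr P (\big[setU/set0]_(i <- s) F i) <= \sum_(i <- s) pr P (F i).
Proof.
move=> mF; elim: s => [|a s IH]; first by rewrite !big_nil pr_set0.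
rewrite !big_cons; have mB : measurable (\big[setU/set0]_(i <- s) F i).
  exact: bigsetU_measurable.
apply: le_trans (_ : pr P (F a) + pr P (\big[setU/set0]_(i <- s) F i) <= _).
  rewrite -lee_fin EFinD !prE//; last exact: measurableU.
  exact: measureU2.
by rewrite lerD2l.
Qed.

Lemma prI0_sum (F : nat -> set T) (A : set T) (s : seq nat) : uniq s ->
  measurable A -> (forall n, measurable (F n)) -> trivIset setT F ->
  pr P (A `&` \big[setU/set0]_(i <- s) F i) = \sum_(i <- s) pr P (A `&` F i).
Proof.
move=> us mA mF tF; rewrite big_distrr/= -pr_sum//.
- by move=> n; exact: measurableI.
- exact: trivIset_setIl.
Qed.

Lemma Rintegral_indic (A : set T) : measurable A ->
  Rintegral P setT (fun w => (\1_A w : R)) = pr P A.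
Proof. by move=> mA; rewrite /Rintegral integral_indic// setIT. Qed.

Lemma normr_indic_le1 (U : Type) (A : set U) (x : U) : `|\1_A x : R| <= 1.
Proof. by rewrite indicE; case: (_ \in _); rewrite ?normr1 ?normr0. Qed.

Lemma Rintegral_prob_cst (c : R) : Rintegral P setT (fun=> c) = c.
Proof. by rewrite Rintegral_cst// (_ : fine _ = 1) ?mulr1//; exact: pr_setT. Qed.

Lemma Rintegral_prob_bound (g : T -> R) (M : R) : measurable_fun setT g ->
  (forall w, `|g w| <= M) -> `|Rintegral P setT g| <= M.
Proof.
move=> mg gM; have ig := prob_integrable mg gM.
apply: (le_trans (le_normr_Rintegral _ ig)) => //.
rewrite -[leRHS]Rintegral_prob_cst; apply: le_Rintegral => //.
- by apply: (@prob_integrable _ M) => [|w]; [exact: measurableT_comp|rewrite normr_id].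
- by apply: (@prob_integrable _ `|M|).
Qed.

End bounded_integral.

Lemma pr_setU_le {R : realType} {d : measure_display} {T : measurableType d}
  (P : probability T R) (E1 E2 : set T) : measurable E1 -> measurable E2 ->
  pr P (E1 `|` E2) <= pr P E1 + pr P E2.
Proof.
move=> m1 m2; rewrite -lee_fin EFinD !prE//; last exact: measurableU.
exact: measureU2.
Qed.

Lemma measurable_preimage d d' (T : measurableType d) (T' : measurableType d')
    (f : T -> T') D : measurable_fun setT f -> measurable D -> measurable (f @^-1` D).
Proof. by move=> mf mD; rewrite -[X in measurable X]setTI; exact: mf. Qed.

(** * Independence of generated σ-algebras and product laws *)

Section independence.
Context {R : realType} {d : measure_display} {T : measurableType d}.
Variable P : probability T R.

(** Dynkin's π-λ argument with [B] frozen: the events independent of [B] form a λ-system.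
    Measurability travels along in the conclusion because the difference and union steps of the
    λ-system need it. *)
Lemma indep_sigma_l (C : set (set T)) (B : set T) : setI_closed C ->
  C `<=` measurable -> measurable B ->
  (forall A, C A -> pr P (A `&` B) = pr P A * pr P B) ->
  forall A, <<s C >> A -> measurable A /\ pr P (A `&` B) = pr P A * pr P B.
Proof.
move=> CI Cm mB CB.
apply: (@lambda_system_subset _ C CI setT
  [set A | measurable A /\ pr P (A `&` B) = pr P A * pr P B]) => //; last first.
  by move=> A CA; split; [exact: Cm|exact: CB].
split => //.
- by split => //; rewrite setTI pr_setT mul1r.
- move=> A1 A2 A21 [mA1 iA1] [mA2 iA2]; split; first exact: measurableD.
  have -> : (A1 `\` A2) `&` B = (A1 `&` B) `&` ~` (A2 `&` B).
    rewrite setDE; apply/seteqP; split => x /=; tauto.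
  rewrite setDE !pr_setIC//; try exact: measurableI.
  rewrite setIACA setIid (_ : A1 `&` A2 = A2) ?iA1 ?iA2 ?mulrBl//.
  by apply/seteqP; split => [x []//|x A2x]; split => //; exact: A21.
- move=> F ndF HF; have mF n : measurable (F n) by case: (HF n).
  split; first exact: bigcupT_measurable.
  rewrite /=; have ndF' n m : (n <= m)%N -> F n `<=` F m by move=> /ndF/subsetPset.
  have h1 : pr P (F n `&` B) @[n --> \oo] --> pr P ((\bigcup_n F n) `&` B).
    rewrite setI_bigcupl; apply: pr_bigcup_cvg => [n|n m nm]; first exact: measurableI.
    by apply: setSI; apply: ndF'.
  have h2 : pr P (F n) * pr P B @[n --> \oo] --> pr P (\bigcup_n F n) * pr P B.
    by apply: cvgM; [exact: pr_bigcup_cvg|exact: cvg_cst].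
  have e : (fun n => pr P (F n `&` B)) = (fun n => pr P (F n) * pr P B).
    by apply/funext => n; case: (HF n).
  by rewrite e in h1; exact: (cvg_unique _ h1 h2).
Qed.

Lemma indep_sigma (C D : set (set T)) : setI_closed C -> setI_closed D ->
  C `<=` measurable -> D `<=` measurable ->
  (forall A B, C A -> D B -> pr P (A `&` B) = pr P A * pr P B) ->
  forall A B, <<s C >> A -> <<s D >> B -> pr P (A `&` B) = pr P A * pr P B.
Proof.
move=> CI DI Cm Dm CD A B sA sB.
have sm : <<s C >> `<=` measurable.
  by apply: smallest_sub => //; exact: sigma_algebra_measurable.
have h B' : D B' -> pr P (B' `&` A) = pr P B' * pr P A.
  move=> DB'; rewrite setIC mulrC.
  by case: (indep_sigma_l CI Cm (Dm _ DB') (fun A' CA' => CD _ _ CA' DB') sA).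
by have [_] := indep_sigma_l DI Dm (sm _ sA) h sB; rewrite setIC mulrC.
Qed.

Definition indep2 d1 d2 (T1 : measurableType d1) (T2 : measurableType d2)
    (U : T -> T1) (V : T -> T2) :=
  forall A B, measurable A -> measurable B ->
    pr P (U @^-1` A `&` V @^-1` B) = pr P (U @^-1` A) * pr P (V @^-1` B).

Section product_law.
Context {d1 d2 : measure_display} {T1 : measurableType d1} {T2 : measurableType d2}.

(** A product measure is determined by its values on rectangles, so both pairs have the same product
    law. Taking for [C] a preimage under addition transfers laws of sums. *)
Lemma indep2_law (U U' : T -> T1) (V V' : T -> T2) :
  measurable_fun setT U -> measurable_fun setT V ->
  measurable_fun setT U' -> measurable_fun setT V' ->
  indep2 U V -> indep2 U' V' ->
  (forall B, measurable B -> pr P (U @^-1` B) = pr P (U' @^-1` B)) ->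
  (forall B, measurable B -> pr P (V @^-1` B) = pr P (V' @^-1` B)) ->
  forall C : set (T1 * T2), measurable C ->
  pr P [set w | C (U w, V w)] = pr P [set w | C (U' w, V' w)].
Proof.
move=> mU mV mU' mV' iUV iUV' UU' VV' C mC.
have mUV (u : T -> T1) (v : T -> T2) : measurable_fun setT u ->
  measurable_fun setT v -> measurable_fun setT (fun w => (u w, v w)).
  by move=> mu mv; exact: measurable_fun_pair.
pose Um : {mfun T >-> T1} := mfun_Sub (mem_set mU).
pose Vm : {mfun T >-> T2} := mfun_Sub (mem_set mV).
have h (u : T -> T1) (v : T -> T2) : measurable_fun setT u -> measurable_fun setT v ->
    indep2 u v -> (forall B, measurable B -> pr P (U @^-1` B) = pr P (u @^-1` B)) ->
    (forall B, measurable B -> pr P (V @^-1` B) = pr P (v @^-1` B)) ->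
    P [set w | C (u w, v w)] = (distribution P Um \x distribution P Vm)%E C.
  move=> mu mv iuv Uu Vv.
  pose W : {mfun T >-> (T1 * T2)%type} := mfun_Sub (mem_set (mUV _ _ mu mv)).
  rewrite (@product_measure_unique _ _ _ _ _ _ _ (distribution P W)) // => A B mA mB.
  transitivity (P ((fun w => (u w, v w)) @^-1` (A `*` B))) => //.
  transitivity (P (U @^-1` A) * P (V @^-1` B))%E => //.
  rewrite -(prE P (measurable_preimage mU mA)) -(prE P (measurable_preimage mV mB)).
  rewrite -(prE P (measurable_preimage (mUV _ _ mu mv) (measurableX mA mB))).
  by rewrite -EFinM Uu// Vv// -iuv.
by rewrite /pr (h U V)// (h U' V').
Qed.

Lemma measurable_Rintegral_section (U : T -> T1) (V : T -> T2) (F : T1 * T2 -> R)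
    (M : R) : measurable_fun setT U -> measurable_fun setT V ->
  measurable_fun setT F -> (forall x, `|F x| <= M) ->
  measurable_fun setT (fun w => Rintegral P setT (fun w' => F (U w, V w'))).
Proof.
move=> mU mV mF FM.
pose Um : {mfun T >-> T1} := mfun_Sub (mem_set mU).
pose Vm : {mfun T >-> T2} := mfun_Sub (mem_set mV).
pose F' : T1 * T2 -> \bar R := fun z => (F z)%:E.
have mEF : measurable_fun setT F' by exact/measurable_EFinP.
have iF : (distribution P Um \x distribution P Vm)%E.-integrable setT F'.
  apply: (integrable_of_bound _ _ mF FM) => //.
  have E1 := product_measure1E (distribution P Um) (distribution P Vm) measurableT measurableT.
  rewrite setXTT in E1.
  apply: (@le_lt_trans _ _ (distribution P Um setT * distribution P Vm setT)%E).
    by rewrite -E1.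
  by rewrite lte_mul_pinfty// ?fin_num_measure// ltey_eq fin_num_measure.
have iFU w : P.-integrable setT (fun w' => (F (U w, V w'))%:E).
  apply: (@prob_integrable _ _ _ P (fun w' => F (U w, V w')) M) => //.
  by apply: (measurableT_comp mF); exact: measurable_fun_pair.
apply/measurable_EFinP.
rewrite (_ : _ \o _ = fubini_F (distribution P Vm) F' \o U).
  apply: measurableT_comp => //.
  exact: (measurable_fubini_F (m1 := distribution P Um)).
apply/funext => w /=; rewrite /fubini_F integral_pushforward//= ?preimage_setT.
- by rewrite fineK//; exact: integrable_fin_num.
- by apply: (measurableT_comp mEF); exact: measurable_fun_pair.
- exact: iFU.
Qed.

(** The joint law is the product of the marginals, so Fubini averages over [V] with [U] frozen; the
    bound [M] supplies all integrability. The Markov property of the walk rests on this. *)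
Lemma indep2_Rintegral (U : T -> T1) (V : T -> T2) (F : T1 * T2 -> R) (M : R) :
  measurable_fun setT U -> measurable_fun setT V -> indep2 U V ->
  measurable_fun setT F -> (forall x, `|F x| <= M) ->
  Rintegral P setT (fun w => F (U w, V w)) =
  Rintegral P setT (fun w => Rintegral P setT (fun w' => F (U w, V w'))).
Proof.
move=> mU mV iUV mF FM.
have mUV : measurable_fun setT (fun w => (U w, V w)) by exact: measurable_fun_pair.
pose Um : {mfun T >-> T1} := mfun_Sub (mem_set mU).
pose Vm : {mfun T >-> T2} := mfun_Sub (mem_set mV).
pose W : {mfun T >-> (T1 * T2)%type} := mfun_Sub (mem_set mUV).
have EW A : measurable A -> (distribution P Um \x distribution P Vm)%E A = distribution P W A.
  move=> mA; apply: product_measure_unique => // B D mB mD.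
  transitivity (P ((fun w => (U w, V w)) @^-1` (B `*` D))) => //.
  transitivity (P (U @^-1` B) * P (V @^-1` D))%E => //.
  rewrite -(prE P (measurable_preimage mU mB)) -(prE P (measurable_preimage mV mD)).
  rewrite -(prE P (measurable_preimage mUV (measurableX mB mD))).
  by rewrite -EFinM -iUV.
pose F' : T1 * T2 -> \bar R := fun z => (F z)%:E.
have mEF : measurable_fun setT F' by exact/measurable_EFinP.
have iF : (distribution P Um \x distribution P Vm)%E.-integrable setT F'.
  apply: (integrable_of_bound _ _ mF FM) => //.
  have EWT := EW setT measurableT.
  by rewrite /= -/(setT) in EWT *; rewrite EWT ltey_eq fin_num_measure.
have iFW : P.-integrable setT (fun w => (F (U w, V w))%:E).
  apply: (@prob_integrable _ _ _ P (fun w => F (U w, V w)) M) => //.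
  exact: measurableT_comp mF mUV.
have iFU w : P.-integrable setT (fun w' => (F (U w, V w'))%:E).
  apply: (@prob_integrable _ _ _ P (fun w' => F (U w, V w')) M) => //.
  by apply: (measurableT_comp mF); exact: measurable_fun_pair.
transitivity (fine (\int[distribution P W]_z F' z)).
  congr fine; rewrite /distribution integral_pushforward//= preimage_setT//.
congr fine.
rewrite (eq_measure_integral (distribution P Um \x distribution P Vm)%E); last first.
  by move=> A mA _; first [exact: EW|exact/esym/EW].
rewrite -integral12_prod_meas1// /distribution.
rewrite integral_pushforward//=.
- rewrite preimage_setT; apply: eq_integral => w _ /=.
  rewrite /fubini_F integral_pushforward//= ?preimage_setT.
  + by rewrite fineK//; exact: integrable_fin_num.
  + by apply: (measurableT_comp mEF); exact: measurable_fun_pair.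
  + exact: iFU.
- exact: (measurable_fubini_F (m1 := distribution P Um)).
- rewrite preimage_setT.
  pose g w := Rintegral P setT (fun w' => F (U w, V w')).
  have gE : fubini_F (distribution P Vm) F' \o U = EFin \o g.
    apply/funext => w /=; rewrite /fubini_F integral_pushforward//= ?preimage_setT.
    + by rewrite fineK//; exact: integrable_fin_num.
    + by apply: (measurableT_comp mEF); exact: measurable_fun_pair.
    + exact: iFU.
  rewrite gE; apply: (@prob_integrable _ _ _ P g M).
    exact: measurable_Rintegral_section mU mV mF FM.
  move=> w; apply: Rintegral_prob_bound => //.
  by apply: (measurableT_comp mF); exact: measurable_fun_pair.
Qed.
End product_law.
End independence.

(** * Cylinder events and the σ-algebras they generate *)

Section cylinders.
Context {R : realType} {d : measure_display} {T : measurableType d}.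
Variable P : probability T R.
Implicit Types (Y : nat -> T -> R) (s : seq nat).

(** A π-system generating σ(Y_i : i in s). Measurability with respect to that σ-algebra is expressed
    by giving the sample space the type [g_sigma_algebraType (cylinders Y s)]. *)
Definition cylinders Y s : set (set T) :=
  [set A | exists2 B : nat -> set R, (forall i, measurable (B i)) &
     A = \big[setI/setT]_(i <- s) (Y i @^-1` B i)].

Lemma cylinders_setI Y s : setI_closed (cylinders Y s).
Proof.
move=> _ _ [B mB ->] [B' mB' ->]; exists (fun i => B i `&` B' i).
  by move=> i; exact: measurableI.
by rewrite -big_split.
Qed.

Lemma cylinders_measurable Y s : (forall i, measurable_fun setT (Y i)) ->
  cylinders Y s `<=` measurable.
Proof.
move=> mY _ [B mB ->]; apply: bigsetI_measurable => i _.
exact: measurable_preimage.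
Qed.

Lemma sigma_cylinders_measurable Y s : (forall i, measurable_fun setT (Y i)) ->
  <<s cylinders Y s >> `<=` measurable.
Proof.
move=> mY; apply: smallest_sub; first exact: sigma_algebra_measurable.
exact: cylinders_measurable.
Qed.

Lemma cylinders_measurable_fun Y s j : j \in s ->
  measurable_fun (setT : set (g_sigma_algebraType (cylinders Y s))) (Y j).
Proof.
move=> js _ B mB; rewrite setTI; apply: sub_sigma_algebra.
exists (fun i => if i == j then B else setT); first by move=> i; case: ifP.
apply/seteqP; split => w /=.
- move=> Bw; elim/big_ind : _ => // i _.
  by rewrite /=; case: eqP => [->|].
- elim: s js => // i s IH; rewrite inE big_cons => /orP[/eqP <-|js].
    by rewrite eqxx => -[].
  by move=> -[_]; exact: IH.
Qed.

Lemma mutually_independent_cylinders Y s1 s2 : mutually_independent P Y ->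
  uniq (s1 ++ s2) -> forall A B, cylinders Y s1 A -> cylinders Y s2 B ->
  pr P (A `&` B) = pr P A * pr P B.
Proof.
move=> iY us _ _ [B1 mB1 ->] [B2 mB2 ->].
(* The index lists are disjoint, so both families of constraints merge into one, to which mutual
   independence applies. *)
pose B i := if i \in s1 then B1 i else B2 i.
have mB i : measurable (B i) by rewrite /B; case: ifP.
have := us; rewrite cat_uniq => /and3P[us1 /hasPn s12 us2].
have e1 : \big[setI/setT]_(i <- s1) (Y i @^-1` B1 i) =
    \big[setI/setT]_(i <- s1) (Y i @^-1` B i).
  by apply: eq_big_seq => i is1; rewrite /B is1.
have e2 : \big[setI/setT]_(i <- s2) (Y i @^-1` B2 i) =
    \big[setI/setT]_(i <- s2) (Y i @^-1` B i).
  by apply: eq_big_seq => i is2; rewrite /B (negbTE (s12 _ is2)).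
by rewrite e1 e2 -big_cat !iY// big_cat.
Qed.

Lemma indep_sigma_cylinders Y s1 s2 : (forall i, measurable_fun setT (Y i)) ->
  mutually_independent P Y -> uniq (s1 ++ s2) ->
  forall A B, <<s cylinders Y s1 >> A -> <<s cylinders Y s2 >> B ->
  pr P (A `&` B) = pr P A * pr P B.
Proof.
move=> mY iY us; apply: indep_sigma.
- exact: cylinders_setI.
- exact: cylinders_setI.
- exact: cylinders_measurable.
- exact: cylinders_measurable.
- exact: mutually_independent_cylinders.
Qed.

Lemma measurable_fun_gsub d' (T' : measurableType d') (G : set (set T)) (f : T -> T') :
  <<s G >> `<=` measurable ->
  measurable_fun (setT : set (g_sigma_algebraType G)) f -> measurable_fun setT f.
Proof.
move=> Gm mf _ B mB; apply: Gm; exact: (mf measurableT B mB).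
Qed.

Lemma sum_cylinders_measurable Y s r : {subset r <= s} ->
  measurable_fun (setT : set (g_sigma_algebraType (cylinders Y s)))
    (fun w => \sum_(i <- r) Y i w).
Proof.
elim: r => [_|j r IH jrs].
  by under eq_fun do rewrite big_nil; exact: measurable_cst.
under eq_fun do rewrite big_cons; apply: measurable_funD.
  by apply: cylinders_measurable_fun; apply: jrs; rewrite mem_head.
by apply: IH => i ir; apply: jrs; rewrite inE ir orbT.
Qed.

End cylinders.

(** * Random walks with an independent starting point *)

Section walks.
Context {R : realType} {d : measure_display} {T : measurableType d}.
Variable P : probability T R.
Implicit Types (X Y : nat -> T -> R) (V : T -> R).

(** The start becomes coordinate 0 and [X i] coordinate i+1, so that V + S_n is a plain sum of n+1
    coordinates and start and steps share one π-system. *)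
Definition prepend V X : nat -> T -> R := fun n => if n is m.+1 then X m else V.

Lemma measurable_walk X n : (forall i, measurable_fun setT (X i)) ->
  measurable_fun setT (walk X n).
Proof. by move=> mX; apply: measurable_sum => i; exact: mX. Qed.

Lemma walkS X n w : walk X n.+1 w = walk X n w + X n w.
Proof. by rewrite /walk big_ord_recr. Qed.

(** The hypothesis on [V] concerns positions of the walk, not steps. A step is the difference of two
    successive positions, so an event on steps lies in the σ-algebra of the positions, to which
    independence extends by the π-λ theorem. *)
Lemma indep_walk_increments V X s (B : nat -> set R) A :
  (forall i, measurable_fun setT (X i)) -> measurable_fun setT V ->
  indep_of_process P V (walk X) -> (forall i, measurable (B i)) -> measurable A ->
  let E := \big[setI/setT]_(i <- s) (X i @^-1` B i) in
  pr P (V @^-1` A `&` E) = pr P (V @^-1` A) * pr P E.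
Proof.
move=> mX mV iV mB mA E.
(* The step of index i needs the positions i and i+1, and i+1 is at most the maximum plus one, hence
   below [n]. *)
pose n := (\max_(i <- s) i).+2.
pose D := cylinders (walk X) (iota 0 n).
have mD : D `<=` measurable.
  by apply: cylinders_measurable => i; exact: measurable_walk.
have sE : <<s D >> E.
  suff : measurable (E : set (g_sigma_algebraType D)) by [].
  rewrite /E big_seq; apply: bigsetI_measurable => i si.
  have iM : (i <= \max_(i <- s) i)%N by exact: leq_bigmax_seq.
  apply: measurable_preimage => //.
  rewrite (_ : X i = fun w => walk X i.+1 w - walk X i w); last first.
    by apply/funext => w; rewrite walkS addrC addKr.
  by apply: measurable_funB; apply: cylinders_measurable_fun;
    rewrite mem_iota /= add0n /n; lia.
have mYA : measurable (V @^-1` A) by exact: measurable_preimage.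
rewrite setIC mulrC; apply: (indep_sigma_l _ mD mYA _ sE).2.
  exact: cylinders_setI.
move=> _ [B' mB' ->]; rewrite setIC mulrC; exact: iV.
Qed.

Lemma prepend_independent V X :
  (forall i, measurable_fun setT (X i)) -> measurable_fun setT V ->
  mutually_independent P X -> indep_of_process P V (walk X) ->
  mutually_independent P (prepend V X).
Proof.
move=> mX mV iX iV s B us mB.
pose r := [seq i.-1 | i <- s & i != 0%N].
have sr : [seq i.+1 | i <- r] = [seq i <- s | i != 0%N].
  rewrite /r -map_comp -[RHS]map_id; apply/eq_in_map => i.
  by rewrite mem_filter => /andP[i0 _] /=; rewrite prednK// lt0n.
have ur : uniq r.
  by rewrite -(map_inj_uniq succn_inj) sr filter_uniq.
have e1 (F : nat -> set T) : \big[setI/setT]_(i <- s) F i =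
    \big[setI/setT]_(i <- s | i == 0%N) F i `&` \big[setI/setT]_(i <- r) F i.+1.
  rewrite (bigID (fun i => i == 0%N)) /=; congr (_ `&` _).
  by rewrite -big_filter -sr big_map.
have e2 (F : nat -> R) : \prod_(i <- s) F i =
    \prod_(i <- s | i == 0%N) F i * \prod_(i <- r) F i.+1.
  rewrite (bigID (fun i => i == 0%N)) /=; congr (_ * _).
  by rewrite -big_filter -sr big_map.
have hr : pr P (\big[setI/setT]_(i <- r) (prepend V X i.+1 @^-1` B i.+1)) =
    \prod_(i <- r) pr P (prepend V X i.+1 @^-1` B i.+1).
  exact: (iX r (fun i => B i.+1)).
rewrite e1 [RHS](e2 (fun i => pr P (prepend V X i @^-1` B i))) -!(big_filter s).
have [s0|s0] := boolP (0%N \in s).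
- have -> : [seq i <- s | i == 0%N] = [:: 0%N].
    by rewrite filter_pred1_uniq.
  rewrite !big_seq1 -hr.
  exact: (@indep_walk_increments V X r (fun i => B i.+1)).
- have -> : [seq i <- s | i == 0%N] = [::].
    by apply/eqP; rewrite -(negbK (_ == _)) -has_filter has_pred1.
  by rewrite !big_nil setTI mul1r.
Qed.

End walks.

(** * Blocks of increments and the Markov property *)

Section blocks.
Context {R : realType} {d : measure_display} {T : measurableType d}.
Variable P : probability T R.
Implicit Types (X Y : nat -> T -> R) (V : T -> R).

Definition block X m n w : R := \sum_(i < n) X (m + i)%N w.

Lemma blockS X m n w : block X m n.+1 w = block X m n w + X (m + n)%N w.
Proof. by rewrite /block big_ord_recr. Qed.

Lemma walk_block X m n w : walk X (m + n) w = walk X m w + block X m n w.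
Proof. by rewrite /walk big_split_ord. Qed.

Lemma block0 X n : block X 0 n = walk X n.
Proof. by apply/funext. Qed.

Lemma measurable_block X m n : (forall i, measurable_fun setT (X i)) ->
  measurable_fun setT (block X m n).
Proof. by move=> mX; apply: measurable_sum => i; exact: mX. Qed.

Lemma block_iota X m n w : block X m n w = \sum_(i <- iota m n) X i w.
Proof. by rewrite /block -[m in iota m n]addn0 iotaDl big_map -val_enum_ord big_map big_enum. Qed.

Lemma indep2_of_sigma (G1 G2 : set (set T)) d1 d2 (T1 : measurableType d1)
    (T2 : measurableType d2) (U : T -> T1) (V : T -> T2) :
  (forall A B, <<s G1 >> A -> <<s G2 >> B -> pr P (A `&` B) = pr P A * pr P B) ->
  measurable_fun (setT : set (g_sigma_algebraType G1)) U ->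
  measurable_fun (setT : set (g_sigma_algebraType G2)) V -> indep2 P U V.
Proof.
move=> G12 mU mV A B mA mB; apply: G12.
- exact: (measurable_preimage mU mA).
- exact: (measurable_preimage mV mB).
Qed.

Lemma indep2_block X m n : (forall i, measurable_fun setT (X i)) ->
  mutually_independent P X -> indep2 P (block X m n) (X (m + n)%N).
Proof.
move=> mX iX.
apply: (@indep2_of_sigma (cylinders X (iota m n)) (cylinders X [:: (m + n)%N])).
- apply: indep_sigma_cylinders => //.
  by rewrite cats1 rcons_uniq mem_iota iota_uniq ltnn andbF.
- rewrite (_ : block X m n = fun w => \sum_(i <- iota m n) X i w); last first.
    by apply/funext => w; rewrite block_iota.
  exact: sum_cylinders_measurable.
- by apply: cylinders_measurable_fun; rewrite mem_head.
Qed.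

Lemma block_law X m n B : (forall i, measurable_fun setT (X i)) ->
  mutually_independent P X -> identically_distributed P X -> measurable B ->
  pr P (block X m n @^-1` B) = pr P (walk X n @^-1` B).
Proof.
move=> mX iX idX mB; elim: n B mB => [|n IH] B mB.
  by congr (pr P _); apply/funext => w; rewrite /block /walk /preimage/= !big_ord0.
have mC : measurable ((fun x : R * R => x.1 + x.2) @^-1` B).
  apply: measurable_preimage => //.
  by apply: measurable_funD; [exact: measurable_fst|exact: measurable_snd].
have h := @indep2_law _ _ _ P _ _ _ _ (block X m n) (walk X n) (X (m + n)%N) (X n)
  (measurable_block m n mX) (mX _) (measurable_walk n mX) (mX _)
  (indep2_block m n mX iX) _ _ _ _ mC.
rewrite (_ : block X m n.+1 @^-1` B = [set w | ((fun x : R * R => x.1 + x.2) @^-1` B)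
  (block X m n w, X (m + n)%N w)]); last first.
  by apply/seteqP; split => w /=; rewrite blockS.
rewrite (_ : walk X n.+1 @^-1` B = [set w | ((fun x : R * R => x.1 + x.2) @^-1` B)
  (walk X n w, X n w)]); last first.
  by apply/seteqP; split => w /=; rewrite walkS.
apply: h => //.
- by rewrite -block0; have := indep2_block 0 n mX iX.
- by move=> D mD; rewrite idX// [RHS]idX.
Qed.

(** History at time n: the start and the n steps of index 0 to n-1, hence n+1 coordinates; it
    determines the positions up to time n. *)
Definition past V X n := cylinders (prepend V X) (iota 0 n.+1).

Lemma past_measurable V X n : (forall i, measurable_fun setT (X i)) ->
  measurable_fun setT V -> <<s past V X n >> `<=` measurable.
Proof. by move=> mX mV; apply: sigma_cylinders_measurable => -[]. Qed.

Lemma past_walk V X n : (forall i, measurable_fun setT (X i)) ->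
  measurable_fun setT V -> forall m, (m <= n)%N ->
  measurable_fun (setT : set (g_sigma_algebraType (past V X n)))
    (fun w => V w + walk X m w).
Proof.
move=> mX mV m mn.
rewrite (_ : (fun w => _) = fun w => \sum_(i <- iota 0 m.+1) prepend V X i w); last first.
  apply/funext => w; rewrite -addn1 addnC iotaD /= big_cons /=; congr (_ + _).
  by rewrite add0n -[1%N]addn0 iotaDl big_map /walk -val_enum_ord big_map big_enum.
by apply: sum_cylinders_measurable => i; rewrite !mem_iota/=; lia.
Qed.

Lemma past_block_indep V X m n A B : (forall i, measurable_fun setT (X i)) ->
  measurable_fun setT V -> mutually_independent P X -> indep_of_process P V (walk X) ->
  <<s past V X m >> A -> measurable B ->
  pr P (A `&` block X m n @^-1` B) = pr P A * pr P (block X m n @^-1` B).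
Proof.
move=> mX mV iX iV sA mB.
have mpY i : measurable_fun setT (prepend V X i) by case: i.
apply: (@indep_sigma_cylinders _ _ _ P (prepend V X) (iota 0 m.+1) (iota m.+1 n)) => //.
- exact: prepend_independent.
- by rewrite -iotaD iota_uniq.
- rewrite (_ : block X m n = fun w => \sum_(i <- iota m.+1 n) prepend V X i w).
    have mS := @sum_cylinders_measurable _ _ _ (prepend V X) _ _ (fun i (h : i \in iota m.+1 n) => h).
    exact: (measurable_preimage mS mB).
  by apply/funext => w; rewrite block_iota -[m.+1]add1n iotaDl big_map.
Qed.

(** Markov property at a fixed time. What gets frozen is the sample point itself, seen through the
    identity map onto the space carrying the past σ-algebra: [A] and [W] are functions of it, and it
    is independent of the next block. *)
Lemma pr_past_block V X m n (A : set T) (W : T -> R) (D : set R) : (forall i, measurable_fun setT (X i)) ->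
  measurable_fun setT V -> mutually_independent P X -> indep_of_process P V (walk X) ->
  <<s past V X m >> A ->
  measurable_fun (setT : set (g_sigma_algebraType (past V X m))) W -> measurable D ->
  let g w := \1_A w * pr P [set w' | D (W w + block X m n w')] in
  measurable_fun setT g /\
  pr P (A `&` [set w | D (W w + block X m n w)]) = Rintegral P setT g.
Proof.
move=> mX mV iX iV sA mW mD.
pose T1 : measurableType _ := g_sigma_algebraType (past V X m).
have pm := past_measurable (n := m) mX mV.
have mU : measurable_fun setT (id : T -> T1).
  by move=> _ B mB; rewrite setTI; exact: pm.
have mZ := measurable_block m n mX.
pose F (z : T1 * R) : R := \1_A z.1 * \1_D (W z.1 + z.2).
have mF : measurable_fun setT F.
  apply: measurable_funM.
    apply: (measurableT_comp (f := \1_A : T1 -> R)); last exact: measurable_fst.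
    exact: measurable_indic.
  apply: (measurableT_comp (f := \1_D : R -> R)); first exact: measurable_indic.
  apply: measurable_funD; last exact: measurable_snd.
  by apply: measurableT_comp; last exact: measurable_fst.
have F1 z : `|F z| <= 1.
  by rewrite normrM mulr_ile1 ?normr_ge0 ?normr_indic_le1.
have iUZ : indep2 P (id : T -> T1) (block X m n).
  by move=> B C mB mC; exact: (@past_block_indep V X m n B C).
have mA : measurable A by exact: pm.
have mWT : measurable_fun setT W by apply: measurable_fun_gsub mW.
have gE w : \1_A w * pr P [set w' | D (W w + block X m n w')] =
    Rintegral P setT (fun w' => F (w, block X m n w')).
  rewrite /F/= RintegralZl//; last first.
    apply: (@prob_integrable _ _ _ P _ 1).
      apply: (measurableT_comp (f := \1_D : R -> R)); first exact: measurable_indic.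
      exact: measurable_funD.
    by move=> w'; exact: normr_indic_le1.
  congr (_ * _); rewrite -Rintegral_indic//.
  rewrite -[X in measurable X]setTI; apply: measurable_funD => //.
split.
  rewrite (_ : (fun w => _) = fun w => Rintegral P setT (fun w' => F (w, block X m n w'))).
    exact: (@measurable_Rintegral_section _ _ _ P _ _ _ _ (id : T -> T1) _ F 1).
  by apply/funext => w; rewrite gE.
under [RHS]eq_Rintegral do rewrite gE.
rewrite -(@indep2_Rintegral _ _ _ P _ _ _ _ (id : T -> T1) (block X m n) F 1)//.
rewrite -Rintegral_indic; last first.
  apply: measurableI => //; rewrite -[X in measurable X]setTI.
  by apply: measurable_funD.
by apply: eq_Rintegral => w _; rewrite /F /= indicI.
Qed.

End blocks.

(** * Characteristic functions and convergence in distribution *)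

Lemma measurable_cos_mul (R : realType) d (T : measurableType d) (t : R) (W : T -> R) : measurable_fun setT W ->
  measurable_fun setT (fun w => cos (t * W w)).
Proof.
move=> mW; apply: (measurableT_comp (f := @cos R)).
  by apply: continuous_measurable_fun; exact: continuous_cos.
by apply: measurable_funM.
Qed.

Lemma measurable_sin_mul (R : realType) d (T : measurableType d) (t : R) (W : T -> R) : measurable_fun setT W ->
  measurable_fun setT (fun w => sin (t * W w)).
Proof.
move=> mW; apply: (measurableT_comp (f := @sin R)).
  by apply: continuous_measurable_fun; exact: continuous_sin.
by apply: measurable_funM.
Qed.

Lemma measurable_cos_scale (R : realType) (t : R) : measurable_fun setT (fun x => cos (t * x)).
Proof. exact: (@measurable_cos_mul _ _ _ t id). Qed.

Lemma measurable_sin_scale (R : realType) (t : R) : measurable_fun setT (fun x => sin (t * x)).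
Proof. exact: (@measurable_sin_mul _ _ _ t id). Qed.

Section charfun.
Context {R : realType} {d : measure_display} {T : measurableType d}.
Variable P : probability T R.
Implicit Types (U V W : T -> R) (t : R).

Lemma normr_cos_le1 (x : R) : `|cos x| <= 1.
Proof. by rewrite ler_norml cos_geN1 cos_le1. Qed.

Lemma normr_sin_le1 (x : R) : `|sin x| <= 1.
Proof. by rewrite ler_norml sin_geN1 sin_le1. Qed.

Lemma integrable_cos_mul t W : measurable_fun setT W ->
  P.-integrable setT (EFin \o (fun w => cos (t * W w))).
Proof.
move=> mW; apply: (@prob_integrable _ _ _ P _ 1); first exact: measurable_cos_mul.
by move=> w; exact: normr_cos_le1.
Qed.

Lemma integrable_sin_mul t W : measurable_fun setT W ->
  P.-integrable setT (EFin \o (fun w => sin (t * W w))).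
Proof.
move=> mW; apply: (@prob_integrable _ _ _ P _ 1); first exact: measurable_sin_mul.
by move=> w; exact: normr_sin_le1.
Qed.

Lemma indep2_Rintegral_mul U V (g h : R -> R) : measurable_fun setT U ->
  measurable_fun setT V -> indep2 P U V ->
  measurable_fun setT g -> measurable_fun setT h ->
  (forall x, `|g x| <= 1) -> (forall x, `|h x| <= 1) ->
  Rintegral P setT (fun w => g (U w) * h (V w)) =
  Rintegral P setT (g \o U) * Rintegral P setT (h \o V).
Proof.
move=> mU mV iUV mg mh g1 h1.
have igU : P.-integrable setT (EFin \o (g \o U)).
  by apply: (@prob_integrable _ _ _ P _ 1) => [|w]; [exact: measurableT_comp|exact: g1].
have ihV : P.-integrable setT (EFin \o (h \o V)).
  by apply: (@prob_integrable _ _ _ P _ 1) => [|w]; [exact: measurableT_comp|exact: h1].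
pose F (z : R * R) := g z.1 * h z.2.
rewrite (@indep2_Rintegral _ _ _ P _ _ _ _ U V F 1)//.
- rewrite -RintegralZr//; apply: eq_Rintegral => w _.
  by rewrite /F /= RintegralZl.
- apply: measurable_funM.
    by apply: measurableT_comp => //; exact: measurable_fst.
  by apply: measurableT_comp => //; exact: measurable_snd.
- by move=> z; rewrite normrM mulr_ile1.
Qed.

Lemma eq_law_Rintegral U V (g : R -> R) (M : R) : measurable_fun setT U ->
  measurable_fun setT V -> measurable_fun setT g -> (forall x, `|g x| <= M) ->
  (forall B, measurable B -> pr P (U @^-1` B) = pr P (V @^-1` B)) ->
  Rintegral P setT (g \o U) = Rintegral P setT (g \o V).
Proof.
move=> mU mV mg gM UV.
have h W (mW : measurable_fun setT W) : Rintegral P setT (g \o W) =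
    fine (\int[distribution P (mfun_Sub (mem_set mW))]_x (g x)%:E).
  rewrite /distribution integral_pushforward//= ?preimage_setT//.
    exact/measurable_EFinP.
  apply: (@prob_integrable _ _ _ P _ M) => [|w]; last exact: gM.
  exact: measurableT_comp.
rewrite (h _ mU) (h _ mV); congr fine; apply: eq_measure_integral => B mB _.
transitivity (P (U @^-1` B)) => //; transitivity (P (V @^-1` B)) => //.
by rewrite -!(prE P (measurable_preimage _ mB))// UV.
Qed.

Local Notation re := (charfun_re P).
Local Notation im := (charfun_im P).

Lemma charfun_reD U V t : measurable_fun setT U -> measurable_fun setT V ->
  indep2 P U V -> re (fun w => U w + V w) t = re U t * re V t - im U t * im V t.
Proof.
move=> mU mV iUV; rewrite /charfun_re /charfun_im.
rewrite -(@indep2_Rintegral_mul U V (fun x => cos (t * x)) (fun x => cos (t * x)))//;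
  try (by move=> x; exact: normr_cos_le1); try exact: measurable_cos_scale.
rewrite -(@indep2_Rintegral_mul U V (fun x => sin (t * x)) (fun x => sin (t * x)))//;
  try (by move=> x; exact: normr_sin_le1); try exact: measurable_sin_scale.
rewrite -RintegralB//.
- by apply: eq_Rintegral => w _; rewrite mulrDr cosD.
- apply: (@prob_integrable _ _ _ P _ 1).
    by apply: measurable_funM; exact: measurable_cos_mul.
  by move=> w; rewrite normrM mulr_ile1 ?normr_cos_le1.
- apply: (@prob_integrable _ _ _ P _ 1).
    by apply: measurable_funM; exact: measurable_sin_mul.
  by move=> w; rewrite normrM mulr_ile1 ?normr_sin_le1.
Qed.

Lemma charfun_imD U V t : measurable_fun setT U -> measurable_fun setT V ->
  indep2 P U V -> im (fun w => U w + V w) t = im U t * re V t + re U t * im V t.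
Proof.
move=> mU mV iUV; rewrite /charfun_re /charfun_im.
rewrite -(@indep2_Rintegral_mul U V (fun x => sin (t * x)) (fun x => cos (t * x)))//;
  try (by move=> x; (exact: normr_cos_le1 || exact: normr_sin_le1));
  try exact: measurable_cos_scale; try exact: measurable_sin_scale.
rewrite -(@indep2_Rintegral_mul U V (fun x => cos (t * x)) (fun x => sin (t * x)))//;
  try (by move=> x; (exact: normr_cos_le1 || exact: normr_sin_le1));
  try exact: measurable_cos_scale; try exact: measurable_sin_scale.
rewrite -RintegralD//.
- by apply: eq_Rintegral => w _; rewrite mulrDr sinD.
- apply: (@prob_integrable _ _ _ P _ 1).
    by apply: measurable_funM; [exact: measurable_sin_mul|exact: measurable_cos_mul].
  by move=> w; rewrite normrM mulr_ile1 ?normr_sin_le1 ?normr_cos_le1.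
- apply: (@prob_integrable _ _ _ P _ 1).
    by apply: measurable_funM; [exact: measurable_cos_mul|exact: measurable_sin_mul].
  by move=> w; rewrite normrM mulr_ile1 ?normr_sin_le1 ?normr_cos_le1.
Qed.

(** |phi(t)|^2: multiplicative over independent sums and blind to the phase, hence to the centring
    and the logarithmic term of the limit law. *)
Definition charfun_sq W t := re W t ^+ 2 + im W t ^+ 2.

Lemma charfun_sq_ge0 W t : 0 <= charfun_sq W t.
Proof. by rewrite addr_ge0 ?sqr_ge0. Qed.

Lemma charfun_sqD U V t : measurable_fun setT U -> measurable_fun setT V ->
  indep2 P U V -> charfun_sq (fun w => U w + V w) t = charfun_sq U t * charfun_sq V t.
Proof. by move=> mU mV iUV; rewrite /charfun_sq charfun_reD// charfun_imD//; ring. Qed.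

(** Write the characteristic function as (a, b). Then r = a^2 + b^2 is the mean of a cos + b sin,
    which is pointwise at most (a^2 + b^2 + 1) / 2 since cos^2 + sin^2 = 1; so r <= (r + 1) / 2. *)
Lemma charfun_sq_le1 W t : measurable_fun setT W -> charfun_sq W t <= 1.
Proof.
move=> mW; set r := charfun_sq W t.
suff : r <= (r + 1) / 2 by lra.
have rE : r = Rintegral P setT (fun w => re W t * cos (t * W w) + im W t * sin (t * W w)).
  rewrite RintegralD//; last 2 first.
  - by apply: integrable_RZl => //; exact: integrable_cos_mul.
  - by apply: integrable_RZl => //; exact: integrable_sin_mul.
  rewrite !RintegralZl//; try exact: integrable_sin_mul; try exact: integrable_cos_mul.
have mh : measurable_fun setT (fun w => re W t * cos (t * W w) + im W t * sin (t * W w)).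
  apply: measurable_funD; apply: measurable_funM => //.
    exact: measurable_cos_mul.
  exact: measurable_sin_mul.
have hM w : `|re W t * cos (t * W w) + im W t * sin (t * W w)| <= (r + 1) / 2.
  have := cos2Dsin2 (t * W w); rewrite /r /charfun_sq.
  set c := cos _; set s := sin _; set a := re _ _; set b := im _ _ => cs.
  have h1 := sqr_ge0 (a - c); have h2 := sqr_ge0 (b - s).
  have h3 := sqr_ge0 (a + c); have h4 := sqr_ge0 (b + s).
  rewrite !expr2 in cs h1 h2 h3 h4 *.
  by rewrite ler_norml; apply/andP; split; nra.
by rewrite [leLHS]rE; apply: le_trans (ler_norm _) _; exact: Rintegral_prob_bound.
Qed.

Lemma normr_charfun_re_le U t : `|re U t| <= Num.sqrt (charfun_sq U t).
Proof. by rewrite -sqrtr_sqr ler_sqrt ?charfun_sq_ge0// lerDl sqr_ge0. Qed.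

(** The characteristic function of the symmetrised variable U - V is real and equals |phi|^2; this
    carries the doubling inequality for real parts over to |phi|^2. *)
Lemma charfun_sq_symm U V t : measurable_fun setT U -> measurable_fun setT V ->
  indep2 P U V -> (forall B, measurable B -> pr P (U @^-1` B) = pr P (V @^-1` B)) ->
  charfun_sq U t = re (fun w => U w - V w) t.
Proof.
move=> mU mV iUV UV.
have eR : re U t = re V t.
  exact: (eq_law_Rintegral mU mV (measurable_cos_scale t) (fun=> normr_cos_le1 _) UV).
have eI : im U t = im V t.
  exact: (eq_law_Rintegral mU mV (measurable_sin_scale t) (fun=> normr_sin_le1 _) UV).
have mV' : measurable_fun setT (fun w => - V w) by exact: measurableT_comp.
have iUV' : indep2 P U (fun w => - V w).
  move=> A B mA mB; apply: (iUV A (-%R @^-1` B)) => //.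
  by apply: measurable_preimage => //; exact: oppr_measurable.
have reN : re (fun w => - V w) t = re V t.
  by apply: eq_Rintegral => w _; rewrite mulrN cosN.
have imN : im (fun w => - V w) t = - im V t.
  rewrite /charfun_im -mulN1r -RintegralZl//; last exact: integrable_sin_mul.
  by apply: eq_Rintegral => w _; rewrite mulrN sinN mulN1r.
by rewrite charfun_reD// reN imN /charfun_sq eR eI; ring.
Qed.

(* from 1 - cos(2a) <= 4(1 - cos a) *)
Lemma charfun_re_double W t : measurable_fun setT W ->
  1 - re W (2 * t) <= 4 * (1 - re W t).
Proof.
move=> mW; rewrite /charfun_re.
have ic s := integrable_cos_mul s mW.
have i1 : P.-integrable setT (EFin \o (fun=> 1)).
  by apply: (@prob_integrable _ _ _ P _ 1) => // w; rewrite normr1.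
have E1 s : 1 - Rintegral P setT (fun w => cos (s * W w)) =
    Rintegral P setT (fun w => 1 - cos (s * W w)).
  by rewrite RintegralB// Rintegral_prob_cst.
rewrite !E1 -RintegralZl//; last first.
  exact: integrable_RB.
apply: le_Rintegral => //.
- exact: integrable_RB.
- by apply: integrable_RZl => //; apply: (integrableB _ i1 (ic t)).
- move=> w _; rewrite -mulrA mulr2n mulrDl mul1r cosD -!expr2.
  have := cos2Dsin2 (t * W w); have := cos_le1 (t * W w).
  by set c := cos _; set s := sin _; nra.
Qed.

End charfun.

(** * Weak convergence, uniformly over Lipschitz functions *)

Section step_approximation.
Context {R : realType}.
Implicit Types (g : R -> R) (y : nat -> R).

(** The indicator of ]-oo, a] as a function of x, reversed with respect to the usual step, so that
    its mean is the distribution function at a. *)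
Definition heaviside (a x : R) : R := (x <= a)%R%:R.

Lemma heaviside_ge0 a x : 0 <= heaviside a x.
Proof. exact: ler0n. Qed.

Lemma heaviside_le1 a x : heaviside a x <= 1.
Proof. by rewrite /heaviside lern1 leq_b1. Qed.

Lemma measurable_heaviside a : measurable_fun setT (heaviside a).
Proof.
rewrite (_ : heaviside a = \1_`]-oo, a]); first exact: measurable_indic.
by apply/funext => x; rewrite indicE /heaviside mem_setE in_itv.
Qed.

(** A Riemann-Stieltjes sum for g with mesh k. A point between the end nodes lies in one cell, where
    g moves by at most L k; outside them the sum vanishes and |g| <= 1 is what remains. *)
Lemma step_approx g y (L k : R) N x : 0 <= L -> 0 <= k ->
  (forall u, `|g u| <= 1) -> (forall u v, `|g u - g v| <= L * `|u - v|) ->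
  (forall j, y j.+1 = y j + k) ->
  `|g x - \sum_(j < N) g (y j) * (heaviside (y j.+1) x - heaviside (y j) x)|
    <= L * k + 1 - heaviside (y N) x + heaviside (y 0%N) x.
Proof.
move=> L0 k0 g1 gL yS; have Lk : 0 <= L * k by exact: mulr_ge0.
have ymono i j : (i <= j)%N -> y i <= y j.
  by move=> /subnK <-; elim: (j - i)%N => // m IH; rewrite addSn yS; lra.
elim: N => [|N IH].
  by rewrite big_ord0 subr0 subrK; apply: (le_trans (g1 x)); lra.
rewrite big_ord_recr /=; have [xN|Nx] := leP x (y N).
  have xN1 : x <= y N.+1 by apply: le_trans xN _; exact: ymono.
  have H1 a : x <= a -> heaviside a x = 1 by rewrite /heaviside => ->.
  by move: IH; rewrite (H1 _ xN) (H1 _ xN1) subrr mulr0 addr0.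
have H0 j : (j <= N)%N -> heaviside (y j) x = 0.
  by move=> jN; rewrite /heaviside leNgt (le_lt_trans _ Nx)// ymono.
rewrite big1 ?add0r; last first.
  by move=> i _; rewrite !H0 ?subrr ?mulr0// ltnW.
rewrite (H0 N)// (H0 0%N)// subr0 addr0 /heaviside.
have [xN1|_] := leP x (y N.+1).
  rewrite mulr1 addrK; apply: le_trans (gL _ _) _; apply: ler_wpM2l => //.
  by rewrite ger0_norm ?subr_ge0 ?(ltW Nx)// lerBlDl -yS.
by rewrite mulr0 !subr0; apply: (le_trans (g1 x)); lra.
Qed.

Section weight.
Context {d : measure_display} {T : measurableType d}.
Variables (m : {measure set T -> \bar R}) (phi Z : T -> R).
Hypothesis mZ : measurable_fun setT Z.
Hypothesis phi0 : forall w, 0 <= phi w.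
Hypothesis iphi : m.-integrable setT (EFin \o phi).
Hypothesis phi1 : Rintegral m setT phi = 1.

Let F u := Rintegral m setT (fun w => heaviside u (Z w) * phi w).

Let mphi : measurable_fun setT phi.
Proof. by apply/measurable_EFinP; exact: measurable_int iphi. Qed.

Lemma integrable_weight (g : R -> R) (M : R) : measurable_fun setT g ->
  (forall u, `|g u| <= M) -> m.-integrable setT (EFin \o (fun w => g (Z w) * phi w)).
Proof.
move=> mg gM; apply: (@integrable_Rle _ _ _ m setT measurableT _ (fun w => M * phi w)).
- by apply: measurable_funM => //; exact: measurableT_comp.
- exact: integrable_RZl.
- by move=> w _; rewrite normrM (ger0_norm (phi0 w)) ler_wpM2r.
Qed.

Let iH u : m.-integrable setT (EFin \o (fun w => heaviside u (Z w) * phi w)).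
Proof.
apply: (@integrable_weight _ 1); first exact: measurable_heaviside.
by move=> x; rewrite ger0_norm ?heaviside_ge0// heaviside_le1.
Qed.

(** Stated for a density [phi] and a map [Z] so as to serve twice: for the law of Z_n, with [phi]
    equal to 1, and for the limit law, with Lebesgue measure, [phi] = f and [Z] the identity. *)
Lemma step_approx_integral g y (L k : R) N : 0 <= L -> 0 <= k ->
  measurable_fun setT g ->
  (forall u, `|g u| <= 1) -> (forall u v, `|g u - g v| <= L * `|u - v|) ->
  (forall j, y j.+1 = y j + k) ->
  `|Rintegral m setT (fun w => g (Z w) * phi w) -
    \sum_(j < N) g (y j) * (F (y j.+1) - F (y j))| <= L * k + 1 - F (y N) + F (y 0%N).
Proof.
move=> L0 k0 mg g1 gL yS.
have ig : m.-integrable setT (EFin \o (fun w => g (Z w) * phi w)).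
  exact: (@integrable_weight _ 1).
have sumE n : m.-integrable setT (EFin \o (fun w =>
      \sum_(j < n) g (y j) * (heaviside (y j.+1) (Z w) - heaviside (y j) (Z w)) * phi w)) /\
    Rintegral m setT (fun w =>
      \sum_(j < n) g (y j) * (heaviside (y j.+1) (Z w) - heaviside (y j) (Z w)) * phi w) =
    \sum_(j < n) g (y j) * (F (y j.+1) - F (y j)).
  elim: n => [|n [IH1 IH2]].
    under eq_fun do rewrite big_ord0.
    rewrite big_ord0; split; last by rewrite /Rintegral integral0_eq.
    apply: (@integrable_Rle _ _ _ m setT measurableT _ phi) => // w _.
    by rewrite normr0.
  have e w : \sum_(j < n.+1) g (y j) * (heaviside (y j.+1) (Z w) - heaviside (y j) (Z w)) * phi w
    = \sum_(j < n) g (y j) * (heaviside (y j.+1) (Z w) - heaviside (y j) (Z w)) * phi w +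
      g (y n) * (heaviside (y n.+1) (Z w) * phi w - heaviside (y n) (Z w) * phi w).
    by rewrite big_ord_recr /=; congr (_ + _); ring.
  have il : m.-integrable setT (EFin \o (fun w => g (y n) *
      (heaviside (y n.+1) (Z w) * phi w - heaviside (y n) (Z w) * phi w))).
    by apply: integrable_RZl => //; exact: integrable_RB.
  under eq_fun do rewrite e.
  split; first exact: integrable_RD.
  rewrite RintegralD// IH2 RintegralZl//; last exact: integrable_RB.
  by rewrite RintegralB// big_ord_recr.
have [isum <-] := sumE N.
rewrite -RintegralB//.
have -> : L * k + 1 - F (y N) + F (y 0%N) = Rintegral m setT (fun w =>
    (L * k + 1) * phi w - heaviside (y N) (Z w) * phi w + heaviside (y 0%N) (Z w) * phi w).
  rewrite RintegralD//; last by apply: integrable_RB => //; exact: integrable_RZl.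
  by rewrite RintegralB// ?RintegralZl// ?phi1 ?mulr1//; exact: integrable_RZl.
apply: Rintegral_norm_le => //.
- by apply/measurable_EFinP; apply: (@measurable_int _ _ _ m); exact: integrable_RB.
- by apply: integrable_RD => //; apply: integrable_RB => //; exact: integrable_RZl.
move=> w _; rewrite -mulr_suml -mulrBl normrM (ger0_norm (phi0 w)) -mulrBl -mulrDl.
by apply: ler_wpM2r => //; exact: step_approx.
Qed.

(** Tightness of a single law: the mass outside ]-M, M] is the integral of a function that tends
    pointwise to 0 under the majorant 2 [phi]. *)
Lemma heaviside_tail (e : R) : 0 < e ->
  exists M : nat, 1 - F M%:R + F (- M%:R) <= e.
Proof.
move=> e0.
pose h (n : nat) w := (1 - heaviside n%:R (Z w) + heaviside (- n%:R) (Z w)) * phi w.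
have mh n : measurable_fun setT (h n).
  apply: measurable_funM => //; apply: measurable_funD; first apply: measurable_funB => //.
    by apply: (measurableT_comp (measurable_heaviside _)).
  by apply: (measurableT_comp (measurable_heaviside _)).
have h_phi n w : `|h n w| <= 2 * phi w.
  have := phi0 w; rewrite /h; set p := phi w => p0.
  have := heaviside_ge0 n%:R (Z w); have := heaviside_le1 n%:R (Z w).
  have := heaviside_ge0 (- n%:R) (Z w); have := heaviside_le1 (- n%:R) (Z w).
  set a := heaviside _ _; set b := heaviside _ _ => a1 a0 b1 b0.
  by rewrite normrM (ger0_norm p0) ler_wpM2r// ler_norml; apply/andP; split; lra.
have h0 w : h n w @[n --> \oo] --> 0.
  apply: cvg_near_cst; near=> n.
  have nZ : `|Z w| < n%:R by near: n; exact: nbhs_infty_gtr.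
  move: nZ; rewrite ltr_norml => /andP[n1 n2].
  by rewrite /h /heaviside (ltW n2) leNgt n1 /= subrr add0r mul0r.
have i2phi : m.-integrable setT (EFin \o (fun w => 2 * phi w)) by exact: integrable_RZl.
have hc := @Rdominated_cvg _ _ _ m setT measurableT h (fun=> 0) _ mh
  (measurable_cst _) (fun w _ => h0 w) i2phi (fun n w _ => h_phi n w).
have e1 : Rintegral m setT (fun=> 0 : R) = 0 by rewrite /Rintegral integral0_eq.
rewrite e1 in hc; have /cvgr0_norm_le /(_ _ e0) [M _ hM] := hc.
exists M; have := hM M (leqnn M) => /=; apply: le_trans.
apply: le_trans (ler_norm _).
rewrite /h; under [leRHS]eq_Rintegral do rewrite mulrDl mulrBl mul1r.
by rewrite RintegralD// ?RintegralB// ?phi1//; exact: integrable_RB.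
Unshelve. all: end_near. Qed.

End weight.

(* step functions approximate g with an error depending only on L, which makes
   the convergence uniform over the L-Lipschitz functions *)
Lemma weak_cvg_lipschitz d (T : measurableType d) (P : probability T R)
    (Z : nat -> T -> R) (f : R -> R) : (forall n, measurable_fun setT (Z n)) ->
  (forall x, 0 <= f x) -> lebesgue_measure.-integrable setT (EFin \o f) ->
  Rintegral lebesgue_measure setT f = 1 ->
  conv_in_distribution P Z f ->
  forall L e : R, 0 <= L -> 0 < e -> \forall n \near \oo,
  forall g : R -> R, measurable_fun setT g -> (forall u, `|g u| <= 1) ->
    (forall u v, `|g u - g v| <= L * `|u - v|) ->
  `|Rintegral P setT (g \o Z n) - Rintegral lebesgue_measure setT (fun x => g x * f x)| <= e.
Proof.
move=> mZ f0 i_f f1 cvZ L e L0 e0.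
pose F u := Rintegral lebesgue_measure setT (fun x => heaviside u (@id R x) * f x).
pose Fn n u := Rintegral P setT (fun w => heaviside u (Z n w) * cst 1 w).
have FnE n u : Fn n u = pr P [set w | Z n w <= u].
  rewrite /Fn -Rintegral_indic; last first.
    rewrite -[X in measurable X]setTI -[X in _ `&` X]/(Z n @^-1` [set x | x <= u]).
    by apply: mZ => //; rewrite -set_itvNyc; exact: measurable_itv.
  by apply: eq_Rintegral => w _; rewrite mulr1 indicE /heaviside mem_setE.
have FE u : F u = Rintegral lebesgue_measure `]-oo, u]%classic f.
  rewrite [RHS]Rintegral_mkcond; apply: eq_Rintegral => x _.
  rewrite /patch mem_setE in_itv/= /heaviside.
  by case: (x <= u); rewrite ?mul1r ?mul0r.
have cvF u : Fn n u @[n --> \oo] --> F u.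
  by under eq_fun do rewrite FnE; rewrite FE; exact: cvZ.
have e8 : 0 < e / 8 by lra.
have mid : measurable_fun [set: measurableTypeR R] (@id R) by exact: measurable_id.
have [M hM'] := heaviside_tail mid f0 i_f f1 e8.
have hM : 1 - F M%:R + F (- M%:R) <= e / 8 := hM'.
(* [N] cells of length [k] cover [-M, M]; as [N] exceeds 16 L M / e, the product L k is at most e /
   8. *)
pose N := (Num.truncn (16 * L * M%:R / e)).+1.
pose k : R := 2 * M%:R / N%:R.
have N0 : 0 < N%:R :> R by rewrite ltr0n.
have k0 : 0 <= k by rewrite /k; apply: divr_ge0; rewrite ?mulr_ge0 ?ler0n.
have Lk : L * k <= e / 8.
  have := truncnS_gt (16 * L * M%:R / e); rewrite -/N ltr_pdivrMr// => h.
  by rewrite /k mulrA ler_pdivrMr//; lra.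
pose y j : R := - M%:R + j%:R * k.
have yS j : y j.+1 = y j + k by rewrite /y -addn1 natrD; ring.
have y0 : y 0%N = - M%:R by rewrite /y mul0r addr0.
have yN : y N = M%:R by rewrite /y /k mulrCA divff ?lt0r_neq0//; ring.
(* Total error of the distribution functions at the finitely many nodes: it tends to 0, does not
   involve [g], and also transfers the tail bound of the limit law to Z_n. *)
pose D n : R := \sum_(j < N.+1) `|Fn n (y j) - F (y j)|.
have cvD : D n @[n --> \oo] --> 0.
  rewrite /D; elim: N.+1 => [|K IH].
    by under eq_fun do rewrite big_ord0; exact: cvg_cst.
  have h0 : Fn n (y K) - F (y K) @[n --> \oo] --> 0 by apply/subr_cvg0; exact: cvF.
  have hN : `|Fn n (y K) - F (y K)| @[n --> \oo] --> `|0 : R| by exact: cvg_norm.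
  rewrite normr0 in hN; under eq_fun do rewrite big_ord_recr /=.
  by have := cvgD IH hN; rewrite addr0; apply.
have e16 : 0 < e / 16 by lra.
have arith (a b s s' l p0 p1 q0 q1 D0 : R) : `|a - s| <= l + 1 - p1 + p0 ->
    `|b - s'| <= l + 1 - q1 + q0 -> `|s - s'| <= 2 * D0 -> `|p1 - q1| <= D0 ->
    `|p0 - q0| <= D0 -> 1 - q1 + q0 <= e / 8 -> l <= e / 8 -> D0 <= e / 16 -> `|a - b| <= e.
  rewrite !ler_norml.
  move=> /andP[? ?] /andP[? ?] /andP[? ?] /andP[? ?] /andP[? ?] ? ? ?.
  by apply/andP; split; lra.
near=> n.
have Dn : D n <= e / 16.
  apply: le_trans (ler_norm _) _; near: n.
  by move/cvgr0_norm_le : cvD => /(_ _ e16).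
have Dj j : (j <= N)%N -> `|Fn n (y j) - F (y j)| <= D n.
  move=> jN; rewrite /D (bigD1 (Ordinal (jN : (j < N.+1)%N)))//= lerDl.
  by apply: sumr_ge0 => i _.
move=> g mg g1 gL.
have c0 (w : T) : 0 <= cst (1 : R) w by [].
have ic1 : P.-integrable setT (EFin \o cst (1 : R)).
  by apply: (@prob_integrable _ _ _ P _ 1) => // w; rewrite normr1.
have A1 : `|Rintegral P setT (fun w => g (Z n w) * cst 1 w) -
    \sum_(j < N) g (y j) * (Fn n (y j.+1) - Fn n (y j))| <= L * k + 1 - Fn n (y N) + Fn n (y 0%N)
  := step_approx_integral (mZ n) c0 ic1 (Rintegral_prob_cst P 1) N L0 k0 mg g1 gL yS.
have A2 : `|Rintegral lebesgue_measure setT (fun x => g x * f x) -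
    \sum_(j < N) g (y j) * (F (y j.+1) - F (y j))| <= L * k + 1 - F (y N) + F (y 0%N)
  := step_approx_integral mid f0 i_f f1 N L0 k0 mg g1 gL yS.
rewrite y0 yN in A1 A2.
have e1 : Rintegral P setT (fun w => g (Z n w) * cst 1 w) = Rintegral P setT (g \o Z n).
  by apply: eq_Rintegral => w _; rewrite /= mulr1.
rewrite e1 in A1.
have A3 : `|\sum_(j < N) g (y j) * (Fn n (y j.+1) - Fn n (y j)) -
    \sum_(j < N) g (y j) * (F (y j.+1) - F (y j))| <= 2 * D n.
  rewrite -sumrB; apply: le_trans (ler_norm_sum _ _ _) _.
  apply: (@le_trans _ _ (\sum_(j < N) (`|Fn n (y j.+1) - F (y j.+1)| + `|Fn n (y j) - F (y j)|))).
    apply: ler_sum => j _; rewrite -mulrBr normrM.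
    rewrite -[leRHS]mul1r; apply: ler_pM => //.
    rewrite (_ : _ - _ = (Fn n (y j.+1) - F (y j.+1)) - (Fn n (y j) - F (y j))); last by ring.
    exact: ler_normB.
  rewrite big_split/= mulr2n mulrDl mul1r; apply: lerD.
    rewrite (_ : D n = `|Fn n (y 0%N) - F (y 0%N)| +
      \sum_(j < N) `|Fn n (y j.+1) - F (y j.+1)|); last by rewrite /D big_ord_recl.
    by rewrite lerDr.
  by rewrite [D n]big_ord_recr /= lerDl.
have B1 := Dj N (leqnn N); have B2 := Dj 0%N (leq0n N).
rewrite y0 in B2; rewrite yN in B1.
clear hM'; exact: (arith _ _ _ _ _ _ _ _ _ _ A1 A2 A3 B1 B2 hM Lk Dn).
Unshelve. all: end_near. Qed.

End step_approximation.

(** * Growth of the norming sequence *)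

Section scaling.
Context {R : realType}.
Variables (q : R -> R) (A : nat -> R) (s : R).
Hypothesis q_ge0 : forall t, 0 <= q t.
Hypothesis q_le1 : forall t, q t <= 1.
Hypothesis q_double : forall t, 1 - q (2 * t) <= 4 * (1 - q t).
Hypothesis q_cramer : exists c M : R, c < 1 /\ forall t, M <= t -> q t <= c.
Hypothesis A_gt0 : forall n, (0 < n)%N -> 0 < A n.
Hypothesis s_gt0 : 0 < s.
Hypothesis q_cvg : forall K e : R, 0 < e ->
  \forall n \near \oo, forall u, 0 <= u -> u <= K ->
  `|q (u / A n) ^+ n - expR (- (2 * s * u))| <= e.

(** Doubling the argument multiplies 1 - q by at most 4, so a value of q close to 1 at some t >= eta
    would force one close to 1 at 2^k t, in the range where Cramer's condition keeps q below c. *)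
Lemma spectral_gap (eta : R) : 0 < eta ->
  exists r : R, [/\ 0 <= r, r < 1 & forall t, eta <= t -> q t <= r].
Proof.
move=> eta0; have [c [M [c1 qc]]] := q_cramer.
have dbl k t : 1 - q (2 ^+ k * t) <= 4 ^+ k * (1 - q t).
  elim: k t => [|k IH] t; first by rewrite !expr0 !mul1r.
  rewrite exprSr -mulrA; apply: (le_trans (IH _)).
  by rewrite exprSr -mulrA ler_wpM2l// exprn_ge0.
(* 2^(k+1) > k+1 > M / eta, so k+1 doublings carry every t >= eta beyond M. *)
pose k := Num.truncn (M / eta).
have Mk t : eta <= t -> M <= 2 ^+ k.+1 * t.
  move=> et; apply: (@le_trans _ _ (k.+1%:R * eta)).
    by rewrite -ler_pdivrMr// ltW// truncnS_gt.
  apply: ler_pM => //; first exact: ltW.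
  by rewrite -natrX ler_nat ltnW// ltn_expl.
have p4 : 0 < 4 ^+ k.+1 :> R by rewrite exprn_gt0.
(* Raising c to at least 0 keeps the final bound r nonnegative. *)
pose c' := Num.max c 0.
have c'1 : c' < 1 by rewrite gt_max c1 ltr01.
exists (1 - (1 - c') / 4 ^+ k.+1); split.
- rewrite subr_ge0 ler_pdivrMr// mul1r; apply: (@le_trans _ _ 1).
    by rewrite lerBlDr lerDl le_max lexx orbT.
  by rewrite exprn_ege1// ler1n.
- by rewrite ltrBlDr ltrDl divr_gt0// subr_gt0.
- move=> t /Mk /qc qt; have := dbl k.+1 t.
  have qt' : q (2 ^+ k.+1 * t) <= c' by rewrite le_max qt.
  move=> h; rewrite lerBrDr -lerBrDl ler_pdivrMr// mulrC.
  by apply: le_trans h; rewrite lerD2l lerN2.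
Qed.

Lemma cvg_geo_lt (r e : R) : 0 <= r -> r < 1 -> 0 < e ->
  \forall n \near \oo, r ^+ n < e.
Proof.
move=> r0 r1 e0; have := @cvg_expr _ r; rewrite ger0_norm// => /(_ r1).
move=> /cvgr0_norm_lt/(_ _ e0); apply: filterS => n.
by rewrite ger0_norm// exprn_ge0.
Qed.

(** Look at u = 1: if A_n <= K for some large n, then 1 / A_n is bounded away from 0 and the gap
    gives q(1 / A_n)^n <= r^n, too small for the limit exp(-2 s). *)
Lemma A_infty (K : R) : \forall n \near \oo, K < A n.
Proof.
have [|r [r0 r1 qr]] := @spectral_gap (1 / (1 + `|K|)).
  by rewrite divr_gt0// ltr_pwDl.
have e0 : 0 < expR (- (2 * s)) / 4 by rewrite divr_gt0// expR_gt0.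
near=> n.
have n0 : (0 < n)%N by near: n; exists 1%N.
have An := A_gt0 n0.
have h1 : `|q (1 / A n) ^+ n - expR (- (2 * s * 1))| <= expR (- (2 * s)) / 4.
  near: n; have := q_cvg 1 e0; apply: filterS => n; apply => //; exact: ler01.
have h2 : r ^+ n < expR (- (2 * s)) / 4 by near: n; exact: cvg_geo_lt.
rewrite ltNge; apply/negP => AK.
have : q (1 / A n) <= r.
  apply: qr; rewrite !div1r lef_pV2 ?posrE// ?ltr_pwDl//.
  by apply: (le_trans AK); apply: (le_trans (ler_norm _)); rewrite lerDr.
move=> /(lerXn2r n (q_ge0 _ : q (1 / A n) \in Num.nneg) r0) h3.
move: h1; rewrite mulr1 ler_norml => /andP[h1 _].
have := expR_gt0 (- (2 * s)); lra.
Unshelve. all: end_near. Qed.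

(** The logarithm of q(u / A_n)^n -> exp(-2 s u), taken through the inequalities x^n <= exp(-n (1 -
    x)) and exp(-(1 - x) / x) <= x. The range [0, 2] is what comparing u <= 1 with 2u requires. *)
Lemma rate_cvg (e : R) : 0 < e -> \forall n \near \oo, forall u, 0 <= u -> u <= 2 ->
  `|n%:R * (1 - q (u / A n)) - 2 * s * u| <= e.
Proof.
move=> e0.
have E1 : 0 < 1 - expR (- e) by rewrite subr_gt0 -expR0 ltr_expR oppr_lt0.
have E2 : 0 < expR (e / 2) - 1 by rewrite subr_gt0 -expR0 ltr_expR divr_gt0.
have E4 : 0 < expR (- (2 * s * 2)) by exact: expR_gt0.
(* Half the least distance, over u <= 2, from exp(-2 s u) to its multiples by exp(-e) and exp(e /
   2); violating either bound would push x^n past one of these multiples. *)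
pose dl := expR (- (2 * s * 2)) * Num.min (1 - expR (- e)) (expR (e / 2) - 1) / 2.
have dl0 : 0 < dl by rewrite divr_gt0// mulr_gt0// lt_min E1.
near=> n.
have n0 : (0 < n)%N by near: n; exists 1%N.
have nR : 0 < n%:R :> R by rewrite ltr0n.
have hq u : 0 <= u -> u <= 2 -> `|q (u / A n) ^+ n - expR (- (2 * s * u))| <= dl.
  by move: u; near: n; exact: q_cvg.
(* For the lower bound: these terms give 1 - x < 1/4 and 4 s (1 - x) <= e / 2, so that replacing 1 -
   x by (1 - x) / x costs at most e / 2. *)
have nbig : 32 * s * s / e + 16 * s + 1 < n%:R by near: n; exact: nbhs_infty_gtr.
move=> u u0 u2; have := hq u u0 u2; set x := q _ => hx.
have x0 : 0 <= x by exact: q_ge0.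
have x1 : x <= 1 by exact: q_le1.
have s2 : 0 <= 2 * s by rewrite mulr_ge0// ltW.
have su4' : 2 * s * u <= 2 * s * 2 by rewrite ler_wpM2l.
have su4 : 2 * s * u <= 4 * s by lra.
have eu : expR (- (2 * s * 2)) <= expR (- (2 * s * u)) by rewrite ler_expR lerN2.
have dlu1 : dl < expR (- (2 * s * u)) * (1 - expR (- e)).
  rewrite /dl; apply: (@lt_le_trans _ _ (expR (- (2 * s * 2)) * (1 - expR (- e)))).
    have : Num.min (1 - expR (- e)) (expR (e / 2) - 1) <= 1 - expR (- e).
      by rewrite ge_min lexx.
    by move=> h; rewrite ltr_pdivrMr// -[ltRHS]mulrA ltr_pM2l//; lra.
  by apply: ler_wpM2r => //; exact: ltW.
have dlu2 : dl < expR (- (2 * s * u)) * (expR (e / 2) - 1).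
  rewrite /dl; apply: (@lt_le_trans _ _ (expR (- (2 * s * 2)) * (expR (e / 2) - 1))).
    have : Num.min (1 - expR (- e)) (expR (e / 2) - 1) <= expR (e / 2) - 1.
      by rewrite ge_min lexx orbT.
    by move=> h; rewrite ltr_pdivrMr// -[ltRHS]mulrA ltr_pM2l//; lra.
  by apply: ler_wpM2r => //; exact: ltW.
have upper : x ^+ n <= expR (- (n%:R * (1 - x))).
  rewrite -mulrN opprB expRM_natl.
  by apply: lerXn2r => //; rewrite ?nnegrE ?expR_ge0//; have := expR_ge1Dx (x - 1); lra.
rewrite ler_norml; apply/andP; split; last first.
  rewrite leNgt; apply/negP => h.
  have : x ^+ n <= expR (- (2 * s * u)) * expR (- e).
    by apply: (le_trans upper); rewrite -expRD ler_expR; lra.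
  move: hx; rewrite ler_norml => /andP[hx _]; lra.
rewrite leNgt; apply/negP => h.
have y0 : 0 <= n%:R * (1 - x) by rewrite mulr_ge0// subr_ge0.
have small : n%:R * (1 - x) < 4 * s by lra.
have ns : 16 * s < n%:R by have : 0 <= 32 * s * s / e; [rewrite divr_ge0//; nra|lra].
have ne : 32 * s * s / e < n%:R by lra.
have x12 : 1 - x < 1 / 4.
  by rewrite -(ltr_pM2l nR); apply: (lt_le_trans small); lra.
have xp : 0 < x by lra.
have lowerx : expR (- ((1 - x) / x)) <= x.
  have := expR_ge1Dx ((1 - x) / x).
  have -> : 1 + (1 - x) / x = x^-1 by field; rewrite gt_eqF.
  by move=> hh; rewrite expRN -[leRHS]invrK lef_pV2 ?posrE ?invr_gt0 ?expR_gt0.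
have lower : expR (- (n%:R * ((1 - x) / x))) <= x ^+ n.
  rewrite -mulrN expRM_natl.
  by apply: lerXn2r => //; rewrite nnegrE ?expR_ge0.
have key : n%:R * ((1 - x) / x) <= 2 * s * u - e / 2.
  rewrite mulrA ler_pdivrMr//.
  have : n%:R * (1 - x) <= 2 * s * u - e by lra.
  have : (1 - x) * (4 * s) <= e / 2.
    rewrite -(ler_pM2l nR) mulrA; apply: (@le_trans _ _ (4 * s * (4 * s))).
      by apply: ler_wpM2r; [rewrite mulr_ge0// ltW|exact: ltW].
    by move: ne; rewrite ltr_pdivrMr//; lra.
  nra.
have : expR (- (2 * s * u)) * expR (e / 2) <= x ^+ n.
  by apply: le_trans lower; rewrite -expRD ler_expR; lra.
move: hx; rewrite ler_norml => /andP[_ hx]; lra.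
Unshelve. all: end_near. Qed.

(** Since n (1 - q(u / A_n)) is close to 2 s u, linear in u, evaluating q at one argument written
    both as u / A_n and as v / A_(m n) compares the two constants. The argument is the inverse of
    the larger one, which keeps u and v at most 1. *)
Lemma ratio_cvg (m : nat -> nat) (r e : R) : 0 < r -> 0 < e ->
  (m n)%:R / n%:R @[n --> \oo] --> r ->
  \forall n \near \oo, `|A (m n) / A n - r| <= e.
Proof.
move=> r0 e0 mr.
(* The bound 1/2 first yields dd <= 4 r + 1; the other one then makes b (1 + dd) at most e / 2. *)
pose b : R := Num.min (1 / 2) (e / (2 * (2 + 4 * r))).
have r4 : 0 < 2 * (2 + 4 * r) by lra.
have b0 : 0 < b by rewrite lt_min !divr_gt0.
have b2 : b <= 1 / 2 by rewrite ge_min lexx.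
have be : b * (2 * (2 + 4 * r)) <= e.
  by rewrite -ler_pdivlMr// ge_min lexx orbT.
pose dl := b * (2 * s) / (1 + 2 * r).
have r2 : 0 < 1 + 2 * r by lra.
have dl0 : 0 < dl by rewrite divr_gt0// mulr_gt0// mulr_gt0.
have mr1 : \forall n \near \oo, `|r - (m n)%:R / n%:R| <= e / 2.
  by move/cvgrPdist_le : mr; apply; rewrite divr_gt0.
have mr2 : \forall n \near \oo, `|r - (m n)%:R / n%:R| <= r / 2.
  by move/cvgrPdist_le : mr; apply; rewrite divr_gt0.
have [N0 _ hN0] := rate_cvg dl0.
near=> n.
have n0 : (0 < n)%N by near: n; exists 1%N.
have nR : 0 < n%:R :> R by rewrite ltr0n.
have rn1 : `|r - (m n)%:R / n%:R| <= e / 2 by near: n.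
have rn2 : `|r - (m n)%:R / n%:R| <= r / 2 by near: n.
have nN0 : (N0 <= n)%N by near: n; exists N0.
have mN : (N0.+1 <= m n)%N.
  rewrite -(ler_nat R); apply: (@le_trans _ _ (n%:R * (r / 2))).
    rewrite -ler_pdivrMr ?divr_gt0//; near: n; exact: nbhs_infty_ger.
  rewrite mulrC -ler_pdivlMr//.
  by move: rn2; rewrite ler_norml => /andP[]; lra.
have m0 : (0 < m n)%N by apply: leq_trans mN.
have An := A_gt0 n0; have Am := A_gt0 m0.
set rn := (m n)%:R / n%:R in rn1 rn2.
have rnb : r / 2 <= rn /\ rn <= 2 * r.
  by move: rn2; rewrite ler_norml => /andP[]; split; lra.
have rn0 : 0 < rn by lra.
have Hn u : 0 <= u -> u <= 2 -> `|n%:R * (1 - q (u / A n)) - 2 * s * u| <= dl.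
  exact: hN0.
have Hm u : 0 <= u -> u <= 2 -> `|(m n)%:R * (1 - q (u / A (m n))) - 2 * s * u| <= dl.
  by apply: hN0; exact: ltnW.
have mE : (m n)%:R = rn * n%:R by rewrite /rn divfK// gt_eqF.
rewrite mE in Hm.
set dd := A (m n) / A n; have d0 : 0 < dd by rewrite divr_gt0.
have one2 : 1 <= 2 :> R by rewrite ler1n.
have bE : dl * (1 + 2 * r) = 2 * s * b by rewrite /dl divfK ?gt_eqF//; ring.
have s2 : 0 < 2 * s by rewrite mulr_gt0.
suff key : `|dd - rn| <= b * (1 + dd).
  have dd4 : dd <= 4 * r + 1.
    have : b * (1 + dd) <= 1 / 2 * (1 + dd) by apply: ler_wpM2r => //; lra.
    by move: key; rewrite ler_norml => /andP[_]; lra.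
  have : `|dd - rn| <= e / 2.
    apply: (le_trans key); apply: (@le_trans _ _ (b * (2 + 4 * r))); last by lra.
    by apply: ler_wpM2l; [exact: ltW|lra].
  move: rn1; rewrite !ler_norml => /andP[? ?] /andP[? ?]; apply/andP; split; lra.
have [c1|c1] := leP dd 1.
- have h1 := Hm dd (ltW d0) (le_trans c1 one2).
  have h2 := Hn 1 ler01 one2.
  have e1 : dd / A (m n) = 1 / A n by rewrite /dd; field; rewrite !gt_eqF.
  rewrite e1 in h1; set H := n%:R * _ in h2.
  have e2 : rn * n%:R * (1 - q (1 / A n)) = rn * H by rewrite /H mulrA.
  rewrite e2 mulr1 in h1 h2.
  have h3 : `|2 * s * dd - 2 * s * rn| <= 2 * s * b.
    have -> : 2 * s * dd - 2 * s * rn = - (rn * H - 2 * s * dd) + (H - 2 * s) * rn by ring.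
    rewrite -bE mulrDr mulr1; apply: le_trans (ler_normD _ _) _.
    rewrite normrN normrM (ger0_norm (ltW rn0)); apply: lerD => //.
    by apply: ler_pM => //; [exact: ltW|exact: rnb.2].
  rewrite -mulrBr normrM (ger0_norm (ltW s2)) ler_pM2l// in h3.
  by apply: (le_trans h3); rewrite ler_peMr ?ltW// ltrDl.
- have c0 : 0 < dd^-1 by rewrite invr_gt0.
  have c1' : dd^-1 <= 1 by rewrite invf_le1// ltW.
  have h1 := Hn dd^-1 (ltW c0) (le_trans c1' one2).
  have h2 := Hm 1 ler01 one2.
  have e1 : dd^-1 / A n = 1 / A (m n) by rewrite /dd; field; rewrite !gt_eqF.
  rewrite e1 in h1; set H := n%:R * _ in h1.
  have e2 : rn * n%:R * (1 - q (1 / A (m n))) = rn * H by rewrite /H mulrA.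
  rewrite e2 mulr1 in h2.
  have h3 : `|2 * s * (rn / dd) - 2 * s| <= 2 * s * b.
    have -> : 2 * s * (rn / dd) - 2 * s = (rn * H - 2 * s) - (H - 2 * s * dd^-1) * rn by ring.
    rewrite -bE mulrDr mulr1; apply: le_trans (ler_normB _ _) _.
    rewrite normrM (ger0_norm (ltW rn0)); apply: lerD => //.
    by apply: ler_pM => //; [exact: ltW|exact: rnb.2].
  have h4 : `|rn / dd - 1| <= b.
    by rewrite -(ler_pM2l s2) -{1}(ger0_norm (ltW s2)) -normrM mulrBr mulr1.
  have -> : dd - rn = - ((rn / dd - 1) * dd) by field; rewrite gt_eqF.
  rewrite normrN normrM (ger0_norm (ltW d0)).
  by apply: ler_pM; rewrite ?normr_ge0 ?(ltW d0)// lerDr.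
Unshelve. all: end_near. Qed.

(** For small t take the last n with A_n <= 1 / t. As A_(n+1) <= 2 A_n for large n, u = t A_n lies
    in ]1/2, 1], where n (1 - q) is within s / 10 of 2 s u at u and of 4 s u at 2u: the ratio 2
    survives as 3/2. *)
Lemma potter : exists2 eta : R, 0 < eta &
  forall t, 0 < t -> t < eta -> 3 / 2 * (1 - q t) <= 1 - q (2 * t).
Proof.
have s10 : 0 < s / 10 by rewrite divr_gt0.
have [N1 _ hN1] := rate_cvg s10.
have rS : (n.+1)%:R / n%:R @[n --> \oo] --> (1 : R).
  have h : 1 + n%:R^-1 @[n --> \oo] --> (1 + 0 : R).
    apply: cvgD; first exact: cvg_cst.
    by apply/gtr0_cvgV0; [near=> n; rewrite ltr0n; near: n; exists 1%N|exact: cvgr_idn].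
  rewrite addr0 in h; apply: cvg_trans h; apply: near_eq_cvg; near=> n.
  have n0 : n%:R != 0 :> R by rewrite pnatr_eq0 -lt0n; near: n; exists 1%N.
  by rewrite -addn1 natrD mulrDl divff// div1r.
have [N2 _ hN2] := ratio_cvg ltr01 ltr01 rS.
pose n0 := (maxn N1 N2).+1.
have An0 : 0 < A n0 by exact: A_gt0.
exists (1 / A n0) => [|t t0 tn0]; first by rewrite divr_gt0.
have [N3 _ hN3] := A_infty t^-1.
have ex : exists n, (n0 <= n)%N && (A n <= t^-1).
  exists n0; rewrite leqnn /= -[A n0]invrK lef_pV2 ?posrE ?invr_gt0//.
  by rewrite ltW// -div1r.
have bd n : (n0 <= n)%N && (A n <= t^-1) -> (n <= N3)%N.
  move=> /andP[_ An]; rewrite leqNgt; apply/negP => /ltnW /hN3 /=.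
  by rewrite ltNge An.
case: (ex_maxnP ex bd) => n /andP[nn0 Ant] nmax.
have nN1 : (N1 <= n)%N by apply: leq_trans nn0; rewrite leqW// leq_maxl.
have nN2 : (N2 <= n)%N by apply: leq_trans nn0; rewrite leqW// leq_maxr.
have npos : (0 < n)%N by apply: leq_trans nn0.
have An := A_gt0 npos; have nR : 0 < n%:R :> R by rewrite ltr0n.
have AnS : t^-1 < A n.+1.
  rewrite ltNge; apply/negP => h; have := nmax n.+1; rewrite h (leqW nn0) => /(_ isT).
  by rewrite ltnn.
have ratio : A n.+1 <= 2 * A n.
  rewrite -ler_pdivrMr//; have := hN2 n nN2; rewrite ler_norml => /andP[_]; lra.
pose u := t * A n.
have u1 : u <= 1 by rewrite /u -ler_pdivlMl// mulr1.
have u2 : 1 < 2 * u.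
  rewrite /u mulrCA -ltr_pdivrMl// mulr1; exact: lt_le_trans ratio.
have tE : t = u / A n by rewrite /u mulfK// gt_eqF.
have t2E : 2 * t = (2 * u) / A n by rewrite {1}tE mulrA.
have u0 : 0 <= u by rewrite mulr_ge0 ?ltW.
have h1 := hN1 n nN1 u u0 (le_trans u1 (ler1n _ _ : 1 <= 2)).
have h2 : `|n%:R * (1 - q (2 * u / A n)) - 2 * s * (2 * u)| <= s / 10.
  by apply: (hN1 n nN1); lra.
rewrite t2E tE -(ler_pM2l nR) mulrCA.
move: h1 h2; rewrite !ler_norml => /andP[_ h1] /andP[h2 _].
set a := n%:R * _ in h1 *; set b := n%:R * _ in h2 *.
have : s < 2 * (s * u) by rewrite mulrCA ltr_pMr.
by move: h1 h2; lra.
Unshelve. all: end_near. Qed.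

End scaling.

(** * Integrable domination near the origin *)

Section domination.
Context {R : realType}.
Variables (q : R -> R) (A : nat -> R) (s : R).
Hypothesis q_ge0 : forall t, 0 <= q t.
Hypothesis q_le1 : forall t, q t <= 1.
Hypothesis q_double : forall t, 1 - q (2 * t) <= 4 * (1 - q t).
Hypothesis q_cramer : exists c M : R, c < 1 /\ forall t, M <= t -> q t <= c.
Hypothesis A_gt0 : forall n, (0 < n)%N -> 0 < A n.
Hypothesis s_gt0 : 0 < s.
Hypothesis q_cvg : forall K e : R, 0 < e ->
  \forall n \near \oo, forall u, 0 <= u -> u <= K ->
  `|q (u / A n) ^+ n - expR (- (2 * s * u))| <= e.

(** Put y(v) = n (1 - q(v / A_n)). Halving v down to [1, 2] and using the growth factor 3/2 per
    doubling, whose square exceeds 2, gives y(u)^2 >= s^2 u; then q^n <= exp(-y) decays at least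
    like exp(-s sqrt u). *)
Lemma domination : exists eta C : R, [/\ 0 < eta, 0 < C &
  \forall n \near \oo, forall u, 0 <= u -> u <= eta * A n ->
    Num.sqrt (q (u / A n) ^+ n) <= C / (1 + u ^+ 2)].
Proof.
have [eta eta0 hq] := potter q_ge0 q_le1 q_double q_cramer A_gt0 s_gt0 q_cvg.
have s10 : 0 < s / 10 by rewrite divr_gt0.
(* From (1 + y / 8)^2 >= 1 + y^2 / 64 >= 1 + b u; hence exp(y) >= (1 + y / 8)^8 >= (1 + b u)^4, and
   the square root is still quadratic in u. *)
pose b := s ^+ 2 / 64.
have b0 : 0 < b by rewrite divr_gt0// exprn_gt0.
(* The 4 covers u <= 1, where the left side is at most 1; the other term comes from 1 + b u >=
   min(b, 1) (1 + u). *)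
exists (eta / 2), (4 + (Num.min b 1) ^- 2); split.
- by rewrite divr_gt0.
- by rewrite addr_gt0// invr_gt0 exprn_gt0// lt_min b0 ltr01.
near=> n.
have n0 : (0 < n)%N by near: n; exists 1%N.
have nR : 0 < n%:R :> R by rewrite ltr0n.
have An := A_gt0 n0.
have hr u : 0 <= u -> u <= 2 -> `|n%:R * (1 - q (u / A n)) - 2 * s * u| <= s / 10.
  by move: u; near: n; exact: (rate_cvg q_ge0 q_le1 s_gt0 q_cvg).
have C0 : 0 <= (Num.min b 1) ^- 2 by rewrite invr_ge0 exprn_ge0// le_min (ltW b0) ler01.
move=> u u0 uA; have u21 : 0 < 1 + u ^+ 2 by rewrite ltr_wpDr// sqr_ge0.
have [u1|u1] := leP u 1.
  apply: (@le_trans _ _ 1).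
    by rewrite -[leRHS]sqrtr1 ler_sqrt// exprn_ile1.
  rewrite ler_pdivlMr// mul1r; have : u ^+ 2 <= 1 by rewrite exprn_ile1.
  by move: C0; set z := _ ^- 2; lra.
pose y v := n%:R * (1 - q (v / A n)).
have y0 v : 0 <= y v by rewrite mulr_ge0// subr_ge0.
have step k v : 1 <= v -> v <= 2 ^+ k.+1 -> v <= eta / 2 * A n -> s ^+ 2 * v <= y v ^+ 2.
  elim: k v => [|k IH] v v1 vk vA.
    have /ler_normlP [h1 h2] := hr v (le_trans ler01 v1) vk.
    rewrite -/(y v) in h1 h2.
    have sv : s * v <= y v by have : s <= s * v; [rewrite ler_peMr// ltW|lra].
    have sv0 : 0 <= s * v by apply: mulr_ge0; [exact: ltW|lra].
    apply: (@le_trans _ _ ((s * v) ^+ 2)).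
      by rewrite exprMn ler_pM2l ?exprn_gt0// expr2 ler_peMl//; lra.
    by apply: lerXn2r => //; rewrite nnegrE.
  have [v2|v2] := leP v 2; first by apply: IH => //; rewrite (le_trans v2)// exprS ler_peMr// exprn_ege1// ler1n.
  have h := IH (v / 2); have v0 : 0 < v by lra.
  have {}h : s ^+ 2 * (v / 2) <= y (v / 2) ^+ 2.
    apply: h; first lra.
      by rewrite ler_pdivrMr// mulrC -exprS.
    by apply: le_trans vA; lra.
  have h2 : 3 / 2 * y (v / 2) <= y v.
    rewrite /y mulrCA ler_pM2l//.
    have -> : v / A n = 2 * (v / 2 / A n) by field; rewrite gt_eqF.
    apply: hq; first by rewrite !divr_gt0.
    by rewrite !ltr_pdivrMr//; move: vA; have := mulr_gt0 eta0 An; lra.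
  have h3 : (3 / 2 * y (v / 2)) ^+ 2 <= y v ^+ 2.
    by apply: lerXn2r => //; rewrite nnegrE// mulr_ge0// divr_ge0.
  apply: le_trans h3; rewrite exprMn.
  have p1 := mulr_ge0 (sqr_ge0 s) (ltW v0); move: h p1.
  rewrite mulrA; set p := s ^+ 2 * v; set z := y _ ^+ 2; rewrite expr2; lra.
have yu : s ^+ 2 * u <= y u ^+ 2.
  apply: (step (Num.truncn u)) => //; first exact: ltW.
  apply: (@le_trans _ _ (Num.truncn u).+1%:R); first by rewrite ltW// truncnS_gt.
  by rewrite -natrX ler_nat ltnW// ltn_expl.
have lb : q (u / A n) ^+ n <= expR (- y u).
  rewrite -mulrN opprB expRM_natl; apply: lerXn2r; rewrite ?nnegrE ?expR_ge0//.
  by have := expR_ge1Dx (q (u / A n) - 1); lra.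
have lb2 : q (u / A n) ^+ n <= (((1 + b * u) ^+ 2)^-1) ^+ 2.
  apply: (le_trans lb); rewrite expRN exprVn lef_pV2 ?posrE ?expR_gt0//; last first.
    by rewrite !exprn_gt0// addr_gt0// mulr_gt0//; lra.
  have -> : y u = 8%:R * (y u / 8) by field.
  rewrite expRM_natl (_ : _ ^+ 8 = (expR (y u / 8) ^+ 2) ^+ 4) -?exprM//.
  rewrite (_ : (1 + b * u) ^+ (2 * 2) = (1 + b * u) ^+ 4)// exprM; apply: lerXn2r.
  - by rewrite nnegrE; have := mulr_ge0 (ltW b0) u0; lra.
  - by rewrite nnegrE exprn_ge0// expR_ge0.
  have h1 : 1 + y u / 8 <= expR (y u / 8) by exact: expR_ge1Dx.
  apply: (@le_trans _ _ ((1 + y u / 8) ^+ 2)); last first.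
    by apply: lerXn2r => //; rewrite nnegrE ?expR_ge0// addr_ge0// divr_ge0.
  have := y0 u; move: yu; rewrite /b; set Y := y u; set S := s ^+ 2.
  by rewrite !expr2; nra.
have lb3 : Num.sqrt (q (u / A n) ^+ n) <= ((1 + b * u) ^+ 2)^-1.
  apply: (@le_trans _ _ (Num.sqrt ((((1 + b * u) ^+ 2)^-1) ^+ 2))).
    by rewrite ler_sqrt// sqr_ge0.
  by rewrite sqrtr_sqr ger0_norm// invr_ge0 sqr_ge0.
apply: (le_trans lb3); set mb := Num.min b 1.
have mb0 : 0 < mb by rewrite lt_min b0 ltr01.
have mb1 : mb <= 1 by rewrite ge_min lexx orbT.
have mbb : mb <= b by rewrite ge_min lexx.
apply: (@le_trans _ _ (mb ^- 2 / (1 + u ^+ 2))); last first.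
  by rewrite ler_pM2r ?invr_gt0// lerDr.
have bu0 : 0 < 1 + b * u by have := mulr_ge0 (ltW b0) u0; lra.
rewrite -invfM lef_pV2 ?posrE; [|exact: exprn_gt0|by apply: mulr_gt0 => //; exact: exprn_gt0].
apply: (@le_trans _ _ ((mb * (1 + u)) ^+ 2)).
  by rewrite exprMn [leRHS]mulrC [leLHS]mulrC ler_pM2r ?exprn_gt0//; rewrite !expr2; nra.
apply: lerXn2r; rewrite ?nnegrE.
- by rewrite mulr_ge0//; lra.
- by rewrite addr_ge0// mulr_ge0//; lra.
by have := ler_wpM2r u0 mbb; lra.
Unshelve. all: end_near. Qed.

End domination.

Section trig_lipschitz.
Context {R : realType}.

Lemma lipschitz_of_derive (g g' : R -> R) : (forall x : R, is_derive x 1 g (g' x)) ->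
  (forall x, `|g' x| <= 1) -> forall x y, `|g x - g y| <= `|x - y|.
Proof.
move=> dg g'1 x y; wlog xy : x y / x <= y.
  by move=> h; have [/h //|/ltW/h] := leP x y; rewrite distrC (distrC y).
have dz z : z \in `]x, y[%R -> is_derive z 1 g (g' z) by move=> _; exact: dg.
have cg : {within `[x, y], continuous g}.
  apply: continuous_subspaceT => z; apply: differentiable_continuous.
  by apply/derivable1_diffP; case: (dg z).
have [c _ h] := MVT_segment xy dz cg.
by rewrite distrC h normrM (distrC x) ler_piMl.
Qed.

Lemma cos_lipschitz (x y : R) : `|cos x - cos y| <= `|x - y|.
Proof.
apply: (lipschitz_of_derive (g' := fun z => - sin z)) => z.
by rewrite normrN normr_sin_le1.
Qed.

Lemma sin_lipschitz (x y : R) : `|sin x - sin y| <= `|x - y|.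
Proof. by apply: (lipschitz_of_derive (g' := cos)) => z; exact: normr_cos_le1. Qed.

End trig_lipschitz.

(** * Characteristic functions of the walk *)

Section walk_charfun.
Context {R : realType} {d : measure_display} {T : measurableType d}.
Variable P : probability T R.
Variables (X : nat -> T -> R).
Hypothesis mX : forall i, measurable_fun setT (X i).
Hypothesis iX : mutually_independent P X.
Hypothesis idX : identically_distributed P X.
Local Notation re := (charfun_re P).
Local Notation im := (charfun_im P).
Local Notation q := (charfun_sq P (X 0%N)).

Lemma eq_law_charfun_re (U V : T -> R) t : measurable_fun setT U -> measurable_fun setT V ->
  (forall B, measurable B -> pr P (U @^-1` B) = pr P (V @^-1` B)) -> re U t = re V t.
Proof.
by move=> mU mV; exact: (eq_law_Rintegral mU mV (measurable_cos_scale t) (fun=> normr_cos_le1 _)).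
Qed.

Lemma eq_law_charfun_im (U V : T -> R) t : measurable_fun setT U -> measurable_fun setT V ->
  (forall B, measurable B -> pr P (U @^-1` B) = pr P (V @^-1` B)) -> im U t = im V t.
Proof.
by move=> mU mV; exact: (eq_law_Rintegral mU mV (measurable_sin_scale t) (fun=> normr_sin_le1 _)).
Qed.

Lemma indep2_walk_block m n : indep2 P (walk X m) (block X m n).
Proof.
apply: (@indep2_of_sigma _ _ _ P (cylinders X (iota 0 m)) (cylinders X (iota m n))).
- by apply: indep_sigma_cylinders => //; rewrite -[m in iota m n]add0n -iotaD iota_uniq.
- rewrite -block0 (_ : block X 0 m = fun w => \sum_(i <- iota 0 m) X i w); last first.
    by apply/funext => w; rewrite block_iota.
  exact: sum_cylinders_measurable.
- rewrite (_ : block X m n = fun w => \sum_(i <- iota m n) X i w); last first.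
    by apply/funext => w; rewrite block_iota.
  exact: sum_cylinders_measurable.
Qed.

Lemma walk_block_fun m n : walk X (m + n) = fun w => walk X m w + block X m n w.
Proof. by apply/funext => w; rewrite walk_block. Qed.

Lemma charfun_re_walkD m n t : re (walk X (m + n)) t =
  re (walk X m) t * re (walk X n) t - im (walk X m) t * im (walk X n) t.
Proof.
rewrite walk_block_fun charfun_reD//; try exact: measurable_walk; try exact: measurable_block.
- by congr (_ * _ - _ * _); [apply: eq_law_charfun_re|apply: eq_law_charfun_im];
    try exact: measurable_walk; try exact: measurable_block; move=> B mB; rewrite block_law.
- exact: indep2_walk_block.
Qed.

Lemma charfun_im_walkD m n t : im (walk X (m + n)) t =
  im (walk X m) t * re (walk X n) t + re (walk X m) t * im (walk X n) t.
Proof.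
rewrite walk_block_fun charfun_imD//; try exact: measurable_walk; try exact: measurable_block.
- by congr (_ * _ + _ * _); [apply: eq_law_charfun_re|apply: eq_law_charfun_im];
    try exact: measurable_walk; try exact: measurable_block; move=> B mB; rewrite block_law.
- exact: indep2_walk_block.
Qed.

Lemma walk1 : walk X 1 = X 0%N.
Proof. by apply/funext => w; rewrite /walk big_ord1. Qed.

Lemma charfun_sq_walk n t : charfun_sq P (walk X n) t = q t ^+ n.
Proof.
elim: n => [|n IH].
  rewrite expr0 /charfun_sq (_ : walk X 0 = fun=> 0); last first.
    by apply/funext => w; rewrite /walk big_ord0.
  rewrite /charfun_re /charfun_im.
  under eq_Rintegral do rewrite mulr0 cos0.
  under [X in _ + X ^+ _]eq_Rintegral do rewrite mulr0 sin0.
  by rewrite !Rintegral_prob_cst expr1n expr0n addr0.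
rewrite exprSr -IH -walk1 -addn1 /charfun_sq charfun_re_walkD charfun_im_walkD.
ring.
Qed.

Lemma charfun_sq_double t : 1 - q (2 * t) <= 4 * (1 - q t).
Proof.
have i01 : indep2 P (X 0%N) (X 1%N).
  move=> A B mA mB.
  have := iX (s := [:: 0%N; 1%N]) (B := fun i => if i == 0%N then A else B).
  by rewrite !big_cons !big_nil /= setIT mulr1; apply=> // i; case: ifP.
have m01 : measurable_fun setT (fun w => X 0%N w - X 1%N w) by exact: measurable_funB.
have e01 s : q s = re (fun w => X 0%N w - X 1%N w) s.
  by apply: charfun_sq_symm => // B mB; rewrite [RHS]idX.
by rewrite !e01; exact: charfun_re_double.
Qed.

Lemma charfun_sq_cramer : cramer P (X 0%N) ->
  exists c M : R, c < 1 /\ forall t, M <= t -> q t <= c.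
Proof.
move=> [c [c1 [M hM]]]; exists (c ^+ 2), M; split.
  have c0 : 0 <= c by apply: le_trans (hM `|M| _); rewrite ?sqrtr_ge0// normr_id ler_norm.
  by rewrite expr2 mulr_ilt1.
move=> t Mt; have h := hM t (le_trans Mt (ler_norm _)).
rewrite -[leLHS]sqr_sqrtr ?charfun_sq_ge0//; apply: lerXn2r => //.
  by rewrite nnegrE sqrtr_ge0.
by rewrite nnegrE (le_trans _ h)// sqrtr_ge0.
Qed.

Variables (A : nat -> R) (f : R -> R).
Hypothesis cvX : conv_in_distribution P (fun n w => walk X n w / A n) f.
Hypothesis f0 : forall x, 0 <= f x.
Hypothesis i_f : lebesgue_measure.-integrable setT (EFin \o f).

Variables (s b m : R).
Let th t := m * t - s * b * (2 / pi) * t * ln `|t|.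
Hypothesis fcos : forall t, Rintegral lebesgue_measure setT (fun x => cos (t * x) * f x) =
  expR (- (s * `|t|)) * cos (th t).
Hypothesis fsin : forall t, Rintegral lebesgue_measure setT (fun x => sin (t * x) * f x) =
  expR (- (s * `|t|)) * sin (th t).

Lemma density_mass1 : Rintegral lebesgue_measure setT f = 1.
Proof.
have := fcos 0; rewrite /th normr0 !mulr0 mul0r subr0 oppr0 expR0 cos0 mulr1 => <-.
by apply: eq_Rintegral => x _; rewrite mul0r cos0 mul1r.
Qed.

Lemma charfun_walk_cvg (K e : R) : 0 < e -> \forall n \near \oo, forall u, 0 <= u -> u <= K ->
  `|re (walk X n) (u / A n) - expR (- (s * u)) * cos (th u)| <= e /\
  `|im (walk X n) (u / A n) - expR (- (s * u)) * sin (th u)| <= e.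
Proof.
move=> e0.
have mZ n : measurable_fun setT (fun w => walk X n w / A n).
  by apply: measurable_funM => //; exact: measurable_walk.
have := weak_cvg_lipschitz mZ f0 i_f density_mass1 cvX (normr_ge0 K) e0.
apply: filterS => n h u u0 uK.
have uK' : `|u| <= `|K| by rewrite (ger0_norm u0) (le_trans uK)// ler_norm.
have e1 w : u * (walk X n w / A n) = u / A n * walk X n w by rewrite mulrA mulrAC.
have us : `|u| = u by rewrite ger0_norm.
split.
- have := h (fun x => cos (u * x)) (measurable_cos_scale u) (fun=> normr_cos_le1 _).
  rewrite fcos us /charfun_re; under [X in `|X - _|]eq_Rintegral do rewrite /= e1.
  apply => x y; apply: (le_trans (cos_lipschitz _ _)).
  by rewrite -mulrBr normrM ler_wpM2r.
- have := h (fun x => sin (u * x)) (measurable_sin_scale u) (fun=> normr_sin_le1 _).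
  rewrite fsin us /charfun_im; under [X in `|X - _|]eq_Rintegral do rewrite /= e1.
  apply => x y; apply: (le_trans (sin_lipschitz _ _)).
  by rewrite -mulrBr normrM ler_wpM2r.
Qed.

(** Squaring and adding removes the phase [th], and with it the logarithmic term, from the limit. *)
Lemma charfun_sq_cvg : 0 < s -> forall K e : R, 0 < e ->
  \forall n \near \oo, forall u, 0 <= u -> u <= K ->
  `|q (u / A n) ^+ n - expR (- (2 * s * u))| <= e.
Proof.
move=> s0 K e e0; have e4 : 0 < e / 4 by rewrite divr_gt0.
have := charfun_walk_cvg K e4; apply: filterS => n h u u0 uK.
have [h1 h2] := h u u0 uK.
rewrite -charfun_sq_walk /charfun_sq.
have r1 := normr_cos_le1 (th u); have r2 := normr_sin_le1 (th u).
have E1 : expR (- (s * u)) <= 1 by rewrite -expR0 ler_expR oppr_le0 mulr_ge0// ltW.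
have E0 := expR_ge0 (- (s * u)).
have -> : expR (- (2 * s * u)) =
    (expR (- (s * u)) * cos (th u)) ^+ 2 + (expR (- (s * u)) * sin (th u)) ^+ 2.
  rewrite !exprMn -mulrDr cos2Dsin2 mulr1 -expRM_natl; congr expR; ring.
set a := re _ _ in h1 *; set c := im _ _ in h2 *.
have a1 : `|a| <= 1.
  by apply: Rintegral_prob_bound => [|w]; [apply: measurable_cos_mul; exact: measurable_walk|exact: normr_cos_le1].
have c1 : `|c| <= 1.
  by apply: Rintegral_prob_bound => [|w]; [apply: measurable_sin_mul; exact: measurable_walk|exact: normr_sin_le1].
have p1 : `|expR (- (s * u)) * cos (th u)| <= 1 by rewrite normrM mulr_ile1// ger0_norm.
have p2 : `|expR (- (s * u)) * sin (th u)| <= 1 by rewrite normrM mulr_ile1// ger0_norm.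
have sq (x y : R) : `|x| <= 1 -> `|y| <= 1 -> `|x - y| <= e / 4 -> `|x ^+ 2 - y ^+ 2| <= e / 2.
  move=> x1 y1 xy; rewrite subr_sqr normrM (_ : e / 2 = e / 4 * 2); last by lra.
  by apply: ler_pM => //; apply: (le_trans (ler_normD _ _)); lra.
rewrite opprD addrACA; apply: (le_trans (ler_normD _ _)).
by have := sq _ _ a1 p1 h1; have := sq _ _ c1 p2 h2; lra.
Qed.

End walk_charfun.

(** * Strict stability of the limit law *)

Section symmetry.
Context {R : realType} {d : measure_display} {T : measurableType d}.
Variable P : probability T R.
Variables (X : nat -> T -> R).
Hypothesis mX : forall i, measurable_fun setT (X i).
Hypothesis iX : mutually_independent P X.
Hypothesis idX : identically_distributed P X.
Hypothesis crX : cramer P (X 0%N).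
Variables (A : nat -> R) (f : R -> R).
Hypothesis A_gt0 : forall n, (0 < n)%N -> 0 < A n.
Hypothesis cvX : conv_in_distribution P (fun n w => walk X n w / A n) f.
Hypothesis f0 : forall x, 0 <= f x.
Hypothesis i_f : lebesgue_measure.-integrable setT (EFin \o f).
Variables (s b m : R).
Hypothesis s0 : 0 < s.
Let th t := m * t - s * b * (2 / pi) * t * ln `|t|.
Hypothesis fcos : forall t, Rintegral lebesgue_measure setT (fun x => cos (t * x) * f x) =
  expR (- (s * `|t|)) * cos (th t).
Hypothesis fsin : forall t, Rintegral lebesgue_measure setT (fun x => sin (t * x) * f x) =
  expR (- (s * `|t|)) * sin (th t).
Local Notation re := (charfun_re P).
Local Notation im := (charfun_im P).
Local Notation q := (charfun_sq P (X 0%N)).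

Let q_ge0 t : 0 <= q t. Proof. exact: charfun_sq_ge0. Qed.
Let q_le1 t : q t <= 1. Proof. exact: charfun_sq_le1. Qed.
Let q_double := charfun_sq_double mX iX idX.
Let q_cramer := charfun_sq_cramer crX.
Let q_cvg := charfun_sq_cvg mX iX idX cvX f0 i_f fcos fsin s0.

Lemma norming_ratio (k : nat -> nat) (r : R) : 0 < r ->
  (k n)%:R / n%:R @[n --> \oo] --> r -> A (k n) / A n @[n --> \oo] --> r.
Proof.
move=> r0 kr; apply/cvgrPdist_le => e e0.
have := ratio_cvg q_ge0 q_le1 A_gt0 s0 q_cvg r0 e0 kr.
by apply: filterS => n; rewrite distrC.
Qed.

Lemma norming_double : A (n + n)%N / A n @[n --> \oo] --> (2 : R).
Proof.
apply: norming_ratio => //; apply: cvg_near_cst; near=> n.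
have n0 : n%:R != 0 :> R by rewrite pnatr_eq0 -lt0n; near: n; exists 1%N.
by rewrite natrD; field.
Unshelve. all: end_near. Qed.

(* S_(2n) is a sum of two independent copies of S_n and A_(2n) ~ 2 A_n, so the
   limit law is strictly stable, which rules out the logarithmic term *)
Lemma stable_symmetric : b = 0.
Proof.
have lim (u : R) : 0 < u -> [/\ re (walk X (n + n)) (u / A (n + n)%N) @[n --> \oo]
      --> expR (- (s * u)) * cos (th u),
    im (walk X (n + n)) (u / A (n + n)%N) @[n --> \oo]
      --> expR (- (s * u)) * sin (th u),
    re (walk X n) (u / A (n + n)%N) @[n --> \oo]
      --> expR (- (s * (u / 2))) * cos (th (u / 2)) &
    im (walk X n) (u / A (n + n)%N) @[n --> \oo]
      --> expR (- (s * (u / 2))) * sin (th (u / 2))].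
  move=> u0.
  have H (K e : R) (e0 : 0 < e) := charfun_walk_cvg mX cvX f0 i_f fcos fsin K e0.
  have dbl (Q : nat -> Prop) : (\forall n \near \oo, Q n) -> \forall n \near \oo, Q (n + n)%N.
    by move=> [N _ hN]; exists N => // n /= Nn; apply: hN => /=; rewrite (leq_trans Nn)// leq_addr.
  (* u / A_(2n) = v_n / A_n with v_n -> u / 2; uniform convergence lets the moving argument v_n be
     inserted. *)
  pose v n := u * (A (n + n)%N / A n)^-1.
  have vE n : (0 < n)%N -> u / A (n + n)%N = v n / A n.
    move=> n0; rewrite /v; field; rewrite !gt_eqF//; apply: A_gt0 => //.
    by rewrite addn_gt0 n0.
  have cv : v n @[n --> \oo] --> u / 2.
    by apply: cvgM; [exact: cvg_cst|apply: cvgV => //; exact: norming_double].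
  have v_ge0 : \forall n \near \oo, 0 <= v n.
    near=> n; have n0 : (0 < n)%N by near: n; exists 1%N.
    by rewrite mulr_ge0 ?(ltW u0)// invr_ge0 divr_ge0// ltW// A_gt0// addn_gt0 n0.
  have v_le : \forall n \near \oo, v n <= u.
    by apply: (cvgr_le _ cv); lra.
  have cth : th (v n) @[n --> \oo] --> th (u / 2).
    have u2 : 0 < u / 2 by rewrite divr_gt0.
    have lnv : ln `|v n| @[n --> \oo] --> ln `|u / 2|.
      rewrite (ger0_norm (ltW u2)); apply: cvg_trans; last first.
        by apply: (continuous_cvg _ (continuous_ln u2) cv).
      by apply: near_eq_cvg; near=> n; rewrite ger0_norm//; near: n.
    apply: cvgB; first by apply: cvgM => //; exact: cvg_cst.
    by apply: cvgM => //; apply: cvgM => //; exact: cvg_cst.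
  have cexp : expR (- (s * v n)) @[n --> \oo] --> expR (- (s * (u / 2))).
    apply: (continuous_cvg _ (@continuous_expR R _)).
    by apply: cvgN; apply: cvgM => //; exact: cvg_cst.
  have ccos : expR (- (s * v n)) * cos (th (v n)) @[n --> \oo] -->
      expR (- (s * (u / 2))) * cos (th (u / 2)).
    by apply: cvgM => //; apply: (continuous_cvg _ (@continuous_cos R _)).
  have csin : expR (- (s * v n)) * sin (th (v n)) @[n --> \oo] -->
      expR (- (s * (u / 2))) * sin (th (u / 2)).
    by apply: cvgM => //; apply: (continuous_cvg _ (@continuous_sin R _)).
  split.
  - apply/cvgrPdist_le => e e0; have := dbl _ (H u e e0).
    by apply: filterS => n h; rewrite distrC; case: (h u (ltW u0) (lexx u)).
  - apply/cvgrPdist_le => e e0; have := dbl _ (H u e e0).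
    by apply: filterS => n h; rewrite distrC; case: (h u (ltW u0) (lexx u)).
  - apply/cvgrPdist_le => e e0; have e2 : 0 < e / 2 by rewrite divr_gt0.
    near=> n; have n0 : (0 < n)%N by near: n; exists 1%N.
    have h1 : `|re (walk X n) (v n / A n) - expR (- (s * v n)) * cos (th (v n))| <= e / 2.
      have h : forall w, 0 <= w -> w <= u ->
        `|re (walk X n) (w / A n) - expR (- (s * w)) * cos (th w)| <= e / 2 /\
        `|im (walk X n) (w / A n) - expR (- (s * w)) * sin (th w)| <= e / 2.
        by near: n; exact: H.
      by apply: (h _ _ _).1; near: n.
    have h2 : `|expR (- (s * (u / 2))) * cos (th (u / 2)) -
        expR (- (s * v n)) * cos (th (v n))| <= e / 2.
      by near: n; move/cvgrPdist_le : ccos; apply.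
    rewrite vE// (splitr e) distrC; apply: le_trans (lerD h1 h2).
    by apply: le_trans (ler_distD (expR (- (s * v n)) * cos (th (v n))) _ _) _; rewrite lerD2l distrC.
  - apply/cvgrPdist_le => e e0; have e2 : 0 < e / 2 by rewrite divr_gt0.
    near=> n; have n0 : (0 < n)%N by near: n; exists 1%N.
    have h1 : `|im (walk X n) (v n / A n) - expR (- (s * v n)) * sin (th (v n))| <= e / 2.
      have h : forall w, 0 <= w -> w <= u ->
        `|re (walk X n) (w / A n) - expR (- (s * w)) * cos (th w)| <= e / 2 /\
        `|im (walk X n) (w / A n) - expR (- (s * w)) * sin (th w)| <= e / 2.
        by near: n; exact: H.
      by apply: (h _ _ _).2; near: n.
    have h2 : `|expR (- (s * (u / 2))) * sin (th (u / 2)) -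
        expR (- (s * v n)) * sin (th (v n))| <= e / 2.
      by near: n; move/cvgrPdist_le : csin; apply.
    rewrite vE// (splitr e) distrC; apply: le_trans (lerD h1 h2).
    by apply: le_trans (ler_distD (expR (- (s * v n)) * sin (th (v n))) _ _) _; rewrite lerD2l distrC.
(* The square of the characteristic function of S_n at u / A_(2n) is that of S_(2n), so th(u) and 2
   th(u / 2) agree modulo 2 pi; their difference is the angle displayed here, up to sign. *)
have key u : 0 < u -> cos (s * b * (2 / pi) * u * ln 2) = 1.
  move=> u0; have [l1 l2 l3 l4] := lim u u0.
  have E : expR (- (s * u)) = expR (- (s * (u / 2))) * expR (- (s * (u / 2))).
    by rewrite -expRD; congr expR; field.
  have Enz : expR (- (s * (u / 2))) != 0 by rewrite gt_eqF// expR_gt0.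
  set E2 := expR (- (s * (u / 2))) in E Enz l3 l4.
  have e1 : expR (- (s * u)) * cos (th u) =
      (E2 * cos (th (u / 2))) * (E2 * cos (th (u / 2))) -
      (E2 * sin (th (u / 2))) * (E2 * sin (th (u / 2))).
    have h : re (walk X n) (u / A (n + n)%N) * re (walk X n) (u / A (n + n)%N) -
        im (walk X n) (u / A (n + n)%N) * im (walk X n) (u / A (n + n)%N) @[n --> \oo] --> _ :=
      cvgB (cvgM l3 l3) (cvgM l4 l4).
    have fe : (fun n => re (walk X (n + n)) (u / A (n + n)%N)) = _ :=
      funext (fun n => charfun_re_walkD mX iX idX n n _).
    by rewrite fe in l1; exact: (cvg_unique _ l1 (h _ _ _)).
  have e2 : expR (- (s * u)) * sin (th u) =
      (E2 * sin (th (u / 2))) * (E2 * cos (th (u / 2))) +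
      (E2 * cos (th (u / 2))) * (E2 * sin (th (u / 2))).
    have h : im (walk X n) (u / A (n + n)%N) * re (walk X n) (u / A (n + n)%N) +
        re (walk X n) (u / A (n + n)%N) * im (walk X n) (u / A (n + n)%N) @[n --> \oo] --> _ :=
      cvgD (cvgM l4 l3) (cvgM l3 l4).
    have fe : (fun n => im (walk X (n + n)) (u / A (n + n)%N)) = _ :=
      funext (fun n => charfun_im_walkD mX iX idX n n _).
    by rewrite fe in l2; exact: (cvg_unique _ l2 (h _ _ _)).
  have EE : E2 * E2 != 0 by rewrite mulf_neq0.
  have c1 : cos (th u) = cos (th (u / 2) + th (u / 2)).
    by apply: (mulfI EE); rewrite -{1}E e1 (cosD (th (u / 2))); ring.
  have c2 : sin (th u) = sin (th (u / 2) + th (u / 2)).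
    by apply: (mulfI EE); rewrite -{1}E e2 (sinD (th (u / 2))); ring.
  have -> : s * b * (2 / pi) * u * ln 2 = (th (u / 2) + th (u / 2)) - th u.
    have u2 : 0 < u / 2 by rewrite divr_gt0.
    rewrite /th (ger0_norm (ltW u0)) (ger0_norm (ltW u2)) ln_div ?posrE//.
    move: (ln u) (ln 2) (pi : R) (pi_gt0 R) => a c p p0.
    by field; rewrite gt_eqF.
  by rewrite cosB -c1 -c2 -!expr2 cos2Dsin2.
have pi0 := pi_gt0 R; have l2 : 0 < ln 2 :> R by rewrite ln_gt0// ltr1n.
apply/eqP; apply: contraT => b0.
pose k := s * b * (2 / pi) * ln 2.
have k0 : k != 0 by rewrite /k !mulf_neq0 ?invr_eq0 ?(gt_eqF s0) ?(gt_eqF pi0) ?(gt_eqF l2) ?pnatr_eq0.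
have nk : 0 < `|k| by rewrite normr_gt0.
(* This u makes the angle pi or -pi, where the cosine is -1. *)
have := key (pi / `|k|) (divr_gt0 pi0 nk).
have -> : s * b * (2 / pi) * (pi / `|k|) * ln 2 = pi * (k / `|k|) by rewrite /k; ring.
have [kp|kn] := ltP 0 k.
  by rewrite ger0_norm ?ltW// divff// mulr1 cospi; lra.
by rewrite ler0_norm// invrN mulrN divff// mulrN1 cosN cospi; lra.
Unshelve. all: end_near. Qed.

End symmetry.

(** * The Cauchy density *)

Section cauchy_kernel.
Context {R : realType}.
Implicit Types (l x t : R).
Notation mu := (@lebesgue_measure R).

Definition cauchy_pdf l x : R := l / (pi * (l ^+ 2 + x ^+ 2)).

Lemma is_derive_comp_scale (g g' : R -> R) (c t : R) :
  (forall y : R, is_derive y 1 g (g' y)) ->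
  is_derive t 1 (fun t => g (c * t)) (c * g' (c * t)).
Proof.
move=> dg; have h : is_derive t 1 (fun t : R => c * t) c.
  have := is_deriveZ (c) (is_derive_id t (1 : R)); rewrite scaler1.
  by [].
by rewrite mulrC; exact: (is_derive1_comp (dg _) h).
Qed.

Lemma continuous_is_derive (g g' : R -> R) :
  (forall y : R, is_derive y 1 g (g' y)) -> continuous g.
Proof.
move=> dg y; apply: differentiable_continuous.
by apply/derivable1_diffP; case: (dg y).
Qed.

Lemma cvg_expR_decay l : 0 < l -> expR (- l * t) @[t --> +oo%R] --> 0.
Proof.
move=> l0; rewrite (_ : (fun t => expR (- l * t)) = (fun z => expR (- z)) \o (fun z => l * z)).
  by apply: (@cvg_comp _ _ _ _ _ _ (pinfty_nbhs R)); [exact: gt0_cvgMry|exact: cvgr_expR].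
by apply/funext => t /=; rewrite mulNr.
Qed.

Lemma integral_primitive_0y (g G : R -> R) (v : R) : (forall t, 0 <= t -> 0 <= g t) ->
  (forall t : R, is_derive t 1 G (g t)) -> continuous g ->
  G t @[t --> +oo%R] --> v -> (\int[mu]_(t in `[0%R, +oo[) (g t)%:E = (v - G 0)%:E)%E.
Proof.
move=> g0 dG cg Gv.
have cG := continuous_is_derive dG.
have cg' : {within `[0, +oo[, continuous g} by exact: continuous_subspaceT.
have dG' t : 0 < t -> derivable G t 1 by move=> _; case: (dG t).
have G0 : G t @[t --> 0^'+] --> G 0 by apply: cvg_at_right_filter; exact: cG.
have Gg : {in `]0, +oo[, derive1 G =1 g} by move=> t _; rewrite derive1E; case: (dG t).
by rewrite (ge0_continuous_FTC2y g0 cg' Gv dG' G0 Gg) EFinB.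
Qed.

Lemma integrable_0y_of (g : R -> R) (v : R) : (forall t, 0 <= t -> 0 <= g t) ->
  measurable_fun setT g ->
  (\int[mu]_(t in `[0%R, +oo[) (g t)%:E = v%:E)%E ->
  mu.-integrable `[0%R, +oo[ (EFin \o g).
Proof.
move=> g0 mg gv; apply/integrableP; split.
  by apply/measurable_EFinP; apply: measurable_funTS.
rewrite [X in (X < _)%E](_ : _ = (\int[mu]_(t in `[0%R, +oo[) (g t)%:E)%E).
  by rewrite gv ltry.
apply: eq_integral => t.
by rewrite inE/= in_itv/= andbT => t0; rewrite ger0_norm// g0.
Qed.

Lemma is_derive_exp_scale (c t : R) : is_derive t 1 (fun t => expR (c * t)) (c * expR (c * t)).
Proof. exact: (@is_derive_comp_scale expR expR). Qed.

Lemma continuous_exp_scale (c : R) : continuous (fun t : R => expR (c * t)).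
Proof. exact: continuous_is_derive (is_derive_exp_scale c). Qed.

Lemma integral_exp_decay l : 0 < l ->
  (\int[mu]_(t in `[0%R, +oo[) (expR (- l * t))%:E = (l^-1)%:E)%E.
Proof.
move=> l0.
have dF (t : R) : is_derive t 1 (fun t => - l^-1 * expR (- l * t)) (expR (- l * t)).
  have h := is_deriveZ (- l^-1) (is_derive_exp_scale (- l) t).
  by apply: is_derive_eq; rewrite /GRing.scale/= mulrA mulrNN mulVf ?gt_eqF// mul1r.
have Gv : - l^-1 * expR (- l * t) @[t --> +oo%R] --> - l^-1 * 0.
  by apply: cvgM; [exact: cvg_cst|exact: cvg_expR_decay].
have g0 t : 0 <= t -> 0 <= expR (- l * t) by move=> _; exact: expR_ge0.
rewrite (integral_primitive_0y g0 dF (continuous_exp_scale (c := - l)) Gv).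
by rewrite !mulr0 expR0 mulr1 sub0r opprK.
Qed.

Lemma integrable_exp_decay l : 0 < l ->
  mu.-integrable `[0%R, +oo[ (EFin \o (fun t => expR (- l * t))).
Proof.
move=> l0; apply: integrable_0y_of (integral_exp_decay l0).
  by move=> t _; exact: expR_ge0.
by apply: continuous_measurable_fun; exact: continuous_exp_scale.
Qed.

Lemma integral_inv_oneDsqr :
  (\int[mu]_(t in `[0%R, +oo[) ((1 + t ^+ 2)^-1)%:E = (pi / 2)%:E)%E.
Proof.
have p t : 0 < 1 + t ^+ 2 by rewrite ltr_wpDr// sqr_ge0.
have g0 (t : R) : 0 <= t -> 0 <= (1 + t ^+ 2)^-1 by rewrite invr_ge0 (ltW (p t)).
have cg : continuous (fun t : R => (1 + t ^+ 2)^-1).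
  move=> t; apply: cvgV; first by rewrite gt_eqF.
  by apply: cvgD; [exact: cvg_cst|exact: exprn_continuous].
by rewrite (integral_primitive_0y g0 (@is_derive1_atan R) cg (@cvgy_atan R)) atan0 subr0.
Qed.

Lemma integrable_inv_oneDsqr :
  mu.-integrable `[0%R, +oo[ (EFin \o (fun t => (1 + t ^+ 2)^-1)).
Proof.
have p t : 0 < 1 + t ^+ 2 by rewrite ltr_wpDr// sqr_ge0.
apply: integrable_0y_of integral_inv_oneDsqr.
  by move=> t _; rewrite invr_ge0 ltW.
apply: continuous_measurable_fun => t; apply: cvgV; first by rewrite gt_eqF.
by apply: cvgD; [exact: cvg_cst|exact: exprn_continuous].
Qed.

Lemma integrable_exp_cos l x : 0 < l ->
  mu.-integrable `[0%R, +oo[ (EFin \o (fun t => expR (- l * t) * cos (t * x))).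
Proof.
move=> l0; apply: (@integrable_Rle _ _ _ mu _ _ _ (fun t => expR (- l * t))) => //.
- apply: measurable_funTS; apply: measurable_funM.
    by apply: continuous_measurable_fun; exact: continuous_exp_scale.
  by under eq_fun do rewrite mulrC; exact: measurable_cos_scale.
- exact: integrable_exp_decay.
- by move=> t _; rewrite normrM ger0_norm ?expR_ge0// ler_piMr ?expR_ge0// normr_cos_le1.
Qed.

(* the positive integrand exp(-l t) (1 + cos(t x)) has an explicit primitive *)
Lemma integral_exp_cos l x : 0 < l ->
  Rintegral mu `[0%R, +oo[ (fun t => expR (- l * t) * cos (t * x)) = pi * cauchy_pdf l x.
Proof.
move=> l0; have D0 : 0 < l ^+ 2 + x ^+ 2 by rewrite ltr_wpDr ?sqr_ge0// exprn_gt0.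
pose G t := - l^-1 * expR (- l * t) +
  (expR (- l * t) * ((x * sin (x * t) - l * cos (x * t)) / (l ^+ 2 + x ^+ 2))).
have dG (t : R) : is_derive t 1 G (expR (- l * t) * (1 + cos (t * x))).
  have d1 := is_derive_exp_scale (- l) t.
  have d2 := @is_derive_comp_scale sin cos x t (fun y => is_derive_sin y).
  have d3 := @is_derive_comp_scale cos (fun y => - sin y) x t (fun y => is_derive_cos y).
  have e1 := is_deriveZ (- l^-1) d1.
  have e2 := is_deriveZ (x) d2.
  have e3 := is_deriveZ (l) d3.
  have e4 := is_deriveZ ((l ^+ 2 + x ^+ 2)^-1) (is_deriveB e2 e3).
  have e5 := is_deriveD e1 (is_deriveM d1 e4).
  have -> : G = (- l^-1 \*: (fun t => expR (- l * t))) + ((fun t => expR (- l * t)) *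
     ((l ^+ 2 + x ^+ 2)^-1 \*: (x \*: (fun t => sin (x * t)) - l \*: (fun t => cos (x * t))))).
    by apply/funext => z; rewrite /G /= [_ / _]mulrC.
  apply: is_derive_eq; rewrite /GRing.scale/= !fctE /GRing.scale/= /GRing.scale/= (mulrC t).
  by field; rewrite !gt_eqF.
have G0 : G 0 = - l^-1 - pi * cauchy_pdf l x.
  rewrite /G !mulr0 expR0 sin0 cos0 /cauchy_pdf.
  by move: (pi : R) (pi_gt0 R) => p p0; field; rewrite !gt_eqF.
have cG : G t @[t --> +oo%R] --> 0.
  have h := cvg_expR_decay l0.
  rewrite -[X in _ --> X]addr0; apply: cvgD.
    by rewrite -(mulr0 (- l^-1)); apply: cvgM; first exact: cvg_cst.
  pose M := (`|x| + l) / (l ^+ 2 + x ^+ 2).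
  have hM : expR (- l * t) * M @[t --> +oo%R] --> 0 * M by apply: cvgM => //; exact: cvg_cst.
  rewrite mul0r in hM.
  apply: norm_cvg0; apply: (@squeeze_cvgr _ _ _ _ (cst 0) _ _ _ _ _ hM); last exact: cvg_cst.
  apply: nearW => t; rewrite normr_ge0 /= normrM ger0_norm ?expR_ge0// ler_wpM2l ?expR_ge0//.
  rewrite /M normrM (ger0_norm (_ : 0 <= _^-1)) ?invr_ge0 ?(ltW D0)//.
  rewrite ler_wpM2r ?invr_ge0 ?(ltW D0)//; apply: (le_trans (ler_normB _ _)).
  by rewrite !normrM (ger0_norm (ltW l0)); apply: lerD; rewrite ler_piMr ?normr_sin_le1 ?normr_cos_le1// ltW.
have I1 : (\int[mu]_(t in `[0%R, +oo[) (expR (- l * t) * (1 + cos (t * x)))%:E = (0 - G 0)%:E)%E.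
  apply: (integral_primitive_0y _ dG _ cG) => [t _|t].
    by rewrite mulr_ge0 ?expR_ge0//; have := cos_geN1 (t * x); lra.
  apply: cvgM; first exact: continuous_exp_scale.
  apply: cvgD; first exact: cvg_cst.
  apply: (continuous_cvg _ (@continuous_cos R _)).
  by apply: cvgM; [exact: cvg_id|exact: cvg_cst].
have I2 : Rintegral mu `[0%R, +oo[ (fun t => expR (- l * t) + expR (- l * t) * cos (t * x)) = 0 - G 0.
  rewrite /Rintegral; under eq_integral do rewrite -{1}[expR _]mulr1 -mulrDr.
  by rewrite I1.
move: I2; rewrite RintegralD//; last 2 first.
- exact: integrable_exp_decay.
- exact: integrable_exp_cos.
rewrite [X in X + _ = _](_ : _ = l^-1); last by rewrite /Rintegral integral_exp_decay.
by rewrite G0; lra.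
Qed.

End cauchy_kernel.

Section cauchy_basic.
Context {R : realType}.
Implicit Types l x : R.

Lemma cauchy_ge0 l x : 0 < l -> 0 <= cauchy_pdf l x.
Proof.
move=> l0; rewrite divr_ge0 ?(ltW l0)// mulr_ge0 ?pi_ge0// addr_ge0 ?sqr_ge0//.
Qed.

Lemma cauchy_le l x : 0 < l -> cauchy_pdf l x <= (pi * l)^-1.
Proof.
move=> l0; have p0 := pi_gt0 R; have x2 := sqr_ge0 x.
have D0 : 0 < l ^+ 2 + x ^+ 2 by rewrite ltr_wpDr// exprn_gt0.
rewrite /cauchy_pdf ler_pdivrMr ?mulr_gt0// invfM mulrACA mulVf ?gt_eqF// mul1r.
by rewrite ler_pdivlMl// mulrC -expr2 lerDl.
Qed.

Lemma continuous_cauchy l : 0 < l -> continuous (@cauchy_pdf R l).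
Proof.
move=> l0 x; have p0 := pi_gt0 R.
have D0 : 0 < l ^+ 2 + x ^+ 2 by rewrite ltr_wpDr ?sqr_ge0// exprn_gt0.
apply: cvgM; first exact: cvg_cst.
apply: cvgV; first by rewrite gt_eqF// mulr_gt0.
apply: cvgM; first exact: cvg_cst.
by apply: cvgD; [exact: cvg_cst|exact: exprn_continuous].
Qed.

Lemma measurable_cauchy l : 0 < l -> measurable_fun setT (@cauchy_pdf R l).
Proof. by move=> l0; apply: continuous_measurable_fun; exact: continuous_cauchy. Qed.

End cauchy_basic.

(** * Fourier representation of Cauchy averages *)

Section cauchy_fubini.
Context {R : realType} {d : measure_display} {T : measurableType d}.
Variable m : {sigma_finite_measure set T -> \bar R}.
Variables (phi W : T -> R).
Hypothesis mW : measurable_fun setT W.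
Hypothesis phi0 : forall w, 0 <= phi w.
Hypothesis iphi : m.-integrable setT (EFin \o phi).
Notation mu := (@lebesgue_measure R).

Let mphi : measurable_fun setT phi.
Proof. by apply/measurable_EFinP; exact: measurable_int iphi. Qed.

Lemma integrable_weight_cos (t : R) : m.-integrable setT (EFin \o (fun w => cos (t * W w) * phi w)).
Proof.
apply: (@integrable_Rle _ _ _ m setT measurableT _ phi) => //.
  by apply: measurable_funM => //; exact: measurable_cos_mul.
by move=> w _; rewrite normrM (ger0_norm (phi0 w)) ler_piMl// normr_cos_le1.
Qed.

(** The Cauchy kernel is, up to the factor pi, the cosine transform of exp(-l t), and exp(-l t)
    [phi] is an integrable majorant for Fubini. With [phi] = 1 it serves for the walk, with [phi] =
    f for the limit law. *)
Lemma Rintegral_cauchy (l : R) : 0 < l ->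
  pi * Rintegral m setT (fun w => cauchy_pdf l (W w) * phi w) =
  Rintegral mu `[0%R, +oo[ (fun t => expR (- l * t) *
    Rintegral m setT (fun w => cos (t * W w) * phi w)).
Proof.
move=> l0.
pose I0 : set (measurableTypeR R) := `[0%R, +oo[%classic.
have mI0 : measurable I0 by exact: measurable_itv.
pose E (t : measurableTypeR R) : R := expR (- l * t) * \1_I0 t.
have mE : measurable_fun setT E.
  apply: measurable_funM; last exact: measurable_indic.
  by apply: continuous_measurable_fun; exact: continuous_exp_scale.
have E0 t : 0 <= E t by rewrite mulr_ge0// expR_ge0.
pose F (z : T * measurableTypeR R) : \bar R := (E z.2 * (cos (z.2 * W z.1) * phi z.1))%:E.
have mF : measurable_fun setT F.
  apply/measurable_EFinP; apply: measurable_funM.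
    by apply: measurableT_comp => //; exact: measurable_snd.
  apply: measurable_funM; last by apply: measurableT_comp => //; exact: measurable_fst.
  apply: (measurableT_comp (f := @cos R)).
    by apply: continuous_measurable_fun; exact: continuous_cos.
  apply: measurable_funM; first exact: measurable_snd.
  by apply: measurableT_comp => //; exact: measurable_fst.
have intE (g : R -> R) : (\int[mu]_t (E t * g t)%:E = \int[mu]_(t in I0) (expR (- l * t) * g t)%:E)%E.
  rewrite [RHS]integral_mkcond; apply: eq_integral => t _.
  rewrite /patch /E indicE; case: (t \in I0); first by rewrite mulr1.
  by rewrite mulr0 mul0r.
have iF : (m \x mu)%E.-integrable setT F.
  apply/(integrable12ltyP m mu mF).
  apply: (@le_lt_trans _ _ (\int[m]_w (l^-1%:E * (phi w)%:E))%E); last first.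
    rewrite ge0_integralZl//; last 3 first.
    - exact/measurable_EFinP.
    - by move=> w _; rewrite lee_fin.
    - by rewrite lee_fin invr_ge0 ltW.
    have := integrable_fin_num measurableT iphi.
    by rewrite /= => /fineK <-; rewrite -EFinM ltry.
  apply: ge0_le_integral => //.
  - by move=> w _; exact: integral_ge0.
  - apply: (@measurable_fun_fubini_tonelli_F _ _ _ _ _ mu (abse \o F)) => // [|z].
      exact: measurableT_comp.
    exact: abse_ge0.
  - have h : measurable_fun setT (EFin \o (fun w => l^-1 * phi w)).
      by apply/measurable_EFinP; exact: measurable_funM.
    exact: h.
  move=> w _.
  have -> : (l^-1%:E * (phi w)%:E = \int[mu]_t (E t * phi w)%:E)%E.
    rewrite (intE (fun=> phi w)); under eq_integral do rewrite EFinM.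
    rewrite ge0_integralZr//; last by rewrite lee_fin phi0.
    - by rewrite integral_exp_decay.
    - by apply/measurable_EFinP; apply: measurable_funTS; apply: continuous_measurable_fun; exact: continuous_exp_scale.
  apply: ge0_le_integral => //.
  - apply: (measurableT_comp (f := abse)) => //.
    by apply: (measurableT_comp mF); exact: measurable_pair1.
  - by apply/measurable_EFinP; exact: measurable_funM.
  - move=> t _; rewrite /F/= lee_fin normrM (ger0_norm (E0 t)) ler_wpM2l//.
    by rewrite normrM (ger0_norm (phi0 w)) ler_piMl// normr_cos_le1.
have := Fubini iF; move=> /(congr1 fine).
have -> : (\int[m]_x \int[mu]_y F (x, y) = \int[m]_w (pi * (cauchy_pdf l (W w) * phi w))%:E)%E.
  apply: eq_integral => w _; rewrite /F /=.
  rewrite (intE (fun t => cos (t * W w) * phi w)).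
  have ic := integrable_exp_cos (W w) l0.
  rewrite mulrA -(integral_exp_cos (W w) l0) -RintegralZr// /Rintegral fineK.
    by apply: eq_integral => t _; rewrite mulrA.
  apply: integrable_fin_num => //.
  have := integrable_RZl mI0 (phi w) ic; apply: eq_integrable => // t _.
  by rewrite /= mulrC.
have -> : (\int[mu]_y \int[m]_x F (x, y) = \int[mu]_(t in I0)
    (expR (- l * t) * Rintegral m setT (fun w => cos (t * W w) * phi w))%:E)%E.
  rewrite -intE; apply: eq_integral => t _; rewrite /F /=.
  rewrite -RintegralZl//; last exact: integrable_weight_cos.
  rewrite /Rintegral fineK//; apply: integrable_fin_num => //.
  by apply: integrable_RZl => //; exact: integrable_weight_cos.
rewrite -/(Rintegral m setT (fun w => pi * (cauchy_pdf l (W w) * phi w))).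
rewrite RintegralZl//.
apply: (@integrable_Rle _ _ _ m setT measurableT _ (fun w => (pi * l)^-1 * phi w)) => //.
- by apply: measurable_funM => //; apply: measurableT_comp => //; exact: measurable_cauchy.
- exact: integrable_RZl.
- move=> w _; rewrite normrM (ger0_norm (phi0 w)) ler_wpM2r//.
  by rewrite ger0_norm ?cauchy_ge0// cauchy_le.
Qed.

End cauchy_fubini.

Section atan_bounds.
Context {R : realType}.
Implicit Types x y l r : R.

(** The function atan t + 1 / t is decreasing on the positive axis and dominates atan, which tends
    to pi / 2. *)
Lemma atan_lb y : 0 < y -> pi / 2 - y^-1 <= atan y.
Proof.
move=> y0; rewrite lerBlDr.
have mono (z : R) : y < z -> atan z <= atan y + y^-1.
  move=> yz; have z0 : 0 < z by apply: lt_trans yz.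
  pose h (t : R) := atan t + t^-1.
  have dh (t : R) : 0 < t -> is_derive t 1 h ((1 + t ^+ 2)^-1 - t ^- 2).
    move=> t0; have d1 := is_derive1_atan t.
    have d2 := is_deriveV (lt0r_neq0 t0) (is_derive_id t (1 : R)).
    have := is_deriveD d1 d2; rewrite /GRing.scale/= mulr1 => d3.
    by apply: is_derive_eq.
  have ch : {within `[y, z], continuous h}.
    apply: derivable_within_continuous => t; rewrite in_itv/= => /andP[yt _].
    by case: (dh t (lt_le_trans y0 yt)).
  have dh' (t : R) : t \in `]y, z[%R -> is_derive t 1 h ((1 + t ^+ 2)^-1 - t ^- 2).
    by rewrite in_itv/= => /andP[yt _]; apply: dh; exact: lt_trans yt.
  have [c cin hE] := MVT yz dh' ch.
  have c0 : 0 < c by move: cin; rewrite in_itv/= => /andP[yc _]; exact: lt_trans yc.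
  have c2 : 0 < c ^+ 2 by rewrite exprn_gt0.
  have : h z - h y <= 0.
    rewrite hE; apply: mulr_le0_ge0; last by rewrite subr_ge0 ltW.
    by rewrite subr_le0 lef_pV2 ?posrE//; [rewrite lerDr ler01|rewrite addr_gt0].
  rewrite subr_le0; apply: le_trans; rewrite /h lerDl invr_ge0 ltW//.
apply: (@cvgr_to_le _ _ _ _ _ _ _ (@cvgy_atan R)).
by near=> z; apply: mono; near: z; apply: nbhs_pinfty_gt; exact: num_real.
Unshelve. all: end_near. Qed.

Lemma is_derive_cauchy_primitive l x : 0 < l ->
  is_derive x 1 (fun x => pi^-1 * atan (l^-1 * x)) (cauchy_pdf l x).
Proof.
move=> l0; have D0 : 0 < l ^+ 2 + x ^+ 2 by rewrite ltr_wpDr ?sqr_ge0// exprn_gt0.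
have d1 := @is_derive_comp_scale _ atan _ l^-1 x (@is_derive1_atan R).
have d2 := is_deriveZ (pi^-1) d1.
apply: is_derive_eq; rewrite /GRing.scale/= /cauchy_pdf.
have D1 : 1 + (l^-1 * x) ^+ 2 = (l ^+ 2 + x ^+ 2) / l ^+ 2 by field; rewrite gt_eqF.
rewrite D1; move: (pi : R) (pi_gt0 R) => p p0; field.
by rewrite !gt_eqF.
Qed.

Lemma integral_cauchy_segment l r : 0 < l -> 0 < r ->
  Rintegral lebesgue_measure `[- r, r] (cauchy_pdf l) = 2 * pi^-1 * atan (r / l).
Proof.
move=> l0 r0; have rr : - r < r by rewrite gtrN.
have d1 (x : R) := is_derive_cauchy_primitive x l0.
have c1 := continuous_is_derive d1.
rewrite /Rintegral (@continuous_FTC2 _ (cauchy_pdf l) (fun x => pi^-1 * atan (l^-1 * x)))//=.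
- by rewrite mulrN atanN (mulrC l^-1); ring.
- by apply: continuous_subspaceT; exact: continuous_cauchy.
- split.
  + by move=> x _; case: (d1 x).
  + by apply: cvg_at_right_filter; exact: c1.
  + by apply: cvg_at_left_filter; exact: c1.
- by move=> x _; rewrite derive1E; case: (d1 x).
Qed.

End atan_bounds.

(** * The value of the limit density at 0 *)

Section density_at_0.
Context {R : realType}.
Variable f : R -> R.
Notation mu := (@lebesgue_measure R).
Hypothesis f0 : forall x, 0 <= f x.
Hypothesis cf : continuous f.
Hypothesis i_f : mu.-integrable setT (EFin \o f).
Hypothesis f1 : Rintegral mu setT f = 1.

(** On [-r, r] the continuity of f at 0 applies and the kernel has mass close to 1; outside, the
    kernel is at most l / (pi r^2) and f has mass 1. *)
Lemma cauchy_approx_identity e : 0 < e -> \forall l \near 0^'+,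
  `|Rintegral mu setT (fun x => cauchy_pdf l x * f x) - f 0| <= e.
Proof.
move=> e0; have e3 : 0 < e / 3 by rewrite divr_gt0.
have p0 := pi_gt0 R.
have [r0 r00 hr0] : exists2 r : R, 0 < r & forall x, `|x| < r -> `|f x - f 0| <= e / 3.
  have /cvgrPdist_le/(_ _ e3)/nbhs_ballP[r r0 hr] := cf (x := 0).
  exists r => // x xr; rewrite distrC; apply: hr.
  by rewrite /ball/= sub0r normrN.
pose r := r0 / 2; have r_gt0 : 0 < r by rewrite divr_gt0.
have hr x : `|x| <= r -> `|f x - f 0| <= e / 3.
  by move=> xr; apply: hr0; apply: (le_lt_trans xr); rewrite /r; lra.
near=> l.
have l0 : 0 < l by near: l; exact: nbhs_right_gt.
pose J : set (measurableTypeR R) := `[- r, r]%classic.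
have mJ : measurable J by exact: measurable_itv.
have mk : measurable_fun [set: measurableTypeR R] (cauchy_pdf l) by exact: measurable_cauchy.
have mf : measurable_fun [set: measurableTypeR R] f.
  by apply/measurable_EFinP; exact: measurable_int i_f.
have ikf : mu.-integrable setT (EFin \o (fun x => cauchy_pdf l x * f x)).
  apply: (@integrable_Rle _ _ _ mu _ _ _ (fun x => (pi * l)^-1 * f x)) => //.
  - exact: measurable_funM.
  - exact: integrable_RZl.
  - move=> x _; rewrite normrM (ger0_norm (f0 x)) ler_wpM2r//.
    by rewrite ger0_norm ?cauchy_ge0// cauchy_le.
have ikJ : mu.-integrable setT (EFin \o (fun x => cauchy_pdf l x * \1_J x)).
  have : mu.-integrable J (EFin \o cauchy_pdf l).
    apply: continuous_compact_integrable; first exact: segment_compact.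
    by apply: continuous_subspaceT; exact: continuous_cauchy.
  move/(integrable_mkcond _ mJ); apply: eq_integrable => // x _.
  rewrite /patch /= indicE; case: (x \in J); first by rewrite mulr1.
  by rewrite mulr0.
have EJ : Rintegral mu setT (fun x => cauchy_pdf l x * \1_J x) = 2 * pi^-1 * atan (r / l).
  rewrite -integral_cauchy_segment// [RHS]Rintegral_mkcond; apply: eq_Rintegral => x _.
  rewrite /patch /= indicE -/J; case: (x \in J); first by rewrite mulr1.
  by rewrite mulr0.
have J1 : 2 * pi^-1 * atan (r / l) <= 1.
  rewrite mulrAC ler_pdivrMr// mul1r; have := atan_ltpi2 (r / l); lra.
have J2 : 1 - 2 * pi^-1 * (l / r) <= 2 * pi^-1 * atan (r / l).
  have := @atan_lb _ (r / l) (divr_gt0 r_gt0 l0); rewrite invf_div => h.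
  have : 2 * pi^-1 * (pi / 2 - l / r) <= 2 * pi^-1 * atan (r / l).
    by rewrite ler_pM2l// mulr_gt0// invr_gt0.
  have -> : 2 * pi^-1 * (pi / 2 - l / r) = 1 - 2 * pi^-1 * (l / r).
    by move: (pi : R) p0 => p p0; field; rewrite !gt_eqF.
  by [].
have key : `|Rintegral mu setT (fun x => cauchy_pdf l x * f x) -
    f 0 * (2 * pi^-1 * atan (r / l))| <= e / 3 * (2 * pi^-1 * atan (r / l)) + l / (pi * r ^+ 2).
  rewrite -EJ -RintegralZl// -RintegralB//; last exact: integrable_RZl.
  have -> : e / 3 * Rintegral mu setT (fun x => cauchy_pdf l x * \1_J x) + l / (pi * r ^+ 2) =
      Rintegral mu setT (fun x => e / 3 * (cauchy_pdf l x * \1_J x) + l / (pi * r ^+ 2) * f x).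
    rewrite RintegralD//; try exact: integrable_RZl.
    by rewrite !RintegralZl// f1 mulr1.
  apply: Rintegral_norm_le => //.
  - apply: measurable_funB; first exact: measurable_funM.
    by apply: measurable_funM => //; apply: measurable_funM => //; exact: measurable_indic.
  - by apply: integrable_RD => //; exact: integrable_RZl.
  - move=> x _; have k0 := cauchy_ge0 x l0; rewrite indicE.
    have [xJ|xJ] := boolP (x \in J).
      rewrite !mulr1 mulrC -mulrBl normrM (ger0_norm k0); apply: (@le_trans _ _ (e / 3 * cauchy_pdf l x)).
        apply: ler_wpM2r => //; apply: hr; move: xJ; rewrite inE /J /= in_itv/=.
        by rewrite ler_norml.
      by rewrite lerDl mulr_ge0// divr_ge0 ?(ltW l0)// mulr_ge0 ?(ltW p0)// sqr_ge0.
    rewrite !mulr0 subr0 add0r normrM (ger0_norm k0) (ger0_norm (f0 x)) ler_wpM2r//.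
    rewrite /cauchy_pdf ler_pM2l// lef_pV2 ?posrE ?mulr_gt0 ?exprn_gt0//; last first.
      by rewrite ltr_wpDr ?sqr_ge0// exprn_gt0.
    rewrite ler_pM2l//; have xr : r < `|x|.
      rewrite ltNge; apply: contra xJ => xr; rewrite inE /J /= in_itv/=.
      by rewrite -ler_norml.
    apply: (@le_trans _ _ (x ^+ 2)); last by rewrite lerDr sqr_ge0.
    by rewrite -(real_normK (num_real x)); apply: lerXn2r; rewrite ?nnegrE// ltW.
have s1 : l / (pi * r ^+ 2) <= e / 6.
  rewrite ler_pdivrMr; last by rewrite mulr_gt0// exprn_gt0.
  near: l; apply: nbhs_right_le; apply: mulr_gt0; [by rewrite divr_gt0|exact: (mulr_gt0 (pi_gt0 R) (exprn_gt0 2 r_gt0))].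
have s2 : f 0 * (2 * pi^-1 * (l / r)) <= e / 6.
  have pr : 0 < pi * r :> R by rewrite mulr_gt0.
  have -> : f 0 * (2 * pi^-1 * (l / r)) = 2 * f 0 * l / (pi * r).
    by move: (pi : R) p0 => p p0; field; rewrite !gt_eqF.
  rewrite ler_pdivrMr//; apply: (@le_trans _ _ (2 * (f 0 + 1) * l)).
    by rewrite ler_wpM2r ?(ltW l0)//; lra.
  have f01 : 0 < 2 * (f 0 + 1) by have := f0 0; lra.
  rewrite mulrC -ler_pdivlMr//.
  near: l; apply: nbhs_right_le.
  have f01 : 0 < 2 * (f 0 + 1) by have := f0 0; lra.
  by apply: divr_gt0 f01; apply: mulr_gt0; [rewrite divr_gt0|exact: mulr_gt0 (pi_gt0 R) r_gt0].
have s3 : f 0 - f 0 * (2 * pi^-1 * (l / r)) <= f 0 * (2 * pi^-1 * atan (r / l)).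
  have := ler_wpM2l (f0 0) J2; lra.
have s4 : f 0 * (2 * pi^-1 * atan (r / l)) <= f 0.
  by have := ler_wpM2l (f0 0) J1; lra.
have s5 : e / 3 * (2 * pi^-1 * atan (r / l)) <= e / 3.
  by have := ler_wpM2l (ltW e3) J1; lra.
move: key s1 s2 s3 s4 s5.
move: (Rintegral _ _ _) (2 * pi^-1 * atan _) (l / (pi * _)) (2 * pi^-1 * (l / r)) (f 0) => I a c b F.
rewrite !ler_norml => /andP[? ?] ? ? ? ? ?; apply/andP; split; lra.
Unshelve. all: end_near. Qed.

(** Averaging f against the Cauchy kernel of scale l multiplies Fourier transforms and gives the
    Cauchy density of scale l + s at m; then l tends to 0. By evenness, the centred density at m is
    the density centred at m, taken at 0. *)
Lemma density_at0 (s m : R) : 0 < s ->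
  (forall t, Rintegral mu setT (fun x => cos (t * x) * f x) = expR (- (s * `|t|)) * cos (m * t)) ->
  f 0 = cauchy_pdf s m.
Proof.
move=> s0 fcos; have p0 := pi_gt0 R.
have E (l : R) : 0 < l -> Rintegral mu setT (fun x => cauchy_pdf l x * f x) = cauchy_pdf (l + s) m.
  move=> l0; apply: (mulfI (lt0r_neq0 p0)).
  have mid : measurable_fun [set: measurableTypeR R] (@id R) by exact: measurable_id.
  rewrite (Rintegral_cauchy (m := mu) mid f0 i_f l0) -integral_exp_cos ?addr_gt0//.
  apply: eq_Rintegral => t; rewrite inE/= in_itv/= andbT => t0.
  rewrite fcos ger0_norm// mulrA -expRD mulrC [RHS]mulrC (mulrC m); congr (_ * expR _); ring.
have cvk : cauchy_pdf (l + s) m @[l --> 0^'+] --> cauchy_pdf s m.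
  apply: cvg_at_right_filter; rewrite -[X in _ --> cauchy_pdf X m]add0r.
  have cs : (l + s) @[l --> (0 : R)] --> 0 + s by apply: cvgD; [exact: cvg_id|exact: cvg_cst].
  apply: cvgM => //; apply: cvgV.
    by rewrite add0r gt_eqF// mulr_gt0// ltr_wpDr ?sqr_ge0// exprn_gt0.
  apply: cvgM; first exact: cvg_cst.
  by apply: cvgD; [apply: cvgM|exact: cvg_cst].
apply/eqP; rewrite -subr_eq0 -normr_le0; apply/ler_addgt0Pr => e e0; rewrite add0r.
have e2 : 0 < e / 2 by rewrite divr_gt0.
near (0 : R)^'+ => l.
have l0 : 0 < l by near: l; exact: nbhs_right_gt.
have h1 : `|Rintegral mu setT (fun x => cauchy_pdf l x * f x) - f 0| <= e / 2.
  by near: l; exact: cauchy_approx_identity.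
have h2 : `|cauchy_pdf s m - cauchy_pdf (l + s) m| <= e / 2.
  by near: l; move/cvgrPdist_le : cvk; apply.
rewrite E// in h1; rewrite (splitr e) distrC.
by apply: le_trans (lerD h2 h1); exact: ler_distD.
Unshelve. all: end_near. Qed.

End density_at_0.

(** * Local limit theorem *)

Section charfun_continuity.
Context {R : realType} {d : measure_display} {T : measurableType d}.
Variable P : probability T R.

Lemma continuous_charfun_re (W : T -> R) : measurable_fun setT W -> continuous (charfun_re P W).
Proof.
move=> mW t.
have h := @continuity_under_integral R _ T P (fun t w => cos (t * W w)) setT measurableT
  (t - 1) (t + 1) _ _ (cst 1) _ _.
have tI : t \in (`]t - 1, t + 1[%classic : set R) by rewrite inE/= in_itv/=; lra.
apply: h tI => //.
- by move=> x _; exact: integrable_cos_mul.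
- apply: aeW => w _ x _; apply: (continuous_cvg _ (@continuous_cos R _)).
  by apply: cvgM; [exact: cvg_id|exact: cvg_cst].
- by apply: (@prob_integrable _ _ _ P _ 1) => // w; rewrite normr1.
- by move=> x _; apply: aeW => w _; exact: normr_cos_le1.
Qed.

Lemma continuous_charfun_im (W : T -> R) : measurable_fun setT W -> continuous (charfun_im P W).
Proof.
move=> mW t.
have h := @continuity_under_integral R _ T P (fun t w => sin (t * W w)) setT measurableT
  (t - 1) (t + 1) _ _ (cst 1) _ _.
have tI : t \in (`]t - 1, t + 1[%classic : set R) by rewrite inE/= in_itv/=; lra.
apply: h tI => //.
- by move=> x _; exact: integrable_sin_mul.
- apply: aeW => w _ x _; apply: (continuous_cvg _ (@continuous_sin R _)).
  by apply: cvgM; [exact: cvg_id|exact: cvg_cst].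
- by apply: (@prob_integrable _ _ _ P _ 1) => // w; rewrite normr1.
- by move=> x _; apply: aeW => w _; exact: normr_sin_le1.
Qed.

(** A shift z moves the phase by at most t |z|, so continuity at 0 is uniform over |z| <= 1. It
    makes the factor of the starting point negligible at small arguments. *)
Lemma charfun_near0 (W : T -> R) (e : R) : measurable_fun setT W -> 0 < e ->
  exists2 eta : R, 0 < eta & forall t z, 0 <= t -> t <= eta -> `|z| <= 1 ->
    `|charfun_re P (fun w => z + W w) t - 1| + `|charfun_im P (fun w => z + W w) t| <= e.
Proof.
move=> mW e0; have e4 : 0 < e / 4 by rewrite divr_gt0.
have re0 : charfun_re P W 0 = 1.
  by rewrite /charfun_re; under eq_Rintegral do rewrite mul0r cos0; exact: Rintegral_prob_cst.
have im0 : charfun_im P W 0 = 0.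
  by rewrite /charfun_im; under eq_Rintegral do rewrite mul0r sin0; exact: Rintegral_prob_cst.
have /cvgrPdist_le/(_ _ e4)/nbhs_ballP[r1 r10 h1] := continuous_charfun_re mW (x := 0).
have /cvgrPdist_le/(_ _ e4)/nbhs_ballP[r2 r20 h2] := continuous_charfun_im mW (x := 0).
rewrite /= in r10 r20.
exists (Num.min (Num.min (r1 / 2) (r2 / 2)) (e / 4)).
  by rewrite !lt_min !divr_gt0.
move=> t z t0; rewrite !le_min => /andP[/andP[t1 t2] t3] z1.
have b1 : ball (0 : R) r1 t by rewrite /ball/= sub0r normrN ger0_norm//; lra.
have b2 : ball (0 : R) r2 t by rewrite /ball/= sub0r normrN ger0_norm//; lra.
have {}h1 := h1 _ b1; have {}h2 := h2 _ b2; rewrite /= re0 im0 in h1 h2.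
have mzW : measurable_fun setT (fun w => z + W w) by exact: measurable_funD.
have tz (u : R) : `|t * (z + u) - t * u| <= e / 4.
  rewrite -mulrBr addrK normrM (ger0_norm t0); apply: (le_trans _ t3).
  by rewrite ler_piMr.
have d1 : `|charfun_re P (fun w => z + W w) t - charfun_re P W t| <= e / 4.
  rewrite /charfun_re -RintegralB//; try exact: integrable_cos_mul.
  apply: Rintegral_prob_bound.
    by apply: measurable_funB; exact: measurable_cos_mul.
  by move=> w; apply: le_trans (cos_lipschitz _ _) (tz _).
have d2 : `|charfun_im P (fun w => z + W w) t - charfun_im P W t| <= e / 4.
  rewrite /charfun_im -RintegralB//; try exact: integrable_sin_mul.
  apply: Rintegral_prob_bound.
    by apply: measurable_funB; exact: measurable_sin_mul.
  by move=> w; apply: le_trans (sin_lipschitz _ _) (tz _).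
rewrite sub0r normrN in h2.
have a1 : `|charfun_re P (fun w => z + W w) t - 1| <= e / 2.
  rewrite (_ : e / 2 = e / 4 + e / 4); last by lra.
  by apply: le_trans (ler_distD (charfun_re P W t) _ _) _; apply: lerD => //; rewrite distrC.
have a2 : `|charfun_im P (fun w => z + W w) t| <= e / 2.
  rewrite (_ : e / 2 = e / 4 + e / 4); last by lra.
  rewrite -[X in `|X|](subrK (charfun_im P W t)).
  by apply: (le_trans (ler_normD _ _)); apply: lerD.
lra.
Qed.

End charfun_continuity.

(** * Smoothed local limit estimates *)

Section smoothed_llt.
Context {R : realType} {d : measure_display} {T : measurableType d}.
Variable P : probability T R.
Variables (X : nat -> T -> R) (A : nat -> R) (eta0 C : R).
Hypothesis mX : forall i, measurable_fun setT (X i).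
Hypothesis iX : mutually_independent P X.
Hypothesis idX : identically_distributed P X.
Local Notation re := (charfun_re P).
Local Notation im := (charfun_im P).
Local Notation q := (charfun_sq P (X 0%N)).
Notation mu := (@lebesgue_measure R).
Hypothesis A_gt0 : forall n, (0 < n)%N -> 0 < A n.
Hypothesis C0 : 0 < C.
Variables (s m : R).
Hypothesis s0 : 0 < s.
Hypothesis re_cvg : forall u, 0 <= u ->
  re (walk X n) (u / A n) @[n --> \oo] --> expR (- (s * u)) * cos (m * u).
Hypothesis dom : \forall n \near \oo, forall u, 0 <= u -> u <= eta0 * A n ->
  Num.sqrt (q (u / A n) ^+ n) <= C / (1 + u ^+ 2).
Hypothesis A_inf : forall K : R, \forall n \near \oo, K < A n.

(** The main term on the Fourier side, an inversion integral cut at u = eta A_n. Neither the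
    smoothing scale nor the starting point enters it, which makes the comparison uniform in both. *)
Let J eta n := Rintegral mu `[0%R, +oo[
  (fun u => re (walk X n) (u / A n) * (u <= eta * A n)%R%:R).

Let mI0 : measurable (`[0%R, +oo[%classic : set (measurableTypeR R)).
Proof. exact: measurable_itv. Qed.

Let measurable_J eta n : measurable_fun [set: measurableTypeR R]
  (fun u : R => re (walk X n) (u / A n) * (u <= eta * A n)%R%:R).
Proof.
apply: measurable_funM.
  apply: (measurableT_comp (f := re (walk X n))).
    by apply: continuous_measurable_fun; apply: continuous_charfun_re; exact: measurable_walk.
  by apply: measurable_funM.
exact: (measurable_heaviside (eta * A n)).
Qed.

Let integrable_dom (c : R) : mu.-integrable `[0%R, +oo[ (EFin \o (fun u => c / (1 + u ^+ 2))).
Proof. by apply: integrable_RZl => //; exact: integrable_inv_oneDsqr. Qed.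

Let Rintegral_dom (c : R) :
  Rintegral mu `[0%R, +oo[ (fun u => c / (1 + u ^+ 2)) = c * (pi / 2).
Proof.
rewrite RintegralZl//; last exact: integrable_inv_oneDsqr.
by rewrite /Rintegral integral_inv_oneDsqr.
Qed.

Let Rintegral_exp (l : R) : 0 < l ->
  Rintegral mu `[0%R, +oo[ (fun u => expR (- l * u)) = l^-1.
Proof. by move=> l0; rewrite /Rintegral integral_exp_decay. Qed.

(** Dominated convergence under C / (1 + u^2); the cut disappears since A_n tends to infinity. The
    index is shifted by [N] because the domination is known only eventually. *)
Lemma truncated_inversion eta : 0 < eta -> eta <= eta0 ->
  J eta n @[n --> \oo] --> pi * cauchy_pdf s m.
Proof.
move=> eta_gt0 eta_le; rewrite -(integral_exp_cos m s0).
have [N _ hN] := dom.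
rewrite -(cvg_shiftn N) /=.
apply: (@Rdominated_cvg _ _ _ mu _ mI0 _ _ (fun u => C / (1 + u ^+ 2))).
- by move=> n; apply: measurable_funTS; exact: measurable_J.
- apply: measurable_funTS; apply: measurable_funM.
    by apply: continuous_measurable_fun; exact: continuous_exp_scale.
  by under eq_fun do rewrite mulrC; exact: measurable_cos_scale.
- move=> u; rewrite /= in_itv/= andbT => u0.
  rewrite mulNr (mulrC u m); have h := re_cvg u0.
  move: h; rewrite -(cvg_shiftn N) => h; apply: cvg_trans h; apply: near_eq_cvg.
  near=> n; rewrite (_ : u <= _ = true) ?mulr1//.
  rewrite -ler_pdivrMl// mulrC; apply: ltW.
  near: n; have [K _ hK] := A_inf (u / eta); exists K => // k /= Kk.
  by apply: hK; rewrite /= (leq_trans Kk)// leq_addr.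
- exact: integrable_dom.
- move=> n u; rewrite /= in_itv/= andbT => u0.
  have [uA|uA] := boolP (u <= eta * A (n + N)%N); last first.
    by rewrite mulr0 normr0 divr_ge0 ?(ltW C0)// addr_ge0// sqr_ge0.
  rewrite mulr1; apply: (le_trans (normr_charfun_re_le _ _ _)).
  rewrite charfun_sq_walk//; apply: hN => //=; first exact: leq_addl.
  (* Positivity of A is assumed from index 1 on; at index 0 the constraint 0 <= u <= eta A_0 itself
     gives A_0 >= 0. *)
  have [n0|n0] := posnP (n + N)%N.
    rewrite n0 in uA *; have A0 : 0 <= A 0%N.
      by rewrite -(pmulr_rge0 _ eta_gt0) (le_trans u0).
    by apply: (le_trans uA); rewrite ler_wpM2r.
  by apply: (le_trans uA); rewrite ler_wpM2r// ltW// A_gt0.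
Unshelve. all: end_near. Qed.

Section shifted.
Variables (V : T -> R).
Hypothesis mV : measurable_fun setT V.
Hypothesis iV : indep_of_process P V (walk X).

Lemma indep2_initial n : indep2 P V (walk X n).
Proof.
move=> B B' mB mB'.
have := @iV B [:: n] (fun=> B') mB (fun=> mB').
by rewrite big_seq1.
Qed.

Let W n w := V w + walk X n w.

Let mWn n : measurable_fun setT (W n).
Proof. by apply: measurable_funD => //; exact: measurable_walk. Qed.

Lemma normr_charfun_shift_le n t : `|re (W n) t| <= Num.sqrt (q t ^+ n).
Proof.
apply: (le_trans (normr_charfun_re_le _ _ _)).
rewrite ler_sqrt ?exprn_ge0 ?charfun_sq_ge0// charfun_sqD//; last exact: indep2_initial.
  by rewrite charfun_sq_walk// ler_piMl ?exprn_ge0 ?charfun_sq_ge0 ?charfun_sq_le1.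
exact: measurable_walk.
Qed.

Lemma charfun_shift_dist n t : `|re (W n) t - re (walk X n) t| <=
  (`|re V t - 1| + `|im V t|) * Num.sqrt (q t ^+ n).
Proof.
rewrite charfun_reD//; last 2 first.
- exact: measurable_walk.
- exact: indep2_initial.
have -> : re V t * re (walk X n) t - im V t * im (walk X n) t - re (walk X n) t =
  (re V t - 1) * re (walk X n) t - im V t * im (walk X n) t by ring.
rewrite [leRHS]mulrDl; apply: (le_trans (ler_normB _ _)); rewrite !normrM; apply: lerD.
  by apply: ler_wpM2l => //; rewrite -charfun_sq_walk//; exact: normr_charfun_re_le.
apply: ler_wpM2l => //; rewrite -charfun_sq_walk//.
by rewrite -sqrtr_sqr ler_sqrt ?charfun_sq_ge0// lerDr sqr_ge0.
Qed.

(** Dividing the position by A_n turns the scale l into l / A_n and brings out a factor A_n, so the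
    Fourier variable becomes u / A_n. *)
Lemma cauchy_scale n l : (0 < n)%N -> 0 < l ->
  pi * (A n * Rintegral P setT (fun w => cauchy_pdf l (W n w))) =
  Rintegral mu `[0%R, +oo[ (fun u => expR (- (l / A n) * u) * re (W n) (u / A n)).
Proof.
move=> n0 l0; have An := A_gt0 n0.
have lA : 0 < l / A n by rewrite divr_gt0.
have ic1 : P.-integrable setT (EFin \o cst (1 : R)).
  by apply: (@prob_integrable _ _ _ P _ 1) => // w; rewrite normr1.
have mWA : measurable_fun setT (fun w => W n w / A n) by exact: measurable_funM.
have := Rintegral_cauchy (m := P) mWA (fun=> ler01) ic1 lA.
have -> : Rintegral P setT (fun w => cauchy_pdf (l / A n) (W n w / A n) * cst 1 w) =
    A n * Rintegral P setT (fun w => cauchy_pdf l (W n w)).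
  rewrite -RintegralZl//.
    apply: eq_Rintegral => w _; rewrite mulr1 /cauchy_pdf.
    have D0 : 0 < l ^+ 2 + W n w ^+ 2 by rewrite ltr_wpDr ?sqr_ge0// exprn_gt0.
    have -> : (l / A n) ^+ 2 + (W n w / A n) ^+ 2 = (l ^+ 2 + W n w ^+ 2) / A n ^+ 2.
      by field; rewrite gt_eqF.
    by move: (pi : R) (pi_gt0 R) => p p0; field; rewrite !gt_eqF.
  apply: (@prob_integrable _ _ _ P _ (pi * l)^-1).
    by apply: measurableT_comp => //; exact: measurable_cauchy.
  by move=> w; rewrite ger0_norm ?cauchy_ge0// cauchy_le.
move=> ->; apply: eq_Rintegral => u _; congr (_ * _).
apply: eq_Rintegral => w _; rewrite mulr1; congr cos; ring.
Qed.

Let integrable_cmp (l c r : R) : 0 < l -> mu.-integrable `[0%R, +oo[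
  (EFin \o (fun u => c / (1 + u ^+ 2) + r * expR (- l * u))).
Proof.
move=> l0; apply: integrable_RD => //.
by apply: integrable_RZl => //; exact: integrable_exp_decay.
Qed.

Let Rintegral_cmp (l c r : R) : 0 < l -> Rintegral mu `[0%R, +oo[
  (fun u => c / (1 + u ^+ 2) + r * expR (- l * u)) = c * (pi / 2) + r / l.
Proof.
move=> l0; rewrite RintegralD//; last first.
  by apply: integrable_RZl => //; exact: integrable_exp_decay.
rewrite Rintegral_dom RintegralZl// ?Rintegral_exp//.
exact: integrable_exp_decay.
Qed.

Let measurable_W n l : measurable_fun [set: measurableTypeR R]
  (fun u : R => expR (- l * u) * re (W n) (u / A n)).
Proof.
apply: measurable_funM.
  by apply: continuous_measurable_fun; exact: continuous_exp_scale.
apply: (measurableT_comp (f := re (W n))).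
  by apply: continuous_measurable_fun; exact: continuous_charfun_re.
by apply: measurable_funM.
Qed.

Variables (eta r : R).
Hypothesis eta_gt0 : 0 < eta.
Hypothesis eta_le : eta <= eta0.
Hypothesis r0 : 0 <= r.
Hypothesis q_gap : forall t, eta <= t -> q t <= r.

Let domn n := forall u, 0 <= u -> u <= eta0 * A n ->
  Num.sqrt (q (u / A n) ^+ n) <= C / (1 + u ^+ 2).

Let gapn n u : (0 < n)%N -> ~~ (u <= eta * A n) -> Num.sqrt (q (u / A n) ^+ n) <= Num.sqrt (r ^+ n).
Proof.
move=> n0 uA; rewrite ler_sqrt ?exprn_ge0//; apply: lerXn2r; rewrite ?nnegrE ?charfun_sq_ge0//.
by apply: q_gap; rewrite ler_pdivlMr ?A_gt0// ltW// ltNge.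
Qed.

(** Below the cut u = eta A_n the domination integrates to C pi / 2; above it the gap gives
    sqrt(r^n), and the symbol exp(-l u / A_n) of the kernel integrates to A_n / l. *)
Lemma cauchy_mean_le n l : (0 < n)%N -> domn n -> 0 < l ->
  pi * (A n * Rintegral P setT (fun w => cauchy_pdf l (W n w))) <=
  C * (pi / 2) + Num.sqrt (r ^+ n) * (A n / l).
Proof.
move=> n0 dn l0; have An := A_gt0 n0; have lA : 0 < l / A n by rewrite divr_gt0.
rewrite cauchy_scale// -[A n / l]invf_div -Rintegral_cmp//.
apply: (le_trans (ler_norm _)); apply: Rintegral_norm_le => //.
- exact: measurable_funTS.
- exact: integrable_cmp.
move=> u; rewrite /= in_itv/= andbT => u0.
have E1 : expR (- (l / A n) * u) <= 1.
  by rewrite -expR0 ler_expR mulNr oppr_le0 mulr_ge0// ltW.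
have E0 := expR_ge0 (- (l / A n) * u).
have h1 := normr_charfun_shift_le n (u / A n).
rewrite normrM (ger0_norm E0).
have D0 : 0 <= C / (1 + u ^+ 2) by rewrite divr_ge0 ?(ltW C0)// addr_ge0// sqr_ge0.
have [uA|uA] := boolP (u <= eta * A n).
  apply: (@le_trans _ _ (C / (1 + u ^+ 2))); last first.
    by rewrite lerDl mulr_ge0// sqrtr_ge0.
  apply: (@le_trans _ _ `|re (W n) (u / A n)|); first by rewrite ler_piMl.
  apply: (le_trans h1); apply: dn => //; apply: (le_trans uA).
  by rewrite ler_wpM2r// ltW.
apply: (@le_trans _ _ (Num.sqrt (r ^+ n) * expR (- (l / A n) * u))); last by rewrite lerDr.
by rewrite mulrC ler_wpM2r// (le_trans h1)// gapn.
Qed.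

(** The same split. Below the cut, with t = u / A_n, the integrand differs from that of [J] by the
    symbol, where 1 - exp(-l t) <= l t, and by the factor of [V]; together they cost at most e times
    the domination. *)
Lemma cauchy_mean_dist n l e : (0 < n)%N -> domn n -> 0 < l -> 0 <= e ->
  (forall t, 0 <= t -> t <= eta -> l * t + (`|re V t - 1| + `|im V t|) <= e) ->
  `|pi * (A n * Rintegral P setT (fun w => cauchy_pdf l (W n w))) - J eta n| <=
  e * C * (pi / 2) + Num.sqrt (r ^+ n) * (A n / l).
Proof.
move=> n0 dn l0 e0 he; have An := A_gt0 n0; have lA : 0 < l / A n by rewrite divr_gt0.
have iJ : mu.-integrable `[0%R, +oo[ (EFin \o (fun u => re (walk X n) (u / A n) * (u <= eta * A n)%R%:R)).
  apply: (@integrable_Rle _ _ _ mu _ mI0 _ (fun u => C / (1 + u ^+ 2))).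
  - exact: measurable_funTS.
  - exact: integrable_dom.
  - move=> u; rewrite /= in_itv/= andbT => u0.
    have [uA|uA] := boolP (u <= eta * A n); last first.
      by rewrite mulr0 normr0 divr_ge0 ?(ltW C0)// addr_ge0// sqr_ge0.
    rewrite mulr1; apply: (le_trans (normr_charfun_re_le _ _ _)).
    rewrite charfun_sq_walk//; apply: dn => //.
    by apply: (le_trans uA); rewrite ler_wpM2r// ltW.
have iW : mu.-integrable `[0%R, +oo[ (EFin \o (fun u => expR (- (l / A n) * u) * re (W n) (u / A n))).
  apply: (@integrable_Rle _ _ _ mu _ mI0 _ (fun u => expR (- (l / A n) * u))).
  - exact: measurable_funTS.
  - exact: integrable_exp_decay.
  - move=> u _; rewrite normrM ger0_norm ?expR_ge0// ler_piMr ?expR_ge0//.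
    apply: Rintegral_prob_bound => [|w]; last exact: normr_cos_le1.
    exact: measurable_cos_mul.
rewrite cauchy_scale// -RintegralB// -[A n / l]invf_div -Rintegral_cmp//.
apply: Rintegral_norm_le => //.
- by apply: measurable_funB; exact: measurable_funTS.
- exact: integrable_cmp.
move=> u; rewrite /= in_itv/= andbT => u0.
have E1 : expR (- (l / A n) * u) <= 1.
  by rewrite -expR0 ler_expR mulNr oppr_le0 mulr_ge0// ltW.
have E0 := expR_ge0 (- (l / A n) * u).
have h1 := normr_charfun_shift_le n (u / A n).
have D0 : 0 <= e * C / (1 + u ^+ 2).
  by rewrite divr_ge0 ?mulr_ge0// ?(ltW C0)// addr_ge0// sqr_ge0.
have [uA|uA] := boolP (u <= eta * A n); last first.
  rewrite mulr0 subr0 normrM (ger0_norm E0).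
  apply: (@le_trans _ _ (Num.sqrt (r ^+ n) * expR (- (l / A n) * u))); last by rewrite lerDr.
  by rewrite mulrC ler_wpM2r// (le_trans h1)// gapn.
rewrite mulr1; apply: (@le_trans _ _ (e * C / (1 + u ^+ 2))); last first.
  by rewrite lerDl mulr_ge0// sqrtr_ge0.
have uA0 : u / A n <= eta by rewrite ler_pdivrMr.
have u0A : 0 <= u / A n by rewrite divr_ge0// ltW.
have dnu : Num.sqrt (q (u / A n) ^+ n) <= C / (1 + u ^+ 2).
  by apply: dn => //; apply: (le_trans uA); rewrite ler_wpM2r// ltW.
have -> : expR (- (l / A n) * u) * re (W n) (u / A n) - re (walk X n) (u / A n) =
  (re (W n) (u / A n) - re (walk X n) (u / A n)) - (1 - expR (- (l / A n) * u)) * re (W n) (u / A n).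
  ring.
apply: (le_trans (ler_normB _ _)).
have h2 := charfun_shift_dist n (u / A n).
have h3 : `|(1 - expR (- (l / A n) * u)) * re (W n) (u / A n)| <=
    l * (u / A n) * Num.sqrt (q (u / A n) ^+ n).
  rewrite normrM; apply: ler_pM => //.
  rewrite ger0_norm ?subr_ge0// lerBlDl -lerBlDr.
  by have := expR_ge1Dx (- (l / A n) * u); rewrite mulNr mulrAC mulrA.
apply: (le_trans (lerD h2 h3)); rewrite -mulrDl addrC -mulrA.
apply: ler_pM => //; [|exact: he].
by apply: addr_ge0; [rewrite mulr_ge0// ltW|rewrite addr_ge0].
Qed.

End shifted.
End smoothed_llt.

(** * Sandwiching window indicators between smoothed windows *)

Section cauchy_window.
Context {R : realType}.
Implicit Types x y l e r : R.

(** The Cauchy distribution function minus 1/2, an odd primitive of the density; the constant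
    cancels in differences. *)
Definition cauchy_cdf l x : R := pi^-1 * atan (l^-1 * x).

(* the indicator of ]-e, e[ convolved with the Cauchy density of scale l *)
Definition cauchy_window e l x : R := cauchy_cdf l (x + e) - cauchy_cdf l (x - e).

Lemma continuous_cauchy_cdf l : 0 < l -> continuous (cauchy_cdf l).
Proof. by move=> l0; exact: continuous_is_derive (fun x => is_derive_cauchy_primitive x l0). Qed.

Lemma normr_cauchy_cdf_le1 l x : `|cauchy_cdf l x| <= 1.
Proof.
have p0 := pi_gt0 R; rewrite /cauchy_cdf normrM gtr0_norm ?invr_gt0// ler_pdivrMl// mulr1.
have := atan_gtNpi2 (l^-1 * x); have := atan_ltpi2 (l^-1 * x).
by rewrite ler_norml => ? ?; apply/andP; split; lra.
Qed.

Lemma cauchy_window_le1 e l x : cauchy_window e l x <= 1.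
Proof.
have p0 := pi_gt0 R; rewrite /cauchy_window /cauchy_cdf -mulrBr ler_pdivrMl// mulr1.
have := atan_ltpi2 (l^-1 * (x + e)); have := atan_gtNpi2 (l^-1 * (x - e)); lra.
Qed.

Lemma invpi_le1 : pi^-1 <= 1 :> R.
Proof. by rewrite invf_le1 ?pi_gt0//; have := @pi_ge2 R; lra. Qed.

(** Allows approximation errors inside the window to be measured by the Cauchy kernel of the same
    scale, whose mean under the walk is controlled by [cauchy_mean_le]. *)
Lemma cauchy_ge_inside e x : 0 < e -> `|x| < e -> 1 <= 2 * pi * e * cauchy_pdf e x.
Proof.
move=> e0 xe; have D0 : 0 < e ^+ 2 + x ^+ 2 by rewrite ltr_wpDr ?sqr_ge0// exprn_gt0.
have -> : 2 * pi * e * cauchy_pdf e x = 2 * e ^+ 2 / (e ^+ 2 + x ^+ 2).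
  by rewrite /cauchy_pdf; move: (pi : R) (pi_gt0 R) => p p0; field; rewrite !gt_eqF.
rewrite ler_pdivlMr// mul1r; have : x ^+ 2 <= e ^+ 2.
  by rewrite -(real_normK (num_real x)); apply: lerXn2r; rewrite ?nnegrE// ltW.
lra.
Qed.

(** The window is widened by dl e and smoothed at scale dl^3 e. For x inside, the Cauchy mass lost
    beyond the margin is of the order of scale over margin, dl^2, and [cauchy_ge_inside] turns it
    into a multiple of the kernel. *)
Lemma indicator_le_window e dl x : 0 < e -> 0 < dl ->
  (`|x| < e)%R%:R <= cauchy_window (e + dl * e) (dl ^+ 3 * e) x +
     4 * dl ^+ 2 * e * cauchy_pdf e x.
Proof.
move=> e0 d0; have p0 := pi_gt0 R.
have l0 : 0 < dl ^+ 3 * e by rewrite mulr_gt0// exprn_gt0.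
have [xe|xe] := boolP (`|x| < e); last first.
  rewrite addr_ge0//; last by rewrite mulr_ge0 ?cauchy_ge0// !mulr_ge0// ?sqr_ge0// ltW.
  rewrite subr_ge0 ler_pM2l ?invr_gt0//; apply: le_atan; rewrite ler_pM2l ?invr_gt0//.
  by have := mulr_gt0 d0 e0; lra.
have /andP[x1 x2] : - e < x < e by rewrite -ltr_norml.
have d2 : 0 < dl ^- 2 by rewrite invr_gt0 exprn_gt0.
have E : (dl ^+ 3 * e)^-1 * (dl * e) = dl ^- 2 by field; rewrite !gt_eqF.
have a1 : pi / 2 - dl ^+ 2 <= atan ((dl ^+ 3 * e)^-1 * (x + (e + dl * e))).
  apply: (@le_trans _ _ (atan (dl ^- 2))).
    by have := atan_lb d2; rewrite invrK.
  by apply: le_atan; rewrite -E ler_pM2l ?invr_gt0//; lra.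
have a2 : atan ((dl ^+ 3 * e)^-1 * (x - (e + dl * e))) <= - (pi / 2 - dl ^+ 2).
  apply: (@le_trans _ _ (atan (- (dl ^- 2)))); last first.
    by rewrite atanN lerN2; have := atan_lb d2; rewrite invrK.
  by apply: le_atan; rewrite -E -mulrN ler_pM2l ?invr_gt0//; lra.
have g1 : 1 - 2 * pi^-1 * dl ^+ 2 <= cauchy_window (e + dl * e) (dl ^+ 3 * e) x.
  rewrite /cauchy_window /cauchy_cdf -mulrBr.
  have -> : 1 - 2 * pi^-1 * dl ^+ 2 = pi^-1 * (pi - 2 * dl ^+ 2).
    by move: (pi : R) p0 => p p0; field; rewrite gt_eqF.
  by rewrite ler_pM2l ?invr_gt0//; lra.
have g2 : 2 * pi^-1 * dl ^+ 2 <= 4 * dl ^+ 2 * e * cauchy_pdf e x.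
  have := cauchy_ge_inside e0 xe.
  have c0 : 0 < 2 * pi^-1 * dl ^+ 2 by rewrite mulr_gt0 ?exprn_gt0// mulr_gt0// invr_gt0.
  rewrite -(ler_pM2l c0) mulr1 => h; apply: (le_trans h).
  rewrite le_eqVlt; apply/orP; left; apply/eqP.
  by move: (cauchy_pdf e x) (pi : R) p0 => k p p0; field; rewrite gt_eqF.
by rewrite /=; lra.
Qed.

(** By the mean value theorem the smoothed window is its width times the kernel at some c, and |c|
    >= |x| - (e - r) >= (r / e) |x|. The kernel at c is at most l / (pi c^2), comparable to the
    kernel of scale e at x since |x| >= e. *)
Lemma window_outside e r l x : 0 < r -> r < e -> 0 < l -> e <= `|x| ->
  cauchy_window (e - r) l x <= 4 * e ^+ 2 * l / r ^+ 2 * cauchy_pdf e x.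
Proof.
move=> r0 re l0 ex; have p0 := pi_gt0 R.
have e0 : 0 < e by apply: lt_trans re.
have ab : x - (e - r) < x + (e - r) by lra.
have x2 : 0 < x ^+ 2.
  by rewrite -(real_normK (num_real x)) exprn_gt0// (lt_le_trans e0).
have D0 : 0 < e ^+ 2 + x ^+ 2 by rewrite addr_gt0// exprn_gt0.
have dc c : c \in `]x - (e - r), x + (e - r)[%R -> is_derive c 1 (cauchy_cdf l) (cauchy_pdf l c).
  by move=> _; exact: is_derive_cauchy_primitive.
have cc : {within `[x - (e - r), x + (e - r)], continuous (cauchy_cdf l)}.
  by apply: continuous_subspaceT; exact: continuous_cauchy_cdf.
have [c cin hE] := MVT ab dc cc; rewrite /cauchy_window hE.
have cx : r / e * `|x| <= `|c|.
  have h : `|x| - (e - r) <= `|c|.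
    move: cin; rewrite in_itv/= => /andP[c1 c2].
    have : `|x - c| <= e - r by rewrite ler_norml; apply/andP; split; lra.
    by have := ler_distD c x 0; rewrite !subr0; lra.
  apply: le_trans h; have : r / e * `|x| <= `|x| - (1 - r / e) * e.
    have r1 : 0 <= 1 - r / e by rewrite subr_ge0 ler_pdivrMr// mul1r ltW.
    have := ler_wpM2l r1 ex; lra.
  by rewrite mulrBl divfK ?gt_eqF// mul1r.
have cx2 : (r / e) ^+ 2 * x ^+ 2 <= l ^+ 2 + c ^+ 2.
  rewrite -(real_normK (num_real x)) -(real_normK (num_real c)) -exprMn.
  apply: (@le_trans _ _ (`|c| ^+ 2)); last by rewrite lerDr sqr_ge0.
  by apply: lerXn2r; rewrite ?nnegrE// mulr_ge0// divr_ge0// ltW.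
have re0 : 0 < (r / e) ^+ 2 * x ^+ 2 by rewrite mulr_gt0// exprn_gt0// divr_gt0.
have lc0 : 0 < l ^+ 2 + c ^+ 2 by apply: lt_le_trans cx2.
have k1 : cauchy_pdf l c <= l / (pi * ((r / e) ^+ 2 * x ^+ 2)).
  by rewrite /cauchy_pdf ler_pM2l// lef_pV2 ?posrE; [rewrite ler_pM2l|exact: mulr_gt0|exact: mulr_gt0].
have k0 := cauchy_ge0 c l0.
apply: (@le_trans _ _ (cauchy_pdf l c * (2 * e))).
  by apply: ler_wpM2l => //; lra.
apply: (@le_trans _ _ (l / (pi * ((r / e) ^+ 2 * x ^+ 2)) * (2 * e))).
  by apply: ler_wpM2r => //; lra.
have -> : l / (pi * ((r / e) ^+ 2 * x ^+ 2)) * (2 * e) =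
    2 * e ^+ 2 * l / r ^+ 2 / pi * e * (x ^+ 2)^-1.
  by move: (pi : R) p0 (x ^+ 2) x2 => p p0 X X0; field; rewrite !gt_eqF.
have -> : 4 * e ^+ 2 * l / r ^+ 2 * cauchy_pdf e x =
    2 * e ^+ 2 * l / r ^+ 2 / pi * e * (2 / (e ^+ 2 + x ^+ 2)).
  by rewrite /cauchy_pdf; move: (pi : R) p0 => p p0; field; rewrite !gt_eqF.
apply: ler_wpM2l.
  rewrite !mulr_ge0 ?invr_ge0 ?(ltW p0) ?(ltW l0) ?(ltW e0) ?sqr_ge0//.
rewrite ler_pdivlMr// mulrC ler_pdivrMr//.
have : e ^+ 2 <= x ^+ 2.
  by rewrite -(real_normK (num_real x)); apply: lerXn2r; rewrite ?nnegrE// ltW.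
lra.
Qed.

(** Here the exponent 3 matters: with scale dl^3 e and margin dl e the error factor e^2 l / r^2 is
    dl e, small relative to e, whereas a scale dl^2 e would leave a factor of order e. *)
Lemma window_le_indicator e dl x : 0 < e -> 0 < dl -> dl < 1 ->
  cauchy_window (e - dl * e) (dl ^+ 3 * e) x <=
    (`|x| < e)%R%:R + 4 * dl * e * cauchy_pdf e x.
Proof.
move=> e0 d0 d1; have l0 : 0 < dl ^+ 3 * e by rewrite mulr_gt0// exprn_gt0.
have k0 : 0 <= 4 * dl * e * cauchy_pdf e x.
  by rewrite mulr_ge0 ?cauchy_ge0// !mulr_ge0// ltW.
have [xe|xe] := boolP (`|x| < e).
  by apply: (le_trans (cauchy_window_le1 _ _ _)); rewrite /= lerDl.
rewrite -leNgt in xe; rewrite /= add0r.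
have r0 : 0 < dl * e by rewrite mulr_gt0.
have re : dl * e < e by rewrite gtr_pMl.
apply: (le_trans (window_outside r0 re l0 xe)).
rewrite (_ : 4 * e ^+ 2 * (dl ^+ 3 * e) / (dl * e) ^+ 2 = 4 * dl * e)//.
by field; rewrite !gt_eqF.
Qed.

End cauchy_window.

Section window_mean.
Context {R : realType} {d : measure_display} {T : measurableType d}.
Variable P : probability T R.

Lemma measurable_cauchy_cdf (l : R) : 0 < l -> measurable_fun setT (cauchy_cdf l).
Proof. by move=> l0; apply: continuous_measurable_fun; exact: continuous_cauchy_cdf. Qed.

(* mean value theorem applied to c |-> E[cauchy_cdf l (c + W)] *)
Lemma window_mean (W : T -> R) (l e a v dl : R) : measurable_fun setT W -> 0 < l -> 0 < e ->
  (forall c, `|c| <= e ->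
    `|a * Rintegral P setT (fun w => cauchy_pdf l (c + W w)) - v| <= dl) ->
  `|a * Rintegral P setT (fun w => cauchy_window e l (W w)) - 2 * e * v| <= 2 * e * dl.
Proof.
move=> mW l0 e0 hc.
pose Phi (c : R) := Rintegral P setT (fun w => cauchy_cdf l (c + W w)).
pose phi (c : R) := Rintegral P setT (fun w => cauchy_pdf l (c + W w)).
have mcW c : measurable_fun setT (fun w => c + W w) by exact: measurable_funD.
have iPhi c : P.-integrable setT (EFin \o (fun w => cauchy_cdf l (c + W w))).
  apply: (@prob_integrable _ _ _ P _ 1).
    by apply: measurableT_comp => //; exact: measurable_cauchy_cdf.
  by move=> w; exact: normr_cauchy_cdf_le1.
have dcdf w (c : R) : is_derive c 1 (fun c => cauchy_cdf l (c + W w)) (cauchy_pdf l (c + W w)).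
  have h1 := is_derive_cauchy_primitive (c + W w) l0.
  have h2 := is_deriveD (is_derive_id c (1 : R)) (is_derive_cst (W w) c 1).
  rewrite addr0 in h2.
  by have := @is_derive1_comp R (cauchy_cdf l) (id + cst (W w)) c _ _ h1 h2; rewrite mulr1.
have dPhi (c : R) : is_derive c 1 Phi (phi c).
  have cI : `]c - 1, c + 1[%classic c by rewrite /= in_itv/=; lra.
  have G0 (w : T) : 0 <= cst ((pi * l)^-1 : R) w.
    by rewrite invr_ge0 mulr_ge0 ?pi_ge0// ltW.
  have iG : P.-integrable setT (EFin \o cst ((pi * l)^-1 : R)).
    by apply: (@prob_integrable _ _ _ P _ `|(pi * l)^-1|).
  have dd (c' : R) w : derivable (fun c => cauchy_cdf l (c + W w)) c' 1.
    by case: (dcdf w c').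
  have d1E (c' : R) w : partial1of2 (fun c w => cauchy_cdf l (c + W w)) c' w = cauchy_pdf l (c' + W w).
    by rewrite partial1of2E; case: (dcdf w c').
  have Gub (c' : R) w : `]c - 1, c + 1[%classic c' -> setT w ->
      `|partial1of2 (fun c w => cauchy_cdf l (c + W w)) c' w| <= cst ((pi * l)^-1) w.
    by move=> _ _; rewrite d1E ger0_norm ?cauchy_ge0// cauchy_le.
  have D1 := @derivable_under_integral R _ T P (fun c w => cauchy_cdf l (c + W w)) setT
    measurableT c (c - 1) (c + 1) cI (fun c' _ => iPhi c') (fun c' w _ _ => dd c' w) _ G0 iG Gub.
  have D2 := @differentiation_under_integral R _ T P (fun c w => cauchy_cdf l (c + W w)) setT
    measurableT c (c - 1) (c + 1) cI (fun c' _ => iPhi c') (fun c' w _ _ => dd c' w) _ G0 iG Gub.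
  apply: DeriveDef; first exact: D1.
  rewrite -derive1E D2; apply: eq_Rintegral => w _; exact: d1E.
have ee : - e < e by rewrite gtrN.
have cPhi : {within `[- e, e], continuous Phi}.
  by apply: continuous_subspaceT; exact: continuous_is_derive dPhi.
have [c cin hP] := MVT ee (fun c _ => dPhi c) cPhi.
have -> : Rintegral P setT (fun w => cauchy_window e l (W w)) = 2 * e * phi c.
  rewrite (_ : 2 * e * phi c = phi c * (e - - e)); last by ring.
  rewrite -hP -RintegralB//; apply: eq_Rintegral => w _.
  by rewrite /cauchy_window (addrC e) (addrC (- e)).
have ce : `|c| <= e by move: cin; rewrite in_itv/= ler_norml => /andP[? ?]; rewrite !ltW.
have e20 : 0 <= 2 * e by rewrite mulr_ge0// ltW.
rewrite mulrCA -mulrBr normrM (ger0_norm e20) ler_wpM2l//; exact: hc.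
Qed.

End window_mean.

(** * Local limit theorem, uniform over shrinking windows *)

Section local_limit.
Context {R : realType} {d : measure_display} {T : measurableType d}.
Variable P : probability T R.
Variables (X : nat -> T -> R) (A : nat -> R) (eta0 C s m : R).
Hypothesis mX : forall i, measurable_fun setT (X i).
Hypothesis iX : mutually_independent P X.
Hypothesis idX : identically_distributed P X.
Local Notation re := (charfun_re P).
Local Notation im := (charfun_im P).
Local Notation q := (charfun_sq P (X 0%N)).
Notation mu := (@lebesgue_measure R).
Hypothesis A_gt0 : forall n, (0 < n)%N -> 0 < A n.
Hypothesis eta00 : 0 < eta0.
Hypothesis C0 : 0 < C.
Hypothesis s0 : 0 < s.
Hypothesis re_cvg : forall u : R, 0 <= u ->
  re (walk X n) (u / A n) @[n --> \oo] --> expR (- (s * u)) * cos (m * u).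
Hypothesis dom : \forall n \near \oo, forall u : R, 0 <= u -> u <= eta0 * A n ->
  Num.sqrt (q (u / A n) ^+ n) <= C / (1 + u ^+ 2).
Hypothesis A_inf : forall K : R, \forall n \near \oo, K < A n.
Hypothesis gap : forall eta : R, 0 < eta ->
  exists r : R, [/\ 0 <= r, r < 1 & forall t, eta <= t -> q t <= r].

Variable V : T -> R.
Hypothesis mV : measurable_fun setT V.
Hypothesis iV : indep_of_process P V (walk X).

Lemma indep_of_process_shift z : indep_of_process P (fun w => z + V w) (walk X).
Proof.
move=> B r B' mB mB'; apply: (iV (A := (fun v => z + v) @^-1` B)) => //.
by apply: measurable_preimage => //; exact: measurable_funD.
Qed.

Let F := cauchy_pdf s m.

Lemma sqrtr_expn (r : R) n : 0 <= r -> Num.sqrt (r ^+ n) = Num.sqrt r ^+ n.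
Proof.
move=> r0; rewrite -[LHS]ger0_norm ?sqrtr_ge0//.
by rewrite -[in LHS](sqr_sqrtr r0) -exprM mulnC exprM sqrtr_sqr normr_id ger0_norm// exprn_ge0// sqrtr_ge0.
Qed.

(** Uniformity in l and z is the point: the cut and the gap are chosen before them, and l enters
    only through l t <= t and the explicit 1 / l. The base is a square root because the gap bounds
    |phi|^2. *)
Lemma smoothed_local_limit (e : R) : 0 < e -> exists r : R, [/\ 0 <= r, r < 1 &
  \forall n \near \oo, forall l z : R, 0 < l -> l <= 1 -> `|z| <= 1 ->
  `|A n * Rintegral P setT (fun w => cauchy_pdf l (z + V w + walk X n w)) - F| <=
    e + r ^+ n * A n / l /\
  A n * Rintegral P setT (fun w => cauchy_pdf l (z + V w + walk X n w)) <=
    C + r ^+ n * A n / l].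
Proof.
move=> e0; have p0 := pi_gt0 R; have ip0 : 0 < pi^-1 :> R by rewrite invr_gt0.
(* With this value the error e1 C pi / 2 is pi e / 4. *)
pose e1 := e / C / 2.
have e10 : 0 < e1 by rewrite !divr_gt0.
have e12 : 0 < e1 / 2 by rewrite divr_gt0.
have [eta1 eta10 hV] := charfun_near0 P mV e12.
pose eta := Num.min (Num.min eta0 eta1) (e1 / 2).
have eta_gt0 : 0 < eta by rewrite !lt_min eta00 eta10.
have [r [r0 r1 hr]] := gap eta_gt0.
have eta_le0 : eta <= eta0 by rewrite !ge_min lexx.
have eta_le1 : eta <= eta1 by rewrite !ge_min lexx orbT.
have eta_le2 : eta <= e1 / 2 by rewrite !ge_min lexx orbT.
exists (Num.sqrt r); split.
- exact: sqrtr_ge0.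
- by rewrite -sqrtr1 ltr_sqrt// ltr01.
have cJ := truncated_inversion mX iX idX A_gt0 C0 s0 re_cvg dom A_inf eta_gt0 eta_le0.
have e2 : 0 < e / 2 by rewrite divr_gt0.
near=> n.
have n0 : (0 < n)%N by near: n; exists 1%N.
have An := A_gt0 n0.
have dn : forall u : R, 0 <= u -> u <= eta0 * A n ->
  Num.sqrt (q (u / A n) ^+ n) <= C / (1 + u ^+ 2) by near: n; exact: dom.
have hJ : `|pi * cauchy_pdf s m - Rintegral mu `[0%R, +oo[
  (fun u => re (walk X n) (u / A n) * (u <= eta * A n)%R%:R)| <= e / 2.
  by near: n; move/cvgrPdist_le : cJ; apply.
move=> l z l0 l1 z1.
have mzV : measurable_fun setT (fun w => z + V w) by exact: measurable_funD.
have izV := indep_of_process_shift z.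
have hn : forall t : R, 0 <= t -> t <= eta -> l * t +
    (`|re (fun w => z + V w) t - 1| + `|im (fun w => z + V w) t|) <= e1.
  move=> t t0 te; rewrite (splitr e1); apply: lerD.
    by apply: (@le_trans _ _ t); [rewrite ler_piMl|exact: (le_trans te)].
  by apply: hV => //; exact: (le_trans te).
have h1 := cauchy_mean_dist mX iX idX A_gt0 C0 mzV izV eta_le0 r0 hr n0 dn l0 (ltW e10) hn.
have h2 := cauchy_mean_le mX iX idX A_gt0 C0 mzV izV eta_le0 r0 hr n0 dn l0.
move: h1 h2; rewrite /= sqrtr_expn//; set rn := Num.sqrt r ^+ n.
set I := Rintegral P setT _.
have rn0 : 0 <= rn by rewrite exprn_ge0// sqrtr_ge0.
have x0 : 0 <= rn * A n / l by rewrite !mulr_ge0// ?invr_ge0 ltW.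
rewrite (mulrA rn) => h1 h2.
have p1 := @pi_ge2 R.
have xp : pi^-1 * (rn * A n / l) <= rn * A n / l by rewrite ler_piMl// invpi_le1.
split; last first.
  have : A n * I <= pi^-1 * (C * (pi / 2) + rn * A n / l) by rewrite ler_pdivlMl.
  have -> : pi^-1 * (C * (pi / 2) + rn * A n / l) = C / 2 + pi^-1 * (rn * A n / l).
    by move: (pi : R) p0 => p p0'; field; rewrite !gt_eqF.
  by have := C0; lra.
have h3 : `|pi * (A n * I) - pi * F| <= pi * (e / 4) + rn * A n / l + e / 2.
  pose J := Rintegral mu `[0%R, +oo[ (fun u => re (walk X n) (u / A n) * (u <= eta * A n)%R%:R).
  apply: (le_trans (ler_distD J _ _)).
  apply: lerD; last by rewrite distrC.
  apply: (le_trans h1); rewrite lerD2r; rewrite le_eqVlt; apply/orP; left; apply/eqP.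
  by rewrite /e1; move: (pi : R) => p; field; rewrite gt_eqF.
rewrite -mulrBr normrM (gtr0_norm p0) -ler_pdivlMl// in h3.
apply: (le_trans h3).
have -> : pi^-1 * (pi * (e / 4) + rn * A n / l + e / 2) =
    e / 4 + pi^-1 * (rn * A n / l) + pi^-1 * (e / 2).
  by move: (pi : R) p0 => p p0'; field; rewrite !gt_eqF.
have : pi^-1 * (e / 2) <= 2^-1 * (e / 2).
  by rewrite ler_pM2r// lef_pV2 ?posrE.
lra.
Unshelve. all: end_near. Qed.

Let W n w := V w + walk X n w.

(** The indicator is squeezed between smoothed windows of half-widths h - dl h and h + dl h. As the
    scale l = dl^3 h is proportional to h, the term r^n A_n / l times the width leaves a multiple of
    r^n A_n / dl^3, free of h. *)
Lemma local_limit (e : R) : 0 < e -> exists r K : R, [/\ 0 <= r, r < 1, 0 <= K &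
  \forall n \near \oo, forall h z : R, 0 < h -> h <= 1 / 4 -> `|z| <= 1 / 2 ->
  `|A n * pr P [set w | `|z + V w + walk X n w| < h] - 2 * h * F| <=
    e * h + K * r ^+ n * A n].
Proof.
move=> e0; have F0 : 0 <= F by exact: cauchy_ge0.
(* Total coefficient of dl h in the errors: 2 F from changing the width, 4 covering the means of the
   smoothed windows, 4 C from the kernel majorant. *)
pose c := 2 * F + 4 + 4 * C; have c0 : 0 < c by rewrite /c; have := C0; lra.
pose dl := Num.min (1 / 2) (e / c).
have dl0 : 0 < dl by rewrite lt_min !divr_gt0.
have dl2 : dl <= 1 / 2 by rewrite ge_min lexx.
have dle : dl * c <= e by rewrite -ler_pdivlMr// ge_min lexx orbT.
have [r [r0 r1 hr]] := smoothed_local_limit dl0.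
have dl3 : 0 < dl ^+ 3 by rewrite exprn_gt0.
exists r, (4 * (dl ^+ 3)^-1 + 4); split => //.
  by rewrite addr_ge0// mulr_ge0// invr_ge0 ltW.
near=> n => h z h0 h4 z2.
have n0 : (0 < n)%N by near: n; exists 1%N.
have An := A_gt0 n0.
have H : forall l z : R, 0 < l -> l <= 1 -> `|z| <= 1 ->
  `|A n * Rintegral P setT (fun w => cauchy_pdf l (z + V w + walk X n w)) - F| <=
    dl + r ^+ n * A n / l /\
  A n * Rintegral P setT (fun w => cauchy_pdf l (z + V w + walk X n w)) <=
    C + r ^+ n * A n / l by near: n; exact: hr.
set Wz := fun w => z + V w + walk X n w.
have mWz : measurable_fun setT Wz.
  by apply: measurable_funD; [exact: measurable_funD|exact: measurable_walk].
pose l := dl ^+ 3 * h.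
have l0 : 0 < l by rewrite mulr_gt0.
have l1 : l <= 1.
  have : dl ^+ 3 <= 1 by rewrite exprn_ile1//; lra.
  by move=> d31; apply: mulr_ile1 => //; [exact: ltW|exact: ltW|lra].
have h1 : h <= 1 by lra.
set rA := r ^+ n * A n in H *.
have rA0 : 0 <= rA by rewrite mulr_ge0 ?exprn_ge0// ltW.
have z1 : `|z| <= 1 by lra.
have ik k : 0 < k -> P.-integrable setT (EFin \o (fun w => cauchy_pdf k (Wz w))).
  move=> k0; apply: (@prob_integrable _ _ _ P _ (pi * k)^-1).
    by apply: measurableT_comp => //; exact: measurable_cauchy.
  by move=> w; rewrite ger0_norm ?cauchy_ge0// cauchy_le.
have mset : measurable [set w | `|Wz w| < h].
  rewrite (_ : [set w | `|Wz w| < h] = Wz @^-1` `]- h, h[%classic).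
    by apply: measurable_preimage => //; exact: measurable_itv.
  by apply/seteqP; split => w /=; rewrite in_itv/= ltr_norml.
have prE : pr P [set w | `|Wz w| < h] = Rintegral P setT (fun w => (`|Wz w| < h)%R%:R).
  by rewrite -Rintegral_indic//; apply: eq_Rintegral => w _; rewrite indicE mem_setE.
have mI : measurable_fun setT (fun w => (`|Wz w| < h)%R%:R : R).
  rewrite (_ : (fun w => _) = \1_[set w | `|Wz w| < h]); first exact: measurable_indic.
  by apply/funext => w; rewrite indicE mem_setE.
have iI : P.-integrable setT (EFin \o (fun w => (`|Wz w| < h)%R%:R : R)).
  apply: (@prob_integrable _ _ _ P _ 1) => // w.
  by case: (_ < _); rewrite ?normr1 ?normr0.
have ig a : P.-integrable setT (EFin \o (fun w => cauchy_window a l (Wz w))).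
  apply: integrable_RB => //; apply: (@prob_integrable _ _ _ P _ 1).
  - apply: measurableT_comp; first exact: measurable_cauchy_cdf.
    exact: measurable_funD.
  - by move=> w; exact: normr_cauchy_cdf_le1.
  - apply: measurableT_comp; first exact: measurable_cauchy_cdf.
    exact: measurable_funB.
  - by move=> w; exact: normr_cauchy_cdf_le1.
(* [window_mean] adds shifts b up to the half-width a <= 1/2; with |z| <= 1/2 the total shift stays
   in the unit range of the smoothed estimate. *)
have win a : 0 < a -> a <= 1 / 2 ->
    `|A n * Rintegral P setT (fun w => cauchy_window a l (Wz w)) - 2 * a * F| <=
    2 * a * (dl + rA / l).
  move=> a0 a2; apply: window_mean => // b ba.
  have zb : `|b + z| <= 1 by apply: (le_trans (ler_normD _ _)); lra.
  have [hh _] := H l (b + z) l0 l1 zb.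
  by under eq_Rintegral do rewrite /Wz !addrA.
have Kh : A n * Rintegral P setT (fun w => cauchy_pdf h (Wz w)) <= C + rA / h.
  by have [_ hh] := H h z h0 h1 z1.
set kh := Rintegral P setT (fun w => cauchy_pdf h (Wz w)) in Kh.
have kh0 : 0 <= kh by apply: Rintegral_ge0 => w _; exact: cauchy_ge0.
have dh0 : 0 < dl * h by rewrite mulr_gt0.
have dh2 : dl * h <= h / 2 by rewrite mulrC; apply: ler_wpM2l; [exact: ltW|lra].
have up : pr P [set w | `|Wz w| < h] <=
    Rintegral P setT (fun w => cauchy_window (h + dl * h) l (Wz w)) + 4 * dl ^+ 2 * h * kh.
  rewrite prE -RintegralZl ?ik// -RintegralD//; last by apply: integrable_RZl => //; exact: ik.
  apply: le_Rintegral => //.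
    by apply: integrable_RD => //; apply: integrable_RZl => //; exact: ik.
  by move=> w _; exact: indicator_le_window.
have lo : Rintegral P setT (fun w => cauchy_window (h - dl * h) l (Wz w)) <=
    pr P [set w | `|Wz w| < h] + 4 * dl * h * kh.
  rewrite prE -RintegralZl ?ik// -RintegralD//; last by apply: integrable_RZl => //; exact: ik.
  apply: le_Rintegral => //.
    by apply: integrable_RD => //; apply: integrable_RZl => //; exact: ik.
  by move=> w _; apply: window_le_indicator => //; lra.
have w1 := win (h + dl * h) ltac:(lra) ltac:(lra).
have w2 := win (h - dl * h) ltac:(lra) ltac:(lra).
set p := pr P _ in up lo *.
set g1 := Rintegral _ _ _ in up w1.
set g2 := Rintegral _ _ _ in lo w2.
have hkh : h * (A n * kh) <= C * h + rA.
  have := ler_wpM2l (ltW h0) Kh; rewrite mulrDr (mulrC h C); congr (_ <= _ + _).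
  by rewrite mulrC divfK// gt_eqF.
have hkh0 : 0 <= h * (A n * kh).
  by rewrite mulr_ge0 ?(ltW h0)// mulr_ge0// (ltW An).
have hl : h * (rA / l) = (dl ^+ 3)^-1 * rA by rewrite /l; field; rewrite !gt_eqF.
set y := (dl ^+ 3)^-1 * rA in hl.
have y0 : 0 <= y by rewrite mulr_ge0// invr_ge0 ltW.
have up' : A n * p <= A n * g1 + 4 * dl ^+ 2 * (h * (A n * kh)).
  rewrite (_ : _ + _ = A n * (g1 + 4 * dl ^+ 2 * h * kh)); last by ring.
  by rewrite ler_pM2l.
have lo' : A n * g2 <= A n * p + 4 * dl * (h * (A n * kh)).
  rewrite (_ : _ + 4 * _ * _ = A n * (p + 4 * dl * h * kh)); last by ring.
  by rewrite ler_pM2l.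
have w1' : A n * g1 <= 2 * (h + dl * h) * F + 2 * (1 + dl) * (h * dl + y).
  move: w1; rewrite ler_norml => /andP[_ w1].
  have : 2 * (h + dl * h) * (dl + rA / l) = 2 * (1 + dl) * (h * dl + h * (rA / l)) by ring.
  by rewrite hl => <-; lra.
have w2' : 2 * (h - dl * h) * F - 2 * (1 - dl) * (h * dl + y) <= A n * g2.
  move: w2; rewrite ler_norml => /andP[w2 _].
  have : 2 * (h - dl * h) * (dl + rA / l) = 2 * (1 - dl) * (h * dl + h * (rA / l)) by ring.
  by rewrite hl => <-; lra.
have hd0 : 0 <= h * dl by rewrite ltW// mulr_gt0.
have hy0 : 0 <= h * dl + y by rewrite addr_ge0.
have b1 : 2 * (1 + dl) * (h * dl + y) <= 3 * (h * dl + y).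
  by apply: ler_wpM2r => //; lra.
have b2 : 2 * (1 - dl) * (h * dl + y) <= 2 * (h * dl + y).
  by apply: ler_wpM2r => //; lra.
have b3 : 4 * dl * (h * (A n * kh)) <= 4 * dl * (C * h) + 4 * rA.
  have : 4 * dl * (h * (A n * kh)) <= 4 * dl * (C * h + rA).
    by apply: ler_wpM2l => //; rewrite mulr_ge0// ltW.
  have : dl * rA <= rA by rewrite ler_piMl//; lra.
  lra.
have b4 : 4 * dl ^+ 2 * (h * (A n * kh)) <= 4 * dl * (h * (A n * kh)).
  apply: ler_wpM2r => //; rewrite ler_pM2l// expr2 ler_piMl ?ltW//; lra.
have eh : dl * h * c <= e * h by rewrite mulrAC; apply: ler_wpM2r => //; exact: ltW.
have ceq : dl * h * c = 2 * dl * h * F + 4 * (h * dl) + 4 * dl * (C * h) by rewrite /c; ring.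
have Keq : (4 * (dl ^+ 3)^-1 + 4) * r ^+ n * A n = 4 * y + 4 * rA by rewrite /y /rA; ring.
have f1 : 2 * (h + dl * h) * F = 2 * h * F + 2 * dl * h * F by ring.
have f2 : 2 * (h - dl * h) * F = 2 * h * F - 2 * dl * h * F by ring.
rewrite f1 in w1'; rewrite f2 in w2'; rewrite Keq.
rewrite ler_norml; apply/andP; split; lra.
Unshelve. all: end_near. Qed.

End local_limit.

(** * Renewal equation for small windows *)

Section norming_sums.
Context {R : realType}.
Implicit Types (A : nat -> R) (r : R).

Lemma geometric_tail r M L : 0 <= r -> r < 1 -> (M <= L)%N ->
  \sum_(M <= k < L) r ^+ k <= r ^+ M / (1 - r).
Proof.
move=> r0 r1 ML; rewrite ler_pdivlMr ?subr_gt0//.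
have -> : (\sum_(M <= k < L) r ^+ k) * (1 - r) = r ^+ M - r ^+ L.
  rewrite -[RHS]opprB -[in RHS](telescope_sumr (fun k => r ^+ k) ML) mulr_suml -sumrN.
  by apply: eq_bigr => k _; rewrite exprS; ring.
by rewrite gerBl exprn_ge0.
Qed.

Lemma GnatS A n : Gnat A n.+1 = Gnat A n + (A n.+1)^-1.
Proof. by rewrite /Gnat big_nat_recr. Qed.

Lemma Gnat0 A : Gnat A 0 = 0.
Proof. by rewrite /Gnat big_geq. Qed.

Lemma Gfun_nat A n : Gfun A n%:R = Gnat A n.
Proof. by rewrite /Gfun ltNge ler0n/= natrK subrr mul0r addr0. Qed.

Lemma Gnat_cat A M N : (M <= N)%N ->
  Gnat A N = Gnat A M + \sum_(M.+1 <= k < N.+1) (A k)^-1.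
Proof. by move=> MN; rewrite /Gnat (@big_cat_nat _ _ _ M.+1). Qed.

Lemma Gnat_double A n : Gnat A (n + n) =
  \sum_(1 <= k < n.+1) ((A (k + k)%N)^-1 + (A (k + k).-1)^-1).
Proof.
elim: n => [|n IH]; first by rewrite Gnat0 big_geq.
rewrite big_nat_recr//= -IH addSn addnS !GnatS; rewrite -addrA; congr (_ + _).
by rewrite addrC.
Qed.

Section positive.
Variable A : nat -> R.
Hypothesis A_gt0 : forall n, (0 < n)%N -> 0 < A n.

Lemma le_Gnat m n : (m <= n)%N -> Gnat A m <= Gnat A n.
Proof.
move=> mn; rewrite (Gnat_cat _ mn) lerDl big_nat; apply: sumr_ge0 => k /andP[mk _].
by rewrite invr_ge0 ltW// A_gt0// (leq_trans _ mk).
Qed.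

Lemma Gnat_ge0 n : 0 <= Gnat A n.
Proof. by rewrite -(Gnat0 A) le_Gnat. Qed.

(** The terms of index 2k and 2k - 1 are each about 1 / (2 A_k), so a pair replaces one term 1 /
    A_k; the divergence of G absorbs the finitely many pairs for which this is not yet accurate. *)
Lemma Gnat_doubling (dl : R) :
  A (n + n)%N / A n @[n --> \oo] --> (2 : R) ->
  A (n + n).-1 / A n @[n --> \oo] --> (2 : R) ->
  (forall B : R, \forall n \near \oo, B < Gnat A n) ->
  0 < dl -> \forall n \near \oo, Gnat A (n + n) <= (1 + dl) * Gnat A n.
Proof.
move=> c1 c2 Ginf dl0.
have half (g : nat -> R) : (g n @[n --> \oo] --> (2 : R)) ->
    (g n)^-1 @[n --> \oo] --> (2^-1 : R).
  by move=> h; apply: cvgV.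
have c : (A (n + n)%N / A n)^-1 + (A (n + n).-1 / A n)^-1 @[n --> \oo] --> (2^-1 + 2^-1 : R).
  by apply: cvgD; exact: half.
have dl2 : 0 < dl / 2 by rewrite divr_gt0.
move/cvgrPdist_le: c => /(_ _ dl2)[M _ hM].
have hk k : (M < k)%N -> (A (k + k)%N)^-1 + (A (k + k).-1)^-1 <= (1 + dl / 2) * (A k)^-1.
  move=> Mk; have k0 : (0 < k)%N by exact: leq_ltn_trans Mk.
  have /= := hM k (ltnW Mk); rewrite !invf_div distrC => /(le_trans (ler_norm _)) h.
  by rewrite ler_pdivlMr ?A_gt0// mulrDl mulrC (mulrC _ (A k)); lra.
near=> n.
have Mn : (M <= n)%N by near: n; exists M.
have GB : 2 / dl * Gnat A (M + M) < Gnat A n by near: n; exact: Ginf.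
have -> : Gnat A (n + n) = Gnat A (M + M) +
    \sum_(M.+1 <= k < n.+1) ((A (k + k)%N)^-1 + (A (k + k).-1)^-1).
  by rewrite !Gnat_double (@big_cat_nat _ _ _ M.+1).
apply: (@le_trans _ _ (dl / 2 * Gnat A n + (1 + dl / 2) * Gnat A n)); last by rewrite -mulrDl; apply: ler_wpM2r; [exact: Gnat_ge0|lra].
apply: lerD.
  by rewrite -ler_pdivrMl// invf_div; exact: ltW.
apply: (@le_trans _ _ ((1 + dl / 2) * \sum_(M.+1 <= k < n.+1) (A k)^-1)).
  by rewrite mulr_sumr !big_nat; apply: ler_sum => k /andP[Mk _]; exact: hk.
apply: ler_wpM2l; first by lra.
by rewrite (Gnat_cat _ Mn) lerDr Gnat_ge0.
Unshelve. all: end_near. Qed.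

(* the terms of bounded index converge one by one, and the tail is comparable
   with the norming sum, uniformly in the window size *)
Lemma window_sum_cvg (u : R -> nat -> R) (p : nat -> R) (S F g : R) (N : R -> nat) :
  0 <= F ->
  (forall k, u e k @[e --> 0^'+] --> p k) ->
  \sum_(1 <= k < n.+1) p k @[n --> \oo] --> S ->
  (forall e : R, 0 < e -> exists r K : R, [/\ 0 <= r, r < 1, 0 <= K &
    \forall n \near \oo, forall h : R, 0 < h -> h <= 1 / 4 ->
      `|u h n - 2 * h * F / A n| <= e * h / A n + K * r ^+ n]) ->
  (forall M, \forall h \near 0^'+, (M <= N h)%N) ->
  h * Gnat A (N h) @[h --> 0^'+] --> g ->
  \sum_(1 <= k < (N h).+1) u h k @[h --> 0^'+] --> S + 2 * F * g.
Proof.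
move=> F0 up pS hu Ninf Ng; apply/cvgrPdist_le => e e0.
have g1 : 0 < `|g| + 1 by rewrite ltr_wpDl.
(* Sum of the coefficients of [e1] in the final estimate. *)
pose c : R := 4 * F + `|g| + 5; have c0 : 0 < c by rewrite /c; lra.
pose e1 := Num.min 1 (e / c).
have e10 : 0 < e1 by rewrite lt_min ltr01 divr_gt0.
have e11 : e1 <= 1 by rewrite ge_min lexx.
have e1c : e1 * c <= e by rewrite -ler_pdivlMr// ge_min lexx orbT.
have [r [K [r0 r1 K0 [n0 _ hn0]]]] := hu e1 e10.
have r1' : 0 < 1 - r by rewrite subr_gt0.
have e1K : 0 < e1 * (1 - r) / (K + 1).
  by rewrite divr_gt0// ?mulr_gt0// ltr_wpDl.
(* The cut M is fixed before h: beyond it the geometric errors add up to at most [e1], and the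
   partial sum of [p] up to it is within [e1] of [S]. The terms up to M converge as h tends to 0. *)
have : \forall M \near \oo, (n0 <= M)%N /\ (r ^+ M < e1 * (1 - r) / (K + 1) /\
    `|S - \sum_(1 <= k < M.+1) p k| <= e1).
  near=> M; split; first by near: M; exists n0.
  split; first by near: M; exact: cvg_geo_lt.
  by near: M; move/cvgrPdist_le : pS; apply.
move=> [M _ /(_ M (leqnn M))[n0M [rM pM]]].
have finite_part : \sum_(1 <= k < M.+1) u h k @[h --> 0^'+] --> \sum_(1 <= k < M.+1) p k.
  elim: M.+1 => [|L IH]; first by under eq_fun do rewrite big_geq//; rewrite big_geq//; exact: cvg_cst.
  case: L IH => [|L] IH; first by under eq_fun do rewrite big_geq//; rewrite big_geq//; exact: cvg_cst.
  under eq_fun do rewrite big_nat_recr//=.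
  by rewrite big_nat_recr//=; apply: cvgD.
near=> h.
have h0 : 0 < h by near: h; exact: nbhs_right_gt.
have h4 : h <= 1 / 4 by apply: ltW; near: h; apply: nbhs_right_lt; lra.
have MN : (M <= N h)%N by near: h; exact: Ninf.
have hg : `|g - h * Gnat A (N h)| <= e1 by near: h; move/cvgrPdist_le : Ng; apply.
have hf : `|\sum_(1 <= k < M.+1) p k - \sum_(1 <= k < M.+1) u h k| <= e1.
  by near: h; move/cvgrPdist_le : finite_part; apply.
have hGM : h * Gnat A M <= e1.
  have GM := Gnat_ge0 M.
  have h1 : h <= e1 / (Gnat A M + 1).
    by apply: ltW; near: h; apply: nbhs_right_lt; rewrite divr_gt0// ltr_wpDl// Gnat_ge0.
  apply: (@le_trans _ _ (e1 / (Gnat A M + 1) * (Gnat A M + 1))).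
    by apply: ler_pM; rewrite ?lerDl ?(ltW h0).
  by rewrite divfK// gt_eqF// ltr_wpDl.
have tail : `|\sum_(M.+1 <= k < (N h).+1) u h k - 2 * h * F * (Gnat A (N h) - Gnat A M)| <=
    e1 * h * (Gnat A (N h) - Gnat A M) + e1.
  have -> : Gnat A (N h) - Gnat A M = \sum_(M.+1 <= k < (N h).+1) (A k)^-1.
    by rewrite (Gnat_cat _ MN) addrC addKr.
  rewrite mulr_sumr -sumrB; apply: (le_trans (ler_norm_sum _ _ _)).
  apply: (@le_trans _ _ (\sum_(M.+1 <= k < (N h).+1) (e1 * h / A k + K * r ^+ k))).
    rewrite !big_nat; apply: ler_sum => k /andP[Mk _]; apply: hn0 => //=.
    exact: (leq_trans n0M (ltnW Mk)).
  rewrite big_split/= -!mulr_sumr lerD2l.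
  apply: (@le_trans _ _ (K * (r ^+ M.+1 / (1 - r)))).
    by apply: ler_wpM2l => //; apply: geometric_tail.
  have rM1 : r ^+ M.+1 <= e1 * (1 - r) / (K + 1).
    by apply: le_trans (ltW rM); rewrite exprS ler_piMl ?exprn_ge0// ltW.
  apply: (@le_trans _ _ (K * (e1 * (1 - r) / (K + 1) / (1 - r)))).
    by apply: ler_wpM2l => //; rewrite ler_pM2r// invr_gt0.
  have -> : K * (e1 * (1 - r) / (K + 1) / (1 - r)) = e1 * (K / (K + 1)).
    by field; rewrite (gt_eqF r1')/= gt_eqF// ltr_wpDl.
  by rewrite ler_piMr ?(ltW e10)// ler_pdivrMr ?ltr_wpDl// mul1r lerDl.
rewrite (@big_cat_nat _ _ _ M.+1)//=.
set s1 := \sum_(1 <= k < M.+1) u h k in hf *; set s2 := \sum_(M.+1 <= k < _) _ in tail *.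
set sp := \sum_(1 <= k < M.+1) p k in hf *; have pM1 : `|S - sp| <= e1 := pM.
set GN := Gnat A (N h) in hg tail; set GM := Gnat A M in hGM tail.
have GM0 : 0 <= h * GM by rewrite mulr_ge0 ?(ltW h0)// Gnat_ge0.
have t1 : e1 * h * (GN - GM) <= e1 * (`|g| + 1).
  rewrite -mulrA; apply: ler_wpM2l; first exact: ltW.
  have := ler_norm g; move: hg; rewrite ler_norml => /andP[]; lra.
have t2 : `|2 * F * g - 2 * h * F * (GN - GM)| <= 4 * F * e1.
  have -> : 2 * F * g - 2 * h * F * (GN - GM) = 2 * F * ((g - h * GN) + h * GM) by ring.
  rewrite normrM ger0_norm ?mulr_ge0//.
  have -> : 4 * F * e1 = 2 * F * (e1 + e1) by ring.
  apply: ler_wpM2l; first by rewrite mulr_ge0.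
  by apply: (le_trans (ler_normD _ _)); apply: lerD => //; rewrite ger0_norm.
have ce : e1 * c = e1 + e1 + 4 * F * e1 + e1 * (`|g| + 1) + e1 + e1 by rewrite /c; ring.
apply: (@le_trans _ _ (e1 * c)) => //; rewrite ce.
have -> : S + 2 * F * g - (s1 + s2) = (S - sp) + (sp - s1) +
   (2 * F * g - 2 * h * F * (GN - GM)) + (2 * h * F * (GN - GM) - s2) by ring.
apply: (le_trans (ler_normD _ _)).
rewrite (distrC _ s2).
have := ler_normD (S - sp + (sp - s1)) (2 * F * g - 2 * h * F * (GN - GM)).
have := ler_normD (S - sp) (sp - s1).
lra.
Unshelve. all: end_near. Qed.

End positive.

End norming_sums.

(** * First-visit decomposition *)

Section renewal.
Context {R : realType} {d : measure_display} {T : measurableType d}.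
Variable P : probability T R.
Variables (X : nat -> T -> R).
Hypothesis mX : forall i, measurable_fun setT (X i).
Hypothesis iX : mutually_independent P X.
Hypothesis idX : identically_distributed P X.
Variable V : T -> R.
Hypothesis mV : measurable_fun setT V.
Hypothesis iV : indep_of_process P V (walk X).
Variable D : set R.
Hypothesis mD : measurable D.

Local Notation W n w := (V w + walk X n w).

Definition hits_at n : set T := [set w | D (W n w)].

(** Earlier visits are counted from time 1 on, as for the hitting time of the theorem; a walk that
    starts in [D] may still make its first visit later. *)
Definition first_at n : set T :=
  hits_at n `&` ~` \bigcup_(k in [set k | (0 < k < n)%N]) hits_at k.

Definition hits_by n : set T := \bigcup_(k in [set k | (0 < k <= n)%N]) hits_at k.

Lemma measurable_walk_from n : measurable_fun setT (fun w => W n w).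
Proof. by apply: measurable_funD => //; exact: measurable_walk. Qed.

Lemma measurable_hits_at n : measurable (hits_at n).
Proof. by apply: (measurable_preimage (f := fun w => W n w)) => //; exact: measurable_walk_from. Qed.

Lemma measurable_hits_by n : measurable (hits_by n).
Proof. by apply: bigcup_measurable => k _; exact: measurable_hits_at. Qed.

Lemma first_at_past n : <<s past V X n >> (first_at n).
Proof.
have mh k : (k <= n)%N -> <<s past V X n >> (hits_at k).
  move=> kn; have := past_walk mX mV kn => /(_ measurableT D mD).
  by rewrite setTI.
rewrite /first_at.
apply: (@measurableI _ (g_sigma_algebraType (past V X n))); first exact: mh.
apply: (@measurableC _ (g_sigma_algebraType (past V X n))).
by apply: bigcup_measurable => k /= /andP[_ kn]; apply: mh; exact: ltnW.
Qed.

Lemma measurable_first_at n : measurable (first_at n).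
Proof. by apply: (past_measurable mX mV); exact: first_at_past. Qed.

(** Markov property with bounds in place of conditional probabilities: bounds valid from every
    position reached on the past event [E] integrate over [E]. Besides first visits it serves the
    escape argument. *)
Lemma past_hits_at n i (E : set T) (a b : R) : <<s past V X n >> E ->
  (forall w, E w -> a <= pr P [set w' | D (W n w + walk X i w')] <= b) ->
  a * pr P E <= pr P (E `&` hits_at (n + i)) <= b * pr P E.
Proof.
move=> pE hab.
have pW : measurable_fun (setT : set (g_sigma_algebraType (past V X n))) (fun w => W n w).
  exact: past_walk.
have [mg e] := pr_past_block i mX mV iX iV pE pW mD.
have -> : hits_at (n + i) = [set w | D (W n w + block X n i w)].
  by apply/seteqP; split => w; rewrite /hits_at/= walk_block addrA.
have gE w : pr P [set w' | D (W n w + block X n i w')] = pr P [set w' | D (W n w + walk X i w')].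
  have h := @block_law _ _ _ P X n i ((fun v => W n w + v) @^-1` D) mX iX idX.
  by apply: h; apply: measurable_preimage => //; exact: measurable_funD.
have mE : measurable E by apply: (past_measurable mX mV); exact: pE.
have ig : P.-integrable setT (EFin \o (fun w => \1_E w * pr P [set w' | D (W n w + block X n i w')])).
  apply: (@prob_integrable _ _ _ P _ 1) => // w.
  rewrite normrM mulr_ile1 ?normr_indic_le1// ger0_norm ?pr_ge0// pr_le1//.
  apply: (measurable_preimage (f := fun w' => W n w + block X n i w')) => //.
  by apply: measurable_funD => //; exact: measurable_block.
have i1 : P.-integrable setT (EFin \o (fun w => \1_E w : R)).
  apply: (@prob_integrable _ _ _ P _ 1); first exact: measurable_indic.
  by move=> w; exact: normr_indic_le1.
have ic c : P.-integrable setT (EFin \o (fun w => c * \1_E w : R)) by exact: integrable_RZl.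
have cE c : c * pr P E = Rintegral P setT (fun w => c * \1_E w).
  by rewrite RintegralZl// Rintegral_indic.
have bnd w : a * \1_E w <= \1_E w * pr P [set w' | D (W n w + block X n i w')] <= b * \1_E w.
  rewrite indicE; have [/set_mem Ew|_] := boolP (w \in E).
    by rewrite !mulr1 mul1r gE; exact: hab.
  by rewrite !mulr0 mul0r lexx.
by rewrite e !cE; apply/andP; split; apply: le_Rintegral => // w _; have /andP[] := bnd w.
Qed.

Lemma hits_at_after n i (a b : R) :
  (forall y, D y -> a <= pr P [set w | D (y + walk X i w)] <= b) ->
  a * pr P (first_at n) <= pr P (first_at n `&` hits_at (n + i)) <= b * pr P (first_at n).
Proof. by move=> h; apply: past_hits_at; [exact: first_at_past|move=> w [/h]]. Qed.

Lemma trivIset_first_at : trivIset setT (fun j => first_at j.+1).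
Proof.
apply/trivIsetP => i j _ _ ij.
have disj a b : (a < b)%N -> first_at a.+1 `&` first_at b.+1 = set0.
  move=> ab; apply/seteqP; split => // w [[ha _] [_ hb]]; apply: hb.
  by exists a.+1.
have [h|h] : (i < j)%N \/ (j < i)%N by lia.
- exact: disj.
- by rewrite setIC; exact: disj.
Qed.

Lemma hits_by_first n : hits_by n = \big[setU/set0]_(0 <= j < n) first_at j.+1.
Proof.
elim: n => [|n IH].
  by rewrite big_geq//; apply/seteqP; split => // w [k /=]; lia.
rewrite big_nat_recr//= -IH; apply/seteqP; split => w.
  move=> [k /= /andP[k0 kn] hk].
  have [hn|hn] := pselect (hits_by n w); first by left.
  right; have -> : n.+1 = k.
    by move: kn; rewrite leq_eqVlt => /orP[/eqP ->//|kn]; case: hn; exists k => //=; rewrite k0.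
  split=> // -[j /= /andP[j0 jk]] hj; apply: hn; exists j => //=; lia.
move=> [[k /= /andP[k0 kn] hk]|[h _]]; first by exists k => //=; lia.
by exists n.+1 => //=.
Qed.

Lemma pr_hits_by n : pr P (hits_by n) = \sum_(0 <= j < n) pr P (first_at j.+1).
Proof.
rewrite hits_by_first (@pr_sum _ _ _ P (fun j => first_at j.+1)) ?iota_uniq//.
- by move=> j; exact: measurable_first_at.
- exact: trivIset_first_at.
Qed.

Lemma pr_first_at_sum n B : measurable B ->
  \sum_(0 <= j < n) pr P (B `&` first_at j.+1) = pr P (B `&` hits_by n).
Proof.
move=> mB; rewrite hits_by_first (@prI0_sum _ _ _ P (fun j => first_at j.+1)) ?iota_uniq//.
- by move=> j; exact: measurable_first_at.
- exact: trivIset_first_at.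
Qed.

(** Visits up to N are sorted by the time j of the first one. From then on their expected number is
    at most the sum of [b] over i <= N - j, enlarged to i <= N so that it no longer depends on j. *)
Lemma renewal_le N (b : nat -> R) : (forall i, 0 <= b i) ->
  (forall i y, D y -> pr P [set w | D (y + walk X i w)] <= b i) ->
  \sum_(1 <= k < N.+1) pr P (hits_at k) <= pr P (hits_by N) * \sum_(0 <= i < N.+1) b i.
Proof.
move=> b0 hb; have -> : \sum_(1 <= k < N.+1) pr P (hits_at k) =
    \sum_(0 <= j < N) \sum_(1 <= k < N.+1) pr P (hits_at k `&` first_at j.+1).
  rewrite exchange_big/=; rewrite [RHS]big_nat [LHS]big_nat; apply: eq_bigr => k kN.
  rewrite pr_first_at_sum; last exact: measurable_hits_at.
  congr (pr P _); rewrite setIidl// => w hw; exists k => //=; lia.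
rewrite pr_hits_by mulr_suml [leLHS]big_nat [leRHS]big_nat; apply: ler_sum => j jN.
rewrite (@big_cat_nat _ _ _ j.+1)//=; last by lia.
rewrite big_nat big1 ?add0r; last first.
  move=> k kj; rewrite (_ : _ `&` _ = set0) ?pr_set0//; apply/seteqP; split => // w [hk [_ h]].
  by apply: h; exists k => //=; lia.
rewrite -[X in \sum_(X <= _ < _) _]add0n big_addn.
apply: (@le_trans _ _ (\sum_(0 <= i < N.+1 - j.+1) pr P (first_at j.+1) * b i)).
  apply: ler_sum => i _; rewrite setIC addnC mulrC.
  have hy y : D y -> 0 <= pr P [set w | D (y + walk X i w)] <= b i.
    by move=> Dy; rewrite pr_ge0 hb.
  by have /andP[] := hits_at_after j.+1 hy.
rewrite mulr_sumr [leRHS](@big_cat_nat _ _ _ (N.+1 - j.+1))//=; last by lia.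
by rewrite lerDl; apply: sumr_ge0 => i _; rewrite mulr_ge0 ?pr_ge0.
Qed.

(** Counting visits up to 2N leaves room for a full stretch i = 0, ..., N after every first visit at
    a time j <= N. *)
Lemma renewal_ge N (a : nat -> R) :
  (forall i y, D y -> a i <= pr P [set w | D (y + walk X i w)]) ->
  pr P (hits_by N) * \sum_(0 <= i < N.+1) a i <= \sum_(1 <= k < (N + N).+1) pr P (hits_at k).
Proof.
move=> ha.
apply: (@le_trans _ _ (\sum_(0 <= j < N) \sum_(1 <= k < (N + N).+1) pr P (hits_at k `&` first_at j.+1))); last first.
  rewrite exchange_big/=; apply: ler_sum => k _.
  rewrite pr_first_at_sum; last exact: measurable_hits_at.
  apply: le_pr => //; last exact: measurable_hits_at.
  by apply: measurableI; [exact: measurable_hits_at|exact: measurable_hits_by].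
rewrite pr_hits_by mulr_suml [leLHS]big_nat [leRHS]big_nat; apply: ler_sum => j jN.
rewrite [leRHS](@big_cat_nat _ _ _ j.+1)//=; last by lia.
apply: ler_wpDl; first by apply: sumr_ge0 => i _; exact: pr_ge0.
rewrite -[X in _ <= \sum_(X <= _ < _) _]add0n big_addn.
rewrite [leRHS](@big_cat_nat _ _ _ N.+1)//=; last by lia.
apply: ler_wpDr; first by apply: sumr_ge0 => i _; exact: pr_ge0.
rewrite mulr_sumr; apply: ler_sum => i _; rewrite setIC addnC mulrC.
have hy y : D y -> a i <= pr P [set w | D (y + walk X i w)] <= 1.
  move=> Dy; rewrite ha//= pr_le1//.
  apply: (measurable_preimage (f := fun w' => y + walk X i w')) => //.
  by apply: measurable_funD => //; exact: measurable_walk.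
by have /andP[] := hits_at_after j.+1 hy.
Qed.

End renewal.

Section small_balls.
Context {R : realType} {d : measure_display} {T : measurableType d}.
Variable P : probability T R.

(** Continuity from above along h = 1 / (n + 1), then monotonicity in h. *)
Lemma small_ball_cvg (W : T -> R) : measurable_fun setT W ->
  pr P [set w | `|W w| < h] @[h --> 0^'+] --> pr P [set w | W w = 0].
Proof.
move=> mW.
have mb h : measurable [set w | `|W w| < h].
  rewrite (_ : [set w | `|W w| < h] = W @^-1` `]- h, h[%classic).
    by apply: measurable_preimage => //; exact: measurable_itv.
  by apply/seteqP; split => w /=; rewrite in_itv/= ltr_norml.
have m0 : measurable [set w | W w = 0].
  by apply: (measurable_preimage (f := W) (D := [set 0])).
have := @pr_bigcap_cvg _ _ _ P (fun n => [set w | `|W w| < n.+1%:R^-1]) (fun n => mb _).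
have -> : \bigcap_n [set w | `|W w| < n.+1%:R^-1] = [set w | W w = 0].
  apply/seteqP; split => w /=; last by move=> w0 n _ /=; rewrite w0 normr0 invr_gt0.
  move=> h; apply/eqP; rewrite -normr_eq0 eq_le normr_ge0 andbT leNgt; apply/negP => W0.
  have [n _ hn] := @cvgr0_norm_lt _ _ _ _ _ _ (@cvg_harmonic R) _ W0.
  have := h n I; rewrite /= => h1; have := hn n (leqnn n); rewrite /harmonic/= ger0_norm ?invr_ge0// => h2.
  by have := lt_trans h1 h2; rewrite ltxx.
move=> /(_ _)/cvgrPdist_le hc; apply/cvgrPdist_le => e e0.
have [|n _ hn] := hc _ e e0.
  by move=> n k nk w /= h; apply: (lt_le_trans h); rewrite lef_pV2 ?posrE// ler_nat.
have := hn n (leqnn n); rewrite /= distrC => /(le_trans (ler_norm _)) hn'.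
near=> h.
have h0 : 0 < h by near: h; exact: nbhs_right_gt.
have h1 : h <= n.+1%:R^-1 by apply: ltW; near: h; apply: nbhs_right_lt; rewrite invr_gt0.
have : pr P [set w | `|W w| < h] <= pr P [set w | `|W w| < n.+1%:R^-1].
  by apply: le_pr => // w /= h2; exact: lt_le_trans h1.
have : pr P [set w | W w = 0] <= pr P [set w | `|W w| < h].
  by apply: le_pr => // w /= ->; rewrite normr0.
rewrite ler_norml; lra.
Unshelve. all: end_near. Qed.

Lemma indep_cst (S : nat -> T -> R) z : indep_of_process P (fun=> z) S.
Proof.
move=> B s B' _ _; have [Bz|Bz] := pselect (B z).
  by rewrite (_ : _ @^-1` B = setT) ?setTI ?pr_setT ?mul1r//; apply/seteqP; split.
rewrite (_ : _ @^-1` B = set0) ?set0I ?pr_set0 ?mul0r//.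
by apply/seteqP; split.
Qed.

End small_balls.

(** * Atoms, exact visits and divergence of the norming sums *)

Section visits.
Context {R : realType} {d : measure_display} {T : measurableType d}.
Variable P : probability T R.
Variables (X : nat -> T -> R) (A : nat -> R) (eta0 C s m : R).
Hypothesis mX : forall i, measurable_fun setT (X i).
Hypothesis iX : mutually_independent P X.
Hypothesis idX : identically_distributed P X.
Local Notation q := (charfun_sq P (X 0%N)).
Hypothesis A_gt0 : forall n, (0 < n)%N -> 0 < A n.
Hypothesis eta00 : 0 < eta0.
Hypothesis C0 : 0 < C.
Hypothesis s0 : 0 < s.
Hypothesis re_cvg : forall u : R, 0 <= u ->
  charfun_re P (walk X n) (u / A n) @[n --> \oo] --> expR (- (s * u)) * cos (m * u).
Hypothesis dom : \forall n \near \oo, forall u : R, 0 <= u -> u <= eta0 * A n ->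
  Num.sqrt (q (u / A n) ^+ n) <= C / (1 + u ^+ 2).
Hypothesis A_inf : forall K : R, \forall n \near \oo, K < A n.
Hypothesis gap : forall eta : R, 0 < eta ->
  exists r : R, [/\ 0 <= r, r < 1 & forall t, eta <= t -> q t <= r].
Hypothesis recX : recurrent P (walk X).
Hypothesis A_double : A (n + n)%N / A n @[n --> \oo] --> (2 : R).
Hypothesis A_double_pred : A (n + n).-1 / A n @[n --> \oo] --> (2 : R).

Let F := cauchy_pdf s m.
Let F0 : 0 <= F. Proof. exact: cauchy_ge0. Qed.

Definition atom_at (V : T -> R) n := pr P [set w | V w + walk X n w = 0].

Definition never_from (V : T -> R) := pr P [set w | forall n, (1 <= n)%N -> V w + walk X n w != 0].

Let mW (V : T -> R) n : measurable_fun setT V -> measurable_fun setT (fun w => V w + walk X n w).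
Proof. by move=> mV; apply: measurable_funD => //; exact: measurable_walk. Qed.

(** An atom of mass a at 0 forces the mean of the Cauchy kernel of scale l to be at least a / (pi
    l). Against [cauchy_mean_le] this gives a <= sqrt(r^n) + pi C l / (2 A_n), and l is chosen so
    that the last term is e. *)
Lemma atom_exponential : exists r : R, [/\ 0 <= r, r < 1 & \forall n \near \oo,
  forall V, measurable_fun setT V -> indep_of_process P V (walk X) -> atom_at V n <= r ^+ n].
Proof.
have [r [r0 r1 hr]] := gap eta00.
exists (Num.sqrt r); split; first exact: sqrtr_ge0.
  by rewrite -sqrtr1 ltr_sqrt// ltr01.
near=> n => V mV iV; rewrite -sqrtr_expn//.
have n0 : (0 < n)%N by near: n; exists 1%N.
have An := A_gt0 n0.
have dn : forall u : R, 0 <= u -> u <= eta0 * A n ->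
  Num.sqrt (q (u / A n) ^+ n) <= C / (1 + u ^+ 2) by near: n; exact: dom.
apply/ler_addgt0Pr => e e0.
have p0 := pi_gt0 R; have Cp : 0 < C * pi by rewrite mulr_gt0.
pose l := e * A n * 2 / (C * pi); have l0 : 0 < l by rewrite !divr_gt0// !mulr_gt0.
have h := cauchy_mean_le mX iX idX A_gt0 C0 mV iV (lexx eta0) r0 hr n0 dn l0.
have mA : measurable [set w | V w + walk X n w = 0].
  by apply: (measurable_preimage (f := fun w => V w + walk X n w) (D := [set 0])) => //; exact: mW.
have : (pi * l)^-1 * atom_at V n <= Rintegral P setT (fun w => cauchy_pdf l (V w + walk X n w)).
  rewrite /atom_at -Rintegral_indic// -RintegralZl//; last first.
    by apply: (@prob_integrable _ _ _ P _ 1) => // w; exact: normr_indic_le1.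
  apply: le_Rintegral => //.
  - apply: integrable_RZl => //.
    by apply: (@prob_integrable _ _ _ P _ 1) => // w; exact: normr_indic_le1.
  - apply: (@prob_integrable _ _ _ P _ (pi * l)^-1).
      by apply: measurableT_comp; [exact: measurable_cauchy|exact: mW].
    by move=> w; rewrite ger0_norm ?cauchy_ge0// cauchy_le.
  move=> w _; rewrite indicE; have [/set_mem/= -> |_] := boolP (w \in _).
    rewrite mulr1 /cauchy_pdf; rewrite le_eqVlt; apply/orP; left; apply/eqP.
    by move: (pi : R) p0 => p p0'; field; rewrite !gt_eqF.
  by rewrite mulr0 cauchy_ge0.
move: h; set E := Rintegral _ _ _; set a := atom_at V n; set rn := Num.sqrt _ => h ha.
have : A n / l * a <= A n / l * (rn + e).
  have -> : A n / l * (rn + e) = C * (pi / 2) + rn * (A n / l).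
    rewrite /l; move: (pi : R) p0 => p p0'; field.
    by rewrite ?(gt_eqF C0) ?(gt_eqF p0') ?(gt_eqF e0) ?(gt_eqF An).
  apply: le_trans h.
  have -> : A n / l * a = pi * (A n * ((pi * l)^-1 * a)).
    by move: (pi : R) p0 => p p0'; field; rewrite (gt_eqF p0') (gt_eqF l0).
  by rewrite ler_pM2l// ler_pM2l.
by rewrite ler_pM2l// divr_gt0.
Unshelve. all: end_near. Qed.

Lemma local_limit_window (V : T -> R) (e : R) : measurable_fun setT V ->
  indep_of_process P V (walk X) -> 0 < e -> exists r K : R, [/\ 0 <= r, r < 1, 0 <= K &
  \forall n \near \oo, forall h : R, 0 < h -> h <= 1 / 4 -> forall z, `|z| <= 1 / 2 ->
  `|pr P [set w | `|z + (V w + walk X n w)| < h] - 2 * h * F / A n| <=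
    e * h / A n + K * r ^+ n].
Proof.
move=> mV iV e0.
have [r [K [r0 r1 K0 hn]]] := local_limit mX iX idX A_gt0 eta00 C0 s0 re_cvg dom A_inf gap mV iV e0.
exists r, K; split => //; near=> n => h h0 h4 z z2.
have n0 : (0 < n)%N by near: n; exists 1%N.
have An := A_gt0 n0.
have H : forall h z : R, 0 < h -> h <= 1 / 4 -> `|z| <= 1 / 2 ->
  `|A n * pr P [set w | `|z + V w + walk X n w| < h] - 2 * h * F| <=
    e * h + K * r ^+ n * A n by near: n; exact: hn.
have := H h z h0 h4 z2.
have -> : [set w | `|z + V w + walk X n w| < h] = [set w | `|z + (V w + walk X n w)| < h].
  by apply/seteqP; split => w /=; rewrite addrA.
set p := pr P _ => {}H.
have -> : e * h / A n + K * r ^+ n = (A n)^-1 * (e * h + K * r ^+ n * A n).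
  by field; rewrite gt_eqF.
rewrite ler_pdivlMl// -[X in X * _](gtr0_norm An) -normrM mulrBr.
by have -> : A n * (2 * h * F / A n) = 2 * h * F by field; rewrite gt_eqF.
Unshelve. all: end_near. Qed.

Let cst0 : T -> R := fun=> 0.
Let mcst0 : measurable_fun setT cst0. Proof. exact: measurable_cst. Qed.
Let icst0 : indep_of_process P cst0 (walk X). Proof. exact: indep_cst. Qed.

(** Borel-Cantelli: if the norming sums were bounded, the local limit theorem would make P(|S_n| <
    1/4) summable, against recurrence. A tail of sum at most 1/2 already contradicts an event of
    probability 1. *)
Lemma Gnat_infty (B : R) : \forall n \near \oo, B < Gnat A n.
Proof.
apply: contrapT => nB.
have Gle n : Gnat A n <= B.
  rewrite leNgt; apply/negP => h; apply: nB; exists n => // k /= nk.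
  exact: lt_le_trans (le_Gnat A_gt0 nk).
pose b (n : nat) := pr P [set w | `|0 + (cst0 w + walk X n w)| < 1 / 4].
have [r [K [r0 r1 K0 [n0 _ hn]]]] := local_limit_window mcst0 icst0 (@ltr01 R).
have ndG : nondecreasing_seq (Gnat A) by move=> a c ac; exact: le_Gnat.
have cG : cvgn (Gnat A).
  apply: nondecreasing_is_cvgn => //.
  by exists B => _ [n _ <-].
(* Coefficient of 1 / A_n in the bound for P(|S_n| < 1/4), from the window h = 1/4 and the error e =
   1. *)
pose c := 2 * (1 / 4) * F + 1 * (1 / 4); have c0 : 0 < c by rewrite /c; have := F0; lra.
have c4 : 0 < (4 * c)^-1 by rewrite invr_gt0 mulr_gt0.
have r1' : 0 < 1 - r by rewrite subr_gt0.
have K4 : 0 < (1 - r) / (4 * (K + 1)) by rewrite divr_gt0// mulr_gt0// ltr_wpDl.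
have : \forall M \near \oo, (n0 <= M)%N /\ (`|limn (Gnat A) - Gnat A M| <= (4 * c)^-1 /\
    r ^+ M < (1 - r) / (4 * (K + 1))).
  near=> M; split; first by near: M; exists n0.
  split; last by near: M; exact: cvg_geo_lt.
  by near: M; move/cvgrPdist_le : cG; apply.
move=> [M _ /(_ M (leqnn M))[n0M [GM rM]]].
have mb n : measurable [set w | `|0 + (cst0 w + walk X n w)| < 1 / 4].
  rewrite (_ : [set w | _] = walk X n @^-1` `]- (1 / 4), (1 / 4)[%classic).
    by apply: measurable_preimage => //; first [exact: measurable_walk|exact: measurable_itv].
  by apply/seteqP; split => w /=; rewrite /cst0 !add0r in_itv/= ltr_norml.
pose U L := \bigcup_(n in [set` index_iota M.+1 L]) [set w | `|0 + (cst0 w + walk X n w)| < 1 / 4].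
have mU L : measurable (U L) by apply: bigcup_measurable => n _; exact: mb.
have hU L : pr P (U L) <= 1 / 2.
  apply: (@le_trans _ _ (\sum_(M.+1 <= n < L) b n)).
    have -> : U L = \big[setU/set0]_(M.+1 <= n < L) [set w | `|0 + (cst0 w + walk X n w)| < 1 / 4].
      by rewrite -bigcup_seq.
    exact: pr_bigsetU_le.
  have [ML|LM] := leqP M.+1 L; last first.
    by rewrite big_geq ?divr_ge0// ltnW.
  apply: (@le_trans _ _ (\sum_(M.+1 <= n < L) (c * (A n)^-1 + K * r ^+ n))).
    rewrite !big_nat; apply: ler_sum => n /andP[Mn _].
    have /= := hn n (leq_trans n0M (ltnW Mn)) (1 / 4) _ _ 0 _.
    rewrite normr0 => /(_ _ _ _)/(le_trans (ler_norm _)) h.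
    have : b n - 2 * (1 / 4) * F / A n <= 1 * (1 / 4) / A n + K * r ^+ n by apply: h; lra.
    by rewrite /c mulrDl; lra.
  rewrite big_split/= -!mulr_sumr.
  have h1 : \sum_(M.+1 <= n < L) (A n)^-1 <= (4 * c)^-1.
    have ML1 : (M <= L.-1)%N by rewrite -ltnS (ltn_predK ML).
    have -> : \sum_(M.+1 <= n < L) (A n)^-1 = Gnat A L.-1 - Gnat A M.
      have := Gnat_cat A ML1; rewrite (ltn_predK ML) => ->.
      by rewrite [X in X - _]addrC addrK.
    have GL := nondecreasing_cvgn_le ndG cG L.-1.
    have := ler_norm (limn (Gnat A) - Gnat A M); have := GM.
    by move: (limn _) (Gnat A _) (Gnat A _) (_^-1) GL => x1 x2 x3 x4; lra.
  have h2 : \sum_(M.+1 <= n < L) r ^+ n <= (4 * (K + 1))^-1.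
    apply: (le_trans (geometric_tail r0 r1 ML)); rewrite ler_pdivrMr// mulrC.
    by apply: le_trans (ltW rM); rewrite exprS ler_piMl ?exprn_ge0// ltW.
  have h3 : c * \sum_(M.+1 <= n < L) (A n)^-1 <= 1 / 4.
    apply: (@le_trans _ _ (c * (4 * c)^-1)); first by rewrite ler_pM2l.
    by rewrite le_eqVlt; apply/orP; left; apply/eqP; field; rewrite gt_eqF.
  have h4 : K * \sum_(M.+1 <= n < L) r ^+ n <= 1 / 4.
    apply: (@le_trans _ _ (K * (4 * (K + 1))^-1)); first exact: ler_wpM2l.
    rewrite -div1r mulrA mulr1 ler_pdivrMr ?mulr_gt0// ?ltr_wpDl//; lra.
  lra.
have hcup : pr P (\bigcup_L U L) <= 1 / 2.
  have mon : {homo U : a a' / (a <= a')%N >-> a `<=` a'}.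
    move=> a a' aa' w [k /=]; rewrite mem_index_iota => /andP[ka kb] hk; exists k => //=.
    by rewrite mem_index_iota ka (leq_trans kb).
  have cv := @pr_bigcup_cvg _ _ _ P _ mU mon.
  rewrite -(cvg_lim _ cv)//; apply: limr_le; first exact: cvgP cv.
  by apply: nearW => L; exact: hU.
have := recX (divr_gt0 (@ltr01 R) (ltr0n _ 4)).
suff : pr P [set w | forall N, exists2 n, (N <= n)%N & `|walk X n w| < 1 / 4] <= 1 / 2 by lra.
apply: le_trans hcup; apply: le_pr.
- rewrite (_ : [set w | _] = \bigcap_N \bigcup_(n in [set n | (N <= n)%N])
     [set w | `|0 + (cst0 w + walk X n w)| < 1 / 4]).
    by apply: bigcap_measurable; [exists 0%N|move=> N _; apply: bigcup_measurable => n _; exact: mb].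
  apply/seteqP; split => w /=.
    by move=> h N _; have [n Nn hw] := h N; exists n => //=; rewrite /cst0 !add0r.
  by move=> h N; have [n /= Nn hw] := h N I; exists n => //; move: hw; rewrite /cst0 !add0r.
- by apply: bigcup_measurable => L _; exact: mU.
move=> w /= h; have [n Mn hw] := h M.+1; exists n.+1 => //; exists n; rewrite /= /cst0 ?add0r//.
by rewrite mem_index_iota Mn ltnSn.
Unshelve. all: end_near. Qed.

Let F_gt0 : 0 < F.
Proof. by rewrite /F /cauchy_pdf divr_gt0// mulr_gt0 ?pi_gt0// ltr_wpDr ?sqr_ge0// exprn_gt0. Qed.

Let m0 : measurable [set (0 : R)]. Proof. by []. Qed.

(** Expected number of exact visits to 0 at times k >= 1. The walk is recurrent for neighbourhoods,
    yet this is finite because atoms decay geometrically. *)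
Definition visits V := limn (fun n => \sum_(1 <= k < n.+1) atom_at V k).

Lemma visits_cvg V : measurable_fun setT V -> indep_of_process P V (walk X) ->
  \sum_(1 <= k < n.+1) atom_at V k @[n --> \oo] --> visits V.
Proof.
move=> mV iV.
have [r [r0 r1 [n0 _ hn]]] := atom_exponential.
have nd : nondecreasing_seq (fun n => \sum_(1 <= k < n.+1) atom_at V k).
  by apply/nondecreasing_seqP => n; rewrite [leRHS]big_nat_recr//= lerDl pr_ge0.
have : cvgn (fun n => \sum_(1 <= k < n.+1) atom_at V k); last by [].
apply: nondecreasing_is_cvgn => //.
exists (\sum_(1 <= k < n0.+1) atom_at V k + r ^+ n0.+1 / (1 - r)) => _ [n _ <-].
have ge0 : 0 <= r ^+ n0.+1 / (1 - r) by rewrite divr_ge0 ?exprn_ge0// subr_ge0 ltW.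
have [nn|nn] := leqP n n0; first by apply: (le_trans (nd _ _ nn)); rewrite lerDl.
rewrite (@big_cat_nat _ _ _ n0.+1)//=; last by rewrite ltnS ltnW.
rewrite lerD2l; apply: le_trans (geometric_tail r0 r1 (ltnW nn : (n0.+1 <= n.+1)%N)).
rewrite !big_nat; apply: ler_sum => k /andP[nk _].
by apply: hn => //; exact: ltnW.
Qed.

Lemma hits_by_cvg V : measurable_fun setT V ->
  pr P (hits_by X V [set 0] n) @[n --> \oo] --> 1 - never_from V.
Proof.
move=> mV.
have mh n : measurable (hits_by X V [set 0] n) by exact: measurable_hits_by.
have mon : {homo hits_by X V [set 0] : a a' / (a <= a')%N >-> a `<=` a'}.
  by move=> a a' aa' w [k /= /andP[k0 ka] hk]; exists k => //=; rewrite k0 (leq_trans ka).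
have := @pr_bigcup_cvg _ _ _ P _ mh mon; congr (_ --> _).
rewrite /never_from -pr_setC.
  congr (pr P _); apply/seteqP; split => w /=.
    by move=> [n _ [k /= /andP[k0 kn] hk]] /(_ k k0); rewrite hk eqxx.
  move=> h; apply: contrapT => nh; apply: h => n n0; apply/eqP => hw; apply: nh.
  by exists n => //; exists n => //=; rewrite n0 leqnn.
rewrite (_ : [set w | _] = ~` \bigcup_n hits_by X V [set 0] n).
  by apply: measurableC; apply: bigcup_measurable.
apply/seteqP; split => w /=.
  by move=> h [n _ [k /= /andP[k0 kn] hk]]; have := h k k0; rewrite hk eqxx.
move=> h n n0; apply/eqP => hw; apply: h.
by exists n => //; exists n => //=; rewrite n0 leqnn.
Qed.

(** For D = {0} every visit restarts the walk from the same point, so the bounds [a] and [b] of the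
    renewal inequalities coincide, and sums up to N and 2N have the same limit. The 1 added to
    [visits cst0] is the visit at time 0. *)
Lemma visits_renewal V : measurable_fun setT V -> indep_of_process P V (walk X) ->
  visits V = (1 - never_from V) * (1 + visits cst0).
Proof.
move=> mV iV.
have hv := visits_cvg mV iV.
have hc := visits_cvg mcst0 icst0.
have hb := hits_by_cvg mV.
pose b i := atom_at cst0 i.
have bE n : \sum_(0 <= i < n.+1) b i = 1 + \sum_(1 <= i < n.+1) b i.
  rewrite big_ltn//; congr (_ + _); rewrite /b /atom_at /cst0.
  rewrite (_ : [set w | _] = setT) ?pr_setT//; apply/seteqP; split => // w _ /=.
  by rewrite /walk big_ord0 addr0.
have hprod : pr P (hits_by X V [set 0] n) * (\sum_(0 <= i < n.+1) b i) @[n --> \oo] -->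
    (1 - never_from V) * (1 + visits cst0).
  apply: cvgM => //; under eq_fun do rewrite bE.
  by apply: cvgD => //; exact: cvg_cst.
have hv2 : \sum_(1 <= k < (n + n).+1) atom_at V k @[n --> \oo] --> visits V.
  have c2 : (n + n)%N @[n --> \oo] --> \oo.
    by apply/cvgnyPge => M; near=> n; rewrite (leq_trans _ (leq_addr _ _))//; near: n; exists M.
  by have := cvg_comp _ _ c2 hv; apply.
have eb i y : [set 0] y -> pr P [set w | [set 0] (y + walk X i w)] = b i by move=> /= ->.
apply/eqP; rewrite eq_le; apply/andP; split.
  apply: (ler_cvg_to hv hprod); apply: nearW => n.
  apply: (renewal_le mX iX idX mV iV m0) => [i|i y y0]; first exact: pr_ge0.
  by rewrite eb.
apply: (ler_cvg_to hprod hv2); apply: nearW => n.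
by apply: (renewal_ge mX iX idX mV iV m0) => i y y0; rewrite eb.
Unshelve. all: end_near. Qed.

Lemma never_from0_visits : never_from cst0 * (1 + visits cst0) = 1.
Proof. by have := visits_renewal mcst0 icst0; lra. Qed.

Let visits_ge0 V : measurable_fun setT V -> indep_of_process P V (walk X) -> 0 <= visits V.
Proof.
move=> mV iV; have hv := visits_cvg mV iV.
rewrite -(cvg_lim _ hv)//; apply: limr_ge; first exact: cvgP hv.
by apply: nearW => n; apply: sumr_ge0 => k _; exact: pr_ge0.
Qed.

Lemma never_from0_gt0 : 0 < never_from cst0.
Proof.
have v0 : 0 < 1 + visits cst0 by rewrite ltr_pwDl// visits_ge0.
by rewrite -(pmulr_lgt0 _ v0) never_from0_visits.
Qed.

(** * Positive probability of never hitting the point *)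

Let mpos (sg : R) (Y : T -> R) : measurable_fun setT Y -> measurable [set w | 0 < sg * Y w].
Proof.
move=> mY; rewrite (_ : [set w | _] = (fun w => sg * Y w) @^-1` `]0, +oo[%classic).
  by apply: measurable_preimage; [exact: measurable_funM|exact: measurable_itv].
by apply/seteqP; split => w /=; rewrite in_itv/= andbT.
Qed.

Lemma pr_step_ge (sg c : R) i : pr P [set w | c <= sg * X i w] = pr P [set w | c <= sg * X 0 w].
Proof.
apply: (idX i (B := [set v : R | c <= sg * v])).
rewrite (_ : [set v | _] = (fun v => sg * v) @^-1` `[c, +oo[%classic).
  by apply: measurable_preimage; [exact: measurable_funM|exact: measurable_itv].
by apply/seteqP; split => w /=; rewrite in_itv/= andbT.
Qed.

Lemma pr_step_gt (sg c : R) i : pr P [set w | c < sg * X i w] = pr P [set w | c < sg * X 0 w].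
Proof.
apply: (idX i (B := [set v : R | c < sg * v])).
rewrite (_ : [set v | _] = (fun v => sg * v) @^-1` `]c, +oo[%classic).
  by apply: measurable_preimage; [exact: measurable_funM|exact: measurable_itv].
by apply/seteqP; split => w /=; rewrite in_itv/= andbT.
Qed.

(** If steps almost surely never went in the direction sg, the walk would almost surely avoid the
    window of half-width 1/4 around sg / 2. The local limit theorem then gives 1 / A_n = O(r^n),
    against the divergence of the norming sums. *)
Lemma step_sign (sg : R) : `|sg| = 1 -> 0 < pr P [set w | 0 < sg * X 0 w].
Proof.
move=> sg1; rewrite lt_neqAle pr_ge0 andbT eq_sym; apply/eqP => h0.
have hS n : pr P [set w | 0 < sg * walk X n w] = 0.
  elim: n => [|n IH].
    rewrite (_ : [set w | _] = set0) ?pr_set0//; apply/seteqP; split => // w /=.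
    by rewrite /walk big_ord0 mulr0 ltxx.
  apply/eqP; rewrite eq_le pr_ge0 andbT.
  apply: (@le_trans _ _ (pr P ([set w | 0 < sg * walk X n w] `|` [set w | 0 < sg * X n w]))).
    apply: le_pr.
    - by apply: mpos; exact: measurable_walk.
    - by apply: measurableU; apply: mpos => //; exact: measurable_walk.
    move=> w /=; rewrite walkS mulrDr => h.
    by have [|] := ltP 0 (sg * walk X n w); [left|right; lra].
  rewrite -[leRHS]addr0 -[X in X + _]IH -[X in _ + X]h0 -(pr_step_gt sg 0 n).
  apply: pr_setU_le; apply: mpos => //; exact: measurable_walk.
(* With error e = F and h = 1/4, the main term F / (2 A_n) beats the error F / (4 A_n). *)
have [r [K [r0 r1 K0 [n0 _ hn]]]] := local_limit_window mcst0 icst0 F_gt0.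
have hA n : (n0 < n)%N -> (A n)^-1 <= 4 * K / F * r ^+ n.
  move=> nn; have An := A_gt0 (leq_ltn_trans (leq0n n0) nn).
  have z2 : `|- (sg / 2)| <= 1 / 2 by rewrite normrN normrM sg1 ger0_norm.
  have h4 : (0 : R) < 1 / 4 by rewrite divr_gt0.
  have := hn n (ltnW nn) (1 / 4) h4 (lexx _) (- (sg / 2)) z2.
  set p := pr P _; have -> : p = 0.
    apply/eqP; rewrite eq_le pr_ge0 andbT -(hS n); apply: le_pr.
    - rewrite (_ : [set w | _] = (fun w => - (sg / 2) + walk X n w) @^-1` `]- (1 / 4), (1 / 4)[%classic).
        apply: measurable_preimage; last exact: measurable_itv.
        by apply: measurable_funD => //; exact: measurable_walk.
      by apply/seteqP; split => w /=; rewrite /cst0 add0r in_itv/= ltr_norml.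
    - by apply: mpos; exact: measurable_walk.
    move=> w /=; rewrite /cst0 add0r => h.
    have sg2 : sg * sg = 1 by rewrite -expr2 -real_normK ?num_real// sg1 expr1n.
    have : `|sg * (- (sg / 2) + walk X n w)| < 1 / 4 by rewrite normrM sg1 [ltLHS]mul1r; exact: h.
    rewrite mulrDr mulrN mulrA sg2 ltr_norml; lra.
  have -> : 2 * (1 / 4) * F / A n = F / 2 * (A n)^-1 by field; rewrite gt_eqF.
  rewrite sub0r normrN ger0_norm; last by rewrite ltW// mulr_gt0 ?invr_gt0// divr_gt0.
  have -> : F * (1 / 4) / A n = F / 4 * (A n)^-1 by field; rewrite gt_eqF.
  have -> : 4 * K / F * r ^+ n = (F / 4)^-1 * (K * r ^+ n) by field; rewrite gt_eqF.
  by have F4 : 0 < F / 4 := divr_gt0 F_gt0 (ltr0n _ 4); move=> h; rewrite ler_pdivlMl//; lra.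
have KF : 0 <= 4 * K / F by apply: divr_ge0; [exact: mulr_ge0|exact: ltW].
have [n1 _ hn1] := Gnat_infty (Gnat A n0 + 4 * K / F * (r ^+ n0.+1 / (1 - r))).
have nn : (n0 <= maxn n0 n1)%N := leq_maxl _ _.
have := hn1 _ (leq_maxr n0 n1); rewrite /= (Gnat_cat A nn) ltrD2l ltNge => /negP; apply.
apply: (@le_trans _ _ (\sum_(n0.+1 <= k < (maxn n0 n1).+1) (4 * K / F * r ^+ k))).
  by rewrite !big_nat; apply: ler_sum => k /andP[nk _]; exact: hA.
by rewrite -mulr_sumr; apply: ler_wpM2l => //; apply: geometric_tail.
Qed.

Lemma step_away (sg : R) : `|sg| = 1 ->
  exists2 c : R, 0 < c & 0 < pr P [set w | c <= sg * X 0 w].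
Proof.
move=> sg1; apply: contrapT => h; have := step_sign sg1.
have mc c : measurable [set w | c <= sg * X 0 w].
  rewrite (_ : [set w | _] = (fun w => sg * X 0 w) @^-1` `[c, +oo[%classic).
    by apply: measurable_preimage; [exact: measurable_funM|exact: measurable_itv].
  by apply/seteqP; split => w /=; rewrite in_itv/= andbT.
have z n : pr P [set w | n.+1%:R^-1 <= sg * X 0 w] = 0.
  apply/eqP; rewrite eq_le pr_ge0 andbT leNgt; apply/negP => pn; apply: h.
  by exists n.+1%:R^-1.
have := @pr_bigcup_cvg _ _ _ P (fun n => [set w | n.+1%:R^-1 <= sg * X 0 w]) (fun n => mc _).
rewrite (_ : \bigcup_n [set w | n.+1%:R^-1 <= sg * X 0 w] = [set w | 0 < sg * X 0 w]).
  move=> /(_ _) cv; rewrite -(cvg_lim _ (cv _))//.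
    by under eq_fun do rewrite z; rewrite lim_cst// ltxx.
  move=> a b ab w /= hw; apply: le_trans hw; rewrite lef_pV2 ?posrE// ler_nat//.
apply/seteqP; split => w /=.
  by move=> [n _]; apply: lt_le_trans; rewrite invr_gt0.
move=> w0; have [n _ hn] := @cvgr0_norm_lt _ _ _ _ _ _ (@cvg_harmonic R) _ w0.
exists n => //; have := hn n (leqnn n); rewrite /harmonic/= ger0_norm ?invr_ge0//; exact: ltW.
Qed.

(** Only finitely many times i are involved; later ones are left to the geometric decay of atoms. *)
Lemma escape_far (c : R) M : 0 < c ->
  \sum_(1 <= i < M.+1) pr P [set w | n%:R * c <= `|walk X i w|] @[n --> \oo] --> (0 : R).
Proof.
move=> c0.
have one i : pr P [set w | n%:R * c <= `|walk X i w|] @[n --> \oo] --> (0 : R).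
  have mb n : measurable [set w | n%:R * c <= `|walk X i w|].
    rewrite (_ : [set w | _] = (fun w => `|walk X i w|) @^-1` `[n%:R * c, +oo[%classic).
      apply: measurable_preimage; last exact: measurable_itv.
      by apply: measurableT_comp => //; exact: measurable_walk.
    by apply/seteqP; split => w /=; rewrite in_itv/= andbT.
  have mon : {homo (fun n : nat => [set w | n%:R * c <= `|walk X i w|]) :
      a b / (a <= b)%N >-> b `<=` a}.
    by move=> a b ab w /=; apply: le_trans; rewrite ler_pM2r// ler_nat.
  have := @pr_bigcap_cvg _ _ _ P _ mb mon.
  rewrite (_ : \bigcap_n _ = set0) ?pr_set0//; apply/seteqP; split => // w h.
  have := h (Num.truncn (`|walk X i w| / c)).+1 I; rewrite /= leNgt => /negP; apply.
  by rewrite -ltr_pdivrMr// truncnS_gt.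
elim: M => [|M IH]; first by under eq_fun do rewrite big_geq//; exact: cvg_cst.
under eq_fun do rewrite big_nat_recr//=.
by have := cvgD IH (one M.+1); rewrite addr0; apply.
Qed.

(* once every step so far went away from 0 by at least c, the walk is so far
   from 0 that it hits 0 later with probability at most 1/2 *)
Lemma never_from_escape (V : T -> R) (sg : R) : measurable_fun setT V ->
  indep_of_process P V (walk X) -> `|sg| = 1 -> 0 < pr P [set w | 0 < sg * V w] ->
  0 < never_from V.
Proof.
move=> mV iV sg1 V0.
have [c c0 pc] := step_away sg1.
have [r [r0 r1 [n0 _ hn]]] := atom_exponential.
have r1' : 0 < 1 - r by rewrite subr_gt0.
have r4 : 0 < (1 - r) / 4 by rewrite divr_gt0.
(* Beyond M the geometric bounds on exact hits add up to at most 1/4. *)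
have : \forall M \near \oo, (n0 <= M)%N /\ r ^+ M < (1 - r) / 4.
  near=> M; split; first by near: M; exists n0.
  by near: M; exact: cvg_geo_lt.
move=> [M _ /(_ M (leqnn M))[n0M rM]].
have e4 : (0 : R) < 1 / 4 by rewrite divr_gt0.
(* After n steps of size at least c the distance to 0 exceeds n c; for this n, covering that
   distance within M further steps has probability at most 1/4. *)
have /cvgr0_norm_lt/(_ _ e4)[n _ /(_ n (leqnn n))] := escape_far M c0.
rewrite ger0_norm => [far|]; last by apply: sumr_ge0 => i _; exact: pr_ge0.
(* Index 0 constrains the start and index i+1 the step [X i], following [prepend]. *)
pose B (i : nat) : set R := if i is _.+1 then [set v | c <= sg * v] else [set v | 0 < sg * v].
have mB i : measurable (B i).
  case: i => [|i]; rewrite /B.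
    rewrite (_ : [set v | _] = (fun v => sg * v) @^-1` `]0, +oo[%classic).
      by apply: measurable_preimage; [exact: measurable_funM|exact: measurable_itv].
    by apply/seteqP; split => w /=; rewrite in_itv/= andbT.
  rewrite (_ : [set v | _] = (fun v => sg * v) @^-1` `[c, +oo[%classic).
    by apply: measurable_preimage; [exact: measurable_funM|exact: measurable_itv].
  by apply/seteqP; split => w /=; rewrite in_itv/= andbT.
pose E := \big[setI/setT]_(i <- iota 0 n.+1) (prepend V X i @^-1` B i).
have pE : <<s past V X n >> E by apply: sub_sigma_algebra; exists B.
have mE : measurable E by apply: (past_measurable mX mV); exact: pE.
have EP w : E w -> 0 < sg * V w /\ forall i, (i < n)%N -> c <= sg * X i w.
  rewrite /E -bigcap_seq => h; split.
    by apply: (h 0%N); rewrite /mkset mem_iota.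
  by move=> i ni; apply: (h i.+1); rewrite /mkset mem_iota.
have E0 : 0 < pr P E.
  rewrite (prepend_independent mX mV iX iV (iota_uniq _ _) mB).
  apply: prodr_gt0 => -[|i] _ //=.
  by have := pr_step_ge sg c i; rewrite /preimage/= => ->.
have Ew w k : E w -> (k <= n)%N -> k%:R * c < sg * (V w + walk X k w).
  move=> /EP[hV hX]; elim: k => [|k IH] kn.
    by rewrite mul0r /walk big_ord0 addr0.
  have := IH (ltnW kn); have := hX k kn.
  by rewrite walkS -natr1 mulrDl mul1r !mulrDr; lra.
pose b i := pr P (E `&` hits_at X V [set 0] (n + i)).
have absE w k : E w -> (k <= n)%N -> k%:R * c < `|V w + walk X k w|.
  move=> ew kn; apply: (lt_le_trans (Ew _ _ ew kn)); apply: (le_trans (ler_norm _)).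
  by rewrite normrM sg1 mul1r.
have hM i : (i <= M)%N -> b i <= pr P [set w | n%:R * c <= `|walk X i w|] * pr P E.
  move=> iM; have h w : E w -> 0 <= pr P [set w' | [set (0 : R)] (V w + walk X n w + walk X i w')]
      <= pr P [set w | n%:R * c <= `|walk X i w|].
    move=> ew; rewrite pr_ge0/=; apply: le_pr.
    - apply: (measurable_preimage (f := fun w' => V w + walk X n w + walk X i w') (D := [set 0])) => //.
      by apply: measurable_funD => //; exact: measurable_walk.
    - rewrite (_ : [set w | _] = (fun w => `|walk X i w|) @^-1` `[n%:R * c, +oo[%classic).
        apply: measurable_preimage; last exact: measurable_itv.
        by apply: measurableT_comp => //; exact: measurable_walk.
      by apply/seteqP; split => w' /=; rewrite in_itv/= andbT.
    move=> w' /= hw; have := absE w n ew (leqnn n).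
    have -> : V w + walk X n w = - walk X i w' by lra.
    by rewrite normrN; exact: ltW.
  by have /andP[] := past_hits_at mX iX idX mV iV (measurable_set1 0) pE h.
(* The position at time n is frozen and taken as a deterministic start, which the uniformity of
   [atom_exponential] in the start allows. *)
have hr i : (M < i)%N -> b i <= r ^+ i * pr P E.
  move=> Mi; have h w : E w -> 0 <= pr P [set w' | [set (0 : R)] (V w + walk X n w + walk X i w')] <= r ^+ i.
    move=> ew; rewrite pr_ge0/=.
    apply: (hn i (leq_trans n0M (ltnW Mi)) (fun=> V w + walk X n w)); first exact: measurable_cst.
    exact: indep_cst.
  by have /andP[] := past_hits_at mX iX idX mV iV (measurable_set1 0) pE h.
have sumb L : \sum_(1 <= i < L.+1) b i <= 1 / 2 * pr P E.
  have b0 i : 0 <= b i by exact: pr_ge0.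
  apply: (@le_trans _ _ (\sum_(1 <= i < (maxn L M).+1) b i)).
    have LM : (L <= maxn L M)%N by exact: leq_maxl.
    rewrite [leRHS](@big_cat_nat _ _ _ L.+1)//= lerDl.
    by apply: sumr_ge0.
  have ML : (M <= maxn L M)%N by exact: leq_maxr.
  rewrite (@big_cat_nat _ _ _ M.+1)//=.
  have -> : 1 / 2 * pr P E = 1 / 4 * pr P E + 1 / 4 * pr P E by field.
  apply: lerD.
    apply: (@le_trans _ _ ((\sum_(1 <= i < M.+1) pr P [set w | n%:R * c <= `|walk X i w|]) * pr P E)).
      by rewrite mulr_suml !big_nat; apply: ler_sum => i /andP[_ iM]; exact: hM.
    by rewrite ler_pM2r// ltW.
  apply: (@le_trans _ _ ((\sum_(M.+1 <= i < (maxn L M).+1) r ^+ i) * pr P E)).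
    by rewrite mulr_suml !big_nat; apply: ler_sum => i /andP[Mi _]; exact: hr.
  rewrite ler_pM2r//; apply: (le_trans (geometric_tail r0 r1 _)) => //.
  rewrite ler_pdivrMr// div1r mulrC -/(_ / _); apply: le_trans (ltW rM).
  by rewrite exprS ler_piMl ?exprn_ge0// ltW.
have mh k : measurable (hits_at X V [set 0] k) by exact: measurable_hits_at.
pose N L := E `&` ~` \big[setU/set0]_(i <- index_iota 1 L.+1) hits_at X V [set 0] (n + i).
have mU L : measurable (\big[setU/set0]_(i <- index_iota 1 L.+1) hits_at X V [set 0] (n + i)).
  by apply: bigsetU_measurable.
have mN L : measurable (N L) by apply: measurableI => //; exact: measurableC.
have NL L : 1 / 2 * pr P E <= pr P (N L).
  rewrite /N pr_setIC//.
  have -> : E `&` \big[setU/set0]_(i <- index_iota 1 L.+1) hits_at X V [set 0] (n + i) =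
      \big[setU/set0]_(i <- index_iota 1 L.+1) (E `&` hits_at X V [set 0] (n + i)).
    by rewrite -!bigcup_seq setI_bigcupr.
  have := @pr_bigsetU_le _ _ _ P (fun i => E `&` hits_at X V [set 0] (n + i)) (index_iota 1 L.+1)
    (fun i => measurableI _ _ mE (mh _)).
  have := sumb L; rewrite /b; lra.
have mon : {homo N : a b / (a <= b)%N >-> b `<=` a}.
  move=> a a' aa' w [ew h]; split => //; move: h; rewrite -!bigcup_seq => h [k /= ka hk]; apply: h.
  exists k => //=; move: ka; rewrite !mem_index_iota => /andP[-> ka] /=.
  by rewrite (leq_trans ka).
have cv := @pr_bigcap_cvg _ _ _ P _ mN mon.
apply: (@lt_le_trans _ _ (1 / 2 * pr P E)); first by rewrite mulr_gt0// divr_gt0.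
apply: (@le_trans _ _ (pr P (\bigcap_L N L))).
  rewrite -(cvg_lim _ cv)//; apply: limr_ge; first exact: cvgP cv.
  by apply: nearW => L; exact: NL.
apply: le_pr.
- by apply: bigcap_measurable => //; exists 0%N.
- rewrite (_ : [set w | _] = \bigcap_(k in [set k | (1 <= k)%N]) ~` hits_at X V [set 0] k).
    by apply: bigcap_measurable; [exists 1%N|move=> k _; exact: measurableC].
  apply/seteqP; split => w /= h k k1; first by apply/eqP; exact: h.
  by have := h k k1; move/eqP.
move=> w /= h k k1; have [ew _] := h 0%N I.
have [kn|nk] := leqP k n.
  apply/eqP => h0; have := absE w k ew kn; rewrite h0 normr0 ltNge => /negP; apply.
  by rewrite mulr_ge0// ltW.
apply/eqP => h0; have [_] := h (k - n)%N I; rewrite -bigcup_seq; apply.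
exists (k - n)%N; first by rewrite /= mem_index_iota ltnSn subn_gt0 nk.
by rewrite /hits_at/= subnKC// ltnW.
Unshelve. all: end_near. Qed.

(** If the start has mass on one side of 0, the walk can escape on that side; otherwise the start is
    almost surely 0, where the finite expected number of visits gives the positivity. *)
Lemma never_from_gt0 (V : T -> R) : measurable_fun setT V ->
  indep_of_process P V (walk X) -> 0 < never_from V.
Proof.
move=> mV iV.
have [hp|hp] := ltP 0 (pr P [set w | 0 < 1 * V w]).
  by apply: (never_from_escape mV iV _ hp); rewrite normr1.
have [hm|hm] := ltP 0 (pr P [set w | 0 < -1 * V w]).
  by apply: (never_from_escape mV iV _ hm); rewrite normrN1.
have q0 := never_from0_gt0.
apply: (lt_le_trans q0).
have mne (U : T -> R) : measurable_fun setT U ->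
    measurable [set w | forall n, (1 <= n)%N -> U w + walk X n w != 0].
  move=> mU; rewrite (_ : [set w | _] = \bigcap_(k in [set k | (1 <= k)%N]) ~` hits_at X U [set 0] k).
    apply: bigcap_measurable; [by exists 1%N|move=> k _; apply: measurableC].
    exact: measurable_hits_at.
  apply/seteqP; split => w /= h k k1; first by apply/eqP; exact: h.
  by have := h k k1; move/eqP.
have mp (sg : R) : measurable [set w | 0 < sg * V w].
  rewrite (_ : [set w | _] = (fun w => sg * V w) @^-1` `]0, +oo[%classic).
    by apply: measurable_preimage; [exact: measurable_funM|exact: measurable_itv].
  by apply/seteqP; split => w /=; rewrite in_itv/= andbT.
rewrite /never_from.
apply: (@le_trans _ _ (pr P ([set w | forall n, (1 <= n)%N -> V w + walk X n w != 0] `|`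
   ([set w | 0 < 1 * V w] `|` [set w | 0 < -1 * V w])))).
  apply: le_pr.
  - by apply: (mne (fun=> 0)); exact: measurable_cst.
  - by apply: measurableU; [exact: mne|exact: measurableU].
  move=> w /= h; rewrite mul1r mulN1r oppr_gt0.
  have [V1|V1|V1] := ltgtP (V w) 0; [by right; right|by right; left|left].
  by move=> n n1; rewrite V1; exact: h.
apply: (le_trans (pr_setU_le P (mne _ mV) (measurableU _ _ (mp 1) (mp (-1))))).
by have := pr_setU_le P (mp 1) (mp (-1)); lra.
Qed.



(** * Window probabilities, uniformly in the starting point *)

Definition near_pr (e : R) k (y : R) := pr P [set w | `|y + walk X k w| < e].
Definition near_values e k := [set near_pr e k y | y in [set y : R | `|y| < e]].
(** Supremum and infimum over starting points in the window provide the bounds [b] and [a] that the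
    renewal inequalities require. *)
Definition near_sup e k := sup (near_values e k).
Definition near_inf e k := inf (near_values e k).

Lemma measurable_near (W : T -> R) (e : R) : measurable_fun setT W ->
  measurable [set w | `|W w| < e].
Proof.
move=> mWw; rewrite (_ : [set w | _] = W @^-1` `]- e, e[%classic).
  by apply: measurable_preimage => //; exact: measurable_itv.
by apply/seteqP; split => w /=; rewrite in_itv/= ltr_norml.
Qed.

Let m_near y k e : measurable [set w | `|y + walk X k w| < e].
Proof. by apply: measurable_near; apply: measurable_funD => //; exact: measurable_walk. Qed.

Let near_ge0 e k y : 0 <= near_pr e k y.
Proof. exact: pr_ge0. Qed.

Let near_le1 e k y : near_pr e k y <= 1.
Proof. exact: pr_le1. Qed.

Lemma near_inf_le e k y : `|y| < e -> near_inf e k <= near_pr e k y.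
Proof.
move=> ye; apply: inf_lbound; last by exists y.
by exists 0 => _ [z _ <-].
Qed.

Lemma near_sup_ge e k y : `|y| < e -> near_pr e k y <= near_sup e k.
Proof.
move=> ye; apply: sup_upper_bound; last by exists y.
by split; [exists (near_pr e k y), y|exists 1 => _ [z _ <-]].
Qed.

Lemma near_inf_ge e k (a : R) : 0 < e -> (forall y, `|y| < e -> a <= near_pr e k y) ->
  a <= near_inf e k.
Proof.
move=> e0 h; apply: lb_le_inf; last by move=> _ [y ye <-]; exact: h.
by exists (near_pr e k 0), 0 => //=; rewrite normr0.
Qed.

Lemma near_sup_le e k (a : R) : 0 < e -> (forall y, `|y| < e -> near_pr e k y <= a) ->
  near_sup e k <= a.
Proof.
move=> e0 h; apply: ge_sup; last by move=> _ [y ye <-]; exact: h.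
by exists (near_pr e k 0), 0 => //=; rewrite normr0.
Qed.

Let atomE k : atom_at cst0 k = pr P [set w | walk X k w = 0].
Proof. by congr (pr P _); apply/seteqP; split => w /=; rewrite /cst0 add0r. Qed.

Let near_atom e k y : `|y| < e -> atom_at cst0 k <= near_pr e k y.
Proof.
move=> ye; rewrite atomE; apply: le_pr => //.
  apply: (measurable_preimage (f := walk X k) (D := [set 0])) => //; exact: measurable_walk.
by move=> w /= ->; rewrite addr0.
Qed.

Let near_double e k y : `|y| < e -> near_pr e k y <= pr P [set w | `|walk X k w| < 2 * e].
Proof.
move=> ye; apply: le_pr => //; first by apply: measurable_near; exact: measurable_walk.
move=> w /= h; have -> : walk X k w = (y + walk X k w) - y by ring.
by apply: le_lt_trans (ler_normB _ _) _; lra.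
Qed.

Lemma near_inf_cvg k : near_inf e k @[e --> 0^'+] --> atom_at cst0 k.
Proof.
apply: (@squeeze_cvgr _ _ _ _ (fun=> atom_at cst0 k) (fun e => pr P [set w | `|walk X k w| < e])); last 2 first.
- exact: cvg_cst.
- by rewrite atomE; apply: small_ball_cvg; exact: measurable_walk.
near=> e; have e0 : 0 < e by near: e; exact: nbhs_right_gt.
rewrite near_inf_ge//=; last by move=> y; exact: near_atom.
have := @near_inf_le e k 0; rewrite normr0 => /(_ e0) /le_trans; apply.
by rewrite /near_pr; under eq_set do rewrite add0r.
Unshelve. all: end_near. Qed.

(** A walk started within e of 0 and found there again at time k has moved by less than 2e, so the
    supremum lies between the atom and the probability of a ball of radius 2e. *)
Lemma near_sup_cvg k : near_sup e k @[e --> 0^'+] --> atom_at cst0 k.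
Proof.
apply: (@squeeze_cvgr _ _ _ _ (fun=> atom_at cst0 k) (fun e => pr P [set w | `|walk X k w| < 2 * e])); last 2 first.
- exact: cvg_cst.
- have h : pr P [set w | `|walk X k w| < e] @[e --> 0^'+] --> atom_at cst0 k.
    by rewrite atomE; apply: small_ball_cvg; exact: measurable_walk.
  apply/cvgrPdist_le => c c0; move/cvgrPdist_le/(_ _ c0) : h => h.
  have [r /= r0 hr] := h; exists (r / 2) => /=; first by rewrite divr_gt0.
  move=> e /=; rewrite sub0r normrN => er e0; apply: hr => /=; last by rewrite mulr_gt0.
  by rewrite sub0r normrN normrM ger0_norm//; lra.
near=> e; have e0 : 0 < e by near: e; exact: nbhs_right_gt.
rewrite near_sup_le//=; last by move=> y; exact: near_double.
rewrite andbT; have := @near_sup_ge e k 0; rewrite normr0 => /(_ e0); apply: le_trans.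
by apply: near_atom; rewrite normr0.
Unshelve. all: end_near. Qed.

Let near_limit (e : R) : 0 < e -> exists r K : R, [/\ 0 <= r, r < 1, 0 <= K &
  \forall n \near \oo, (0 < n)%N /\ forall h : R, 0 < h -> h <= 1 / 4 -> forall y, `|y| < h ->
  `|near_pr h n y - 2 * h * F / A n| <= e * h / A n + K * r ^+ n].
Proof.
move=> e0; have [r [K [r0 r1 K0 hn]]] := local_limit_window mcst0 icst0 e0.
exists r, K; split => //; near=> n; split; first by near: n; exists 1%N.
move=> h h0 h4 y yh.
have H : forall h : R, 0 < h -> h <= 1 / 4 -> forall z, `|z| <= 1 / 2 ->
  `|pr P [set w | `|z + (cst0 w + walk X n w)| < h] - 2 * h * F / A n| <=
    e * h / A n + K * r ^+ n by near: n; exact: hn.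
have y2 : `|y| <= 1 / 2 by lra.
have := H h h0 h4 y y2; rewrite /near_pr; congr (`|pr P _ - _| <= _).
by apply/seteqP; split => w /=; rewrite /cst0 add0r.
Unshelve. all: end_near. Qed.

(** * Limits along the norming sums *)

Section along_norming.
Variables (N : R -> nat) (g : R).
Hypothesis Ninf : forall M, \forall h \near 0^'+, (M <= N h)%N.
Hypothesis Ng : h * Gnat A (N h) @[h --> 0^'+] --> g.

Lemma Gnat_double_cvg : h * Gnat A (N h + N h) @[h --> 0^'+] --> g.
Proof.
apply/cvgrPdist_le => e e0.
pose dl := Num.min 1 (e / (2 * (`|g| + 1))).
have g1 : 0 < `|g| + 1 by rewrite ltr_wpDl.
have dl0 : 0 < dl by rewrite lt_min ltr01 divr_gt0// mulr_gt0.
have dle : dl * (`|g| + 1) <= e / 2.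
  have : dl <= e / (2 * (`|g| + 1)) by rewrite ge_min lexx orbT.
  rewrite ler_pdivlMr ?mulr_gt0//; lra.
have [M _ hM] := Gnat_doubling A_gt0 A_double A_double_pred Gnat_infty dl0.
have e2 : 0 < e / 2 by rewrite divr_gt0.
near=> h.
have h0 : 0 < h by near: h; exact: nbhs_right_gt.
have h1 : `|g - h * Gnat A (N h)| <= e / 2 by near: h; move/cvgrPdist_le : Ng; apply.
have h2 : `|g - h * Gnat A (N h)| <= 1 by near: h; move/cvgrPdist_le : Ng; apply.
have MN : (M <= N h)%N by near: h; exact: Ninf.
have := hM _ MN; rewrite /= -(ler_pM2l h0) => u1.
have := le_Gnat A_gt0 (leq_addr (N h) (N h)); rewrite -(ler_pM2l h0) => u2.
move: u1 u2 h1 h2; rewrite mulrCA; set a := h * Gnat A (N h); set b := h * Gnat A (N h + N h).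
move=> u1 u2; rewrite !ler_norml => /andP[h1 h1'] /andP[h2 h2'].
have : dl * a <= dl * (`|g| + 1).
  by rewrite ler_pM2l//; have := ler_norm g; lra.
by move=> h3; apply/andP; split; lra.
Unshelve. all: end_near. Qed.

Lemma window_hits_cvg (V : T -> R) : measurable_fun setT V ->
  indep_of_process P V (walk X) -> 0 <= g ->
  pr P (hits_by X V [set v | `|v| < h] (N h)) @[h --> 0^'+] -->
    (visits V + 2 * F * g) / (1 + visits cst0 + 2 * F * g).
Proof.
move=> mV iV g0.
have vV := visits_cvg mV iV.
have v0 := visits_cvg mcst0 icst0.
have uV k : pr P [set w | `|V w + walk X k w| < h] @[h --> 0^'+] --> atom_at V k.
  by apply: small_ball_cvg; apply: measurable_funD => //; exact: measurable_walk.
have lV (e : R) : 0 < e -> exists r K : R, [/\ 0 <= r, r < 1, 0 <= K &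
    \forall n \near \oo, forall h : R, 0 < h -> h <= 1 / 4 ->
      `|pr P [set w | `|V w + walk X n w| < h] - 2 * h * F / A n| <= e * h / A n + K * r ^+ n].
  move=> e0; have [r [K [r0 r1 K0 hn]]] := local_limit_window mV iV e0.
  exists r, K; split => //; apply: filterS hn => n hn h h0 h4.
  have z2 : `|0 : R| <= 1 / 2 by rewrite normr0 divr_ge0.
  have := hn h h0 h4 0 z2; congr (`|pr P _ - _| <= _).
  by apply/seteqP; split => w /=; rewrite add0r.
have lS (e : R) : 0 < e -> exists r K : R, [/\ 0 <= r, r < 1, 0 <= K &
    \forall n \near \oo, forall h : R, 0 < h -> h <= 1 / 4 ->
      `|near_sup h n - 2 * h * F / A n| <= e * h / A n + K * r ^+ n].
  move=> e0; have [r [K [r0 r1 K0 hn]]] := near_limit e0.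
  exists r, K; split => //; apply: filterS hn => n [n0 hn] h h0 h4.
  rewrite ler_distl; apply/andP; split.
    have y0 : `|0 : R| < h by rewrite normr0.
    apply: le_trans (near_sup_ge n y0).
    by have := hn h h0 h4 0 y0; rewrite ler_distl => /andP[].
  apply: near_sup_le => // y yh.
  by have := hn h h0 h4 y yh; rewrite ler_distl => /andP[].
have lI (e : R) : 0 < e -> exists r K : R, [/\ 0 <= r, r < 1, 0 <= K &
    \forall n \near \oo, forall h : R, 0 < h -> h <= 1 / 4 ->
      `|near_inf h n - 2 * h * F / A n| <= e * h / A n + K * r ^+ n].
  move=> e0; have [r [K [r0 r1 K0 hn]]] := near_limit e0.
  exists r, K; split => //; apply: filterS hn => n [n0 hn] h h0 h4.
  rewrite ler_distl; apply/andP; split; last first.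
    have y0 : `|0 : R| < h by rewrite normr0.
    apply: (le_trans (near_inf_le n y0)).
    by have := hn h h0 h4 0 y0; rewrite ler_distl => /andP[].
  apply: near_inf_ge => // y yh.
  by have := hn h h0 h4 y yh; rewrite ler_distl => /andP[].
have c1 := window_sum_cvg A_gt0 F0 uV vV lV Ninf Ng.
have Ninf2 M : \forall h \near 0^'+, (M <= N h + N h)%N.
  by apply: filterS (Ninf M) => h /leq_trans; apply; exact: leq_addr.
have c2 := window_sum_cvg A_gt0 F0 uV vV lV Ninf2 Gnat_double_cvg.
have c3 := window_sum_cvg A_gt0 F0 near_sup_cvg v0 lS Ninf Ng.
have c4 := window_sum_cvg A_gt0 F0 near_inf_cvg v0 lI Ninf Ng.
have Fg : 0 <= 2 * F * g by apply: mulr_ge0 => //; exact: mulr_ge0.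
have vis0 : 0 <= visits cst0.
  rewrite -(cvg_lim _ v0)//; apply: limr_ge; first exact: cvgP v0.
  by apply: nearW => n; apply: sumr_ge0 => k _; exact: pr_ge0.
have D0 : 0 < 1 + visits cst0 + 2 * F * g by lra.
have sup_ge0 h k : 0 < h -> 0 <= near_sup h k.
  move=> h0; have y0 : `|0 : R| < h by rewrite normr0.
  exact: le_trans (near_ge0 h k 0) (near_sup_ge k y0).
have inf_ge0 h k : 0 < h -> 0 <= near_inf h k by move=> h0; apply: near_inf_ge.
have quot (a b : R -> R) : a h @[h --> 0^'+] --> visits V + 2 * F * g ->
    b h @[h --> 0^'+] --> visits cst0 + 2 * F * g ->
    a h / (1 + b h) @[h --> 0^'+] --> (visits V + 2 * F * g) / (1 + visits cst0 + 2 * F * g).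
  move=> ca cb; apply: cvgM => //; apply: cvgV; first by rewrite gt_eqF.
  by rewrite -addrA; apply: cvgD => //; exact: cvg_cst.
apply: (squeeze_cvgr _ (quot _ _ c1 c3) (quot _ _ c2 c4)).
near=> h; have h0 : 0 < h by near: h; exact: nbhs_right_gt.
have mD : measurable [set v : R | `|v| < h].
  rewrite (_ : [set v | _] = `]- h, h[%classic); first exact: measurable_itv.
  by apply/seteqP; split => w /=; rewrite in_itv/= ltr_norml.
have ss : 0 <= \sum_(1 <= k < (N h).+1) near_sup h k by apply: sumr_ge0 => k _; exact: sup_ge0.
have si : 0 <= \sum_(1 <= k < (N h).+1) near_inf h k by apply: sumr_ge0 => k _; exact: inf_ge0.
(* A walk started in the window is there at time 0, so the term of index 0 is 1 in both bounds. *)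
have split0 (u : R -> nat -> R) : \sum_(0 <= k < (N h).+1) (if k is k'.+1 then u h k'.+1 else 1)
    = 1 + \sum_(1 <= k < (N h).+1) u h k.
  by rewrite big_ltn//; congr (_ + _); apply: eq_big_nat => -[].
apply/andP; split.
  rewrite ler_pdivrMr; last by rewrite ltr_pwDl.
  rewrite -(split0 near_sup); apply: (renewal_le mX iX idX mV iV mD).
    by case=> // k; exact: sup_ge0.
  by case=> [|k] y yh; [exact: near_le1|exact: near_sup_ge].
rewrite ler_pdivlMr; last by rewrite ltr_pwDl.
rewrite -(split0 near_inf); apply: (renewal_ge mX iX idX mV iV mD).
case=> [|k] y yh; last exact: near_inf_le.
rewrite (_ : [set w | _] = setT) ?pr_setT//; apply/seteqP; split => // w _ /=.
by rewrite /walk big_ord0 addr0.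
Unshelve. all: end_near. Qed.

(** An exact hit is a hit of every window, so the joint probability of an exact hit at some time and
    a window hit by time N(h) tends to 1 - p. Subtracting it from the unconditional limit and
    dividing by p gives the conditional one. *)
Lemma window_hits_never_cvg (V : T -> R) : measurable_fun setT V ->
  indep_of_process P V (walk X) -> 0 <= g ->
  let p := never_from V in
  let q := 2 * F * g * never_from cst0 in
  cond_pr P (hits_by X V [set v | `|v| < h] (N h))
    [set w | forall n, (1 <= n)%N -> V w + walk X n w != 0] @[h --> 0^'+] --> q / (1 + q).
Proof.
move=> mV iV g0 p q.
have p0 : 0 < p := never_from_gt0 mV iV.
have hw := window_hits_cvg mV iV g0.
set E := [set w | _].
have mh0 k : measurable (hits_at X V [set 0] k) by exact: measurable_hits_at.
have mE : measurable E.
  rewrite (_ : E = \bigcap_(k in [set k | (1 <= k)%N]) ~` hits_at X V [set 0] k).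
    by apply: bigcap_measurable; [exists 1%N|move=> k _; exact: measurableC].
  apply/seteqP; split => w /= h k k1; first by apply/eqP; exact: h.
  by have := h k k1; move/eqP.
have mD h : measurable [set v : R | `|v| < h].
  rewrite (_ : [set v | _] = `]- h, h[%classic); first exact: measurable_itv.
  by apply/seteqP; split => w /=; rewrite in_itv/= ltr_norml.
have mH h : measurable (hits_by X V [set v | `|v| < h] (N h)) by exact: measurable_hits_by.
have c0 : pr P (hits_by X V [set v | `|v| < h] (N h) `&` ~` E) @[h --> 0^'+] --> 1 - p.
  have Noo : N h @[h --> 0^'+] --> \oo by apply/cvgnyPge => M; exact: Ninf.
  have := cvg_comp _ _ Noo (hits_by_cvg mV) => c0.
  have cc : (fun=> 1 - p) h @[h --> (0 : R)^'+] --> 1 - p by exact: cvg_cst.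
  apply: (@squeeze_cvgr _ _ _ _ (fun h => pr P (hits_by X V [set 0] (N h))) (fun=> 1 - p)); last 2 first.
  - exact: c0.
  - exact: cc.
  near=> h; have h0 : 0 < h by near: h; exact: nbhs_right_gt.
  apply/andP; split.
    apply: le_pr; [exact: measurable_hits_by|by apply: measurableI => //; exact: measurableC|].
    move=> w [k /= kN hk]; split; first by exists k => //; rewrite /hits_at/= hk normr0.
    by move=> /= Ew; have /andP[k1 _] := kN; have := Ew k k1; rewrite hk eqxx.
  rewrite /p /never_from -/E -pr_setC//; apply: le_pr => //.
  - by apply: measurableI => //; exact: measurableC.
  - exact: measurableC.
have c1 : pr P (hits_by X V [set v | `|v| < h] (N h) `&` E) / pr P E @[h --> 0^'+] -->
    ((visits V + 2 * F * g) / (1 + visits cst0 + 2 * F * g) - (1 - p)) / p.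
  apply: cvgM; last exact: cvg_cst.
  have -> : (fun h => pr P (hits_by X V [set v | `|v| < h] (N h) `&` E)) =
      (fun h => pr P (hits_by X V [set v | `|v| < h] (N h)) -
        pr P (hits_by X V [set v | `|v| < h] (N h) `&` ~` E)).
    by apply/funext => h; rewrite pr_setIC//; ring.
  exact: cvgB.
(* With k = [never_from cst0], the renewal identities read 1 + visits cst0 = 1 / k and visits V = (1
   - p) / k, so the quotient is (1 - p + q) / (1 + q). *)
have -> : q / (1 + q) = ((visits V + 2 * F * g) / (1 + visits cst0 + 2 * F * g) - (1 - p)) / p.
  have e1 := visits_renewal mV iV.
  have e2 := never_from0_visits.
  have q0 := never_from0_gt0.
  rewrite e1 -/p -/cst0; move: e2 q0; rewrite -/cst0 /q; set U := 1 + visits cst0.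
  set k := never_from cst0 => e2 k0.
  have -> : U = k^-1 by apply: (mulfI (lt0r_neq0 k0)); rewrite e2 mulfV// gt_eqF.
  have Fg : 0 <= 2 * F * g by apply: mulr_ge0 => //; exact: mulr_ge0.
  have Fgk : 0 < 1 + 2 * F * g * k by rewrite ltr_pwDl// mulr_ge0// ltW.
  by field; rewrite (gt_eqF p0) (gt_eqF k0) (gt_eqF Fgk).
exact: c1.
Unshelve. all: end_near. Qed.

End along_norming.

End visits.

(** * Proof of the theorem *)

Section last_index.
Context {R : realType}.
Variables (A : nat -> R) (c t : R).
Hypothesis A_gt0 : forall n, (0 < n)%N -> 0 < A n.
Hypothesis Ginf : forall B : R, \forall n \near \oo, B < Gnat A n.
Hypothesis c0 : 0 < c.
Hypothesis t0 : 0 < t.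

(** With c = gamma, monotonicity of G turns the event gamma eps G(tau) <= t into tau <= N(eps). The
    index exists because G is unbounded; for e <= 0 its value is arbitrary. *)
Lemma last_index : exists N : R -> nat, forall e, 0 < e ->
  c * e * Gnat A (N e) <= t /\ t < c * e * Gnat A (N e).+1.
Proof.
suff h e : exists n, 0 < e -> c * e * Gnat A n <= t /\ t < c * e * Gnat A n.+1.
  by have [N hN] := choice h; exists N.
have [e0|e0] := leP e 0; first by exists 0%N.
have ce : 0 < c * e by rewrite mulr_gt0.
have ex : exists n, t < c * e * Gnat A n.
  have [n _ hn] := Ginf (t / (c * e)); exists n.
  by have := hn n (leqnn n); rewrite /= ltr_pdivrMr// mulrC.
case: (ex_minnP ex) => -[|n] hn nmin; first by move: hn; rewrite Gnat0 mulr0 ltNge (ltW t0).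
exists n => _; split => //; rewrite leNgt; apply/negP => /nmin; by rewrite ltnn.
Qed.

Variable N : R -> nat.
Hypothesis hN : forall e, 0 < e -> c * e * Gnat A (N e) <= t /\ t < c * e * Gnat A (N e).+1.

Lemma last_index_le e k : 0 < e -> (c * e * Gnat A k <= t) = (k <= N e)%N.
Proof.
move=> e0; have [h1 h2] := hN e0; have ce : 0 < c * e by rewrite mulr_gt0.
have [kN|kN] := leqP k (N e).
  by apply: le_trans h1; rewrite ler_pM2l//; exact: le_Gnat.
by apply/negbTE; rewrite -ltNge (lt_le_trans h2)// ler_pM2l//; exact: le_Gnat.
Qed.

Lemma last_index_infty M : \forall h \near (0 : R)^'+, (M <= N h)%N.
Proof.
near=> h; have h0 : 0 < h by near: h; exact: nbhs_right_gt.
have G0 := Gnat_ge0 A_gt0 M.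
rewrite -last_index_le//.
have h1 : h <= t / (c * (Gnat A M + 1)).
  apply: ltW; near: h; apply: nbhs_right_lt; rewrite divr_gt0// mulr_gt0//.
  by rewrite ltr_wpDl// Gnat_ge0.
have G1 : 0 < Gnat A M + 1 by rewrite ltr_wpDl.
apply: (@le_trans _ _ (c * h * (Gnat A M + 1))).
  by rewrite ler_pM2l ?mulr_gt0// lerDl.
by move: h1; rewrite ler_pdivlMr ?mulr_gt0// mulrCA mulrA.
Unshelve. all: end_near. Qed.

(** One more term of the sum overshoots t / c, and that term, times h, is at most h as soon as A
    exceeds 1. *)
Lemma last_index_cvg : (forall K : R, \forall n \near \oo, K < A n) ->
  h * Gnat A (N h) @[h --> 0^'+] --> t / c.
Proof.
move=> A_inf; have [M _ hM] := A_inf 1.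
apply/cvgrPdist_le => e e0; near=> h.
have h0 : 0 < h by near: h; exact: nbhs_right_gt.
have he : h <= e by apply: ltW; near: h; exact: nbhs_right_lt.
have MN : (M <= N h)%N by near: h; exact: last_index_infty.
have [h1 h2] := hN h0.
have A1 : 1 < A (N h).+1 by apply: hM; rewrite /= (leq_trans MN).
have i1 : (A (N h).+1)^-1 <= 1 by rewrite invf_le1 ?ltW// (lt_trans _ A1).
rewrite GnatS in h2.
have h1' : h * Gnat A (N h) <= t / c by rewrite ler_pdivlMr// mulrC mulrA.
have h2' : t / c <= h * Gnat A (N h) + h * (A (N h).+1)^-1.
  by rewrite ler_pdivrMr// -mulrDr mulrC mulrA ltW.
have h3 : h * (A (N h).+1)^-1 <= h by rewrite ler_piMr// ltW.
rewrite ler_distl; apply/andP; split; lra.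
Unshelve. all: end_near. Qed.

End last_index.

Theorem theorem1p2 (R : realType) (d : measure_display) (T : measurableType d)
  (P : probability T R) (X : nat -> T -> R) (A : nat -> R) (f : R -> R)
  (S0' : T -> R) (x : R) :
  (forall i, measurable_fun setT (X i)) ->
  mutually_independent P X ->
  identically_distributed P X ->
  recurrent P (walk X) ->
  (forall n, (0 < n)%N -> 0 < A n) ->
  stable1_density f ->
  conv_in_distribution P (fun n w => walk X n w / A n) f ->
  cramer P (X 0%N) ->
  measurable_fun setT S0' ->
  indep_of_process P S0' (walk X) ->
  let S' := fun n w => S0' w + walk X n w in
  let gamma := 2 * f 0 * pr P (never_hits (walk X) 0) in
  forall t : R, 0 < t ->
    (fun eps : R =>
       cond_pr P
         [set w | exists m, first_hit S' x eps w m /\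
                            gamma * eps * Gfun A m%:R <= t]
         (never_hits S' x))
      @ 0^'+ --> t / (1 + t).
Proof.
move=> mX iX idX recX A_gt0 [f0 cf i_f [s [b [m [s0 _ hf]]]]] cvX crX mS iS S' gamma t t0.
have fcos u := (hf u).1; have fsin u := (hf u).2.
have f1 := density_mass1 fcos.
have b0 := stable_symmetric mX iX idX A_gt0 cvX f0 i_f s0 fcos fsin.
have th u : m * u - s * b * (2 / pi) * u * ln `|u| = m * u by rewrite b0; ring.
have f00 : f 0 = cauchy_pdf s m by apply: density_at0 => // u; rewrite fcos th.
have q_ge0 u : 0 <= charfun_sq P (X 0%N) u by exact: charfun_sq_ge0.
have q_le1 u : charfun_sq P (X 0%N) u <= 1 by exact: charfun_sq_le1.
have q_double := charfun_sq_double mX iX idX.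
have q_cramer := charfun_sq_cramer crX.
have q_cvg := charfun_sq_cvg mX iX idX cvX f0 i_f fcos fsin s0.
have gap eta := spectral_gap q_double q_cramer (eta := eta).
have A_inf := A_infty q_ge0 q_double q_cramer A_gt0 q_cvg.
have [eta [C [eta0 C0 dom]]] := domination q_ge0 q_le1 q_double q_cramer A_gt0 s0 q_cvg.
have re_cvg u : 0 <= u ->
    charfun_re P (walk X n) (u / A n) @[n --> \oo] --> expR (- (s * u)) * cos (m * u).
  move=> u0; apply/cvgrPdist_le => e e0.
  have := charfun_walk_cvg mX cvX f0 i_f fcos fsin u e0; apply: filterS => n /(_ u u0 (lexx _))[+ _].
  by rewrite distrC /= th.
have A2 : A (n + n)%N / A n @[n --> \oo] --> (2 : R).
  exact: (norming_double mX iX idX A_gt0 cvX f0 i_f s0 fcos fsin).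
have A2' : A (n + n).-1 / A n @[n --> \oo] --> (2 : R).
  apply: (norming_ratio mX iX idX A_gt0 cvX f0 i_f s0 fcos fsin (k := fun n => (n + n).-1)) => //.
  apply/cvgrPdist_le => e e0; near=> n.
  have n0 : (0 < n)%N by near: n; exists 1%N.
  have ne : e^-1 < n%:R by near: n; exact: nbhs_infty_gtr.
  have nR : 0 < n%:R :> R by rewrite ltr0n.
  have -> : (n + n).-1%:R = n%:R + n%:R - 1 :> R by rewrite -subn1 natrB ?natrD// addn_gt0 n0.
  have -> : 2 - (n%:R + n%:R - 1) / n%:R = n%:R^-1 :> R by field; rewrite gt_eqF.
  by rewrite ger0_norm ?invr_ge0// -[leRHS]invrK lef_pV2 ?posrE ?invr_gt0// ltW.
have Ginf := Gnat_infty mX iX idX A_gt0 eta0 C0 s0 re_cvg dom A_inf gap recX.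
have never0 : pr P (never_hits (walk X) 0) = never_from P X (fun=> 0).
  by congr (pr P _); apply/seteqP; split => w /= h n n1; have := h n n1; rewrite add0r.
have g0 : 0 < gamma.
  rewrite /gamma never0 f00 mulr_gt0//; last exact: (never_from0_gt0 mX iX idX A_gt0 eta0 C0 dom gap).
  rewrite mulr_gt0// /cauchy_pdf divr_gt0// mulr_gt0 ?pi_gt0//.
  by rewrite ltr_wpDr ?sqr_ge0// exprn_gt0.
have [N hN] := last_index Ginf g0 t0.
have Ninf := last_index_infty A_gt0 g0 t0 hN.
have Ncvg := last_index_cvg A_gt0 g0 t0 hN A_inf.
have tg : 0 <= t / gamma by rewrite divr_ge0// ltW.
(* Absorbing -x into the start moves the target from x to 0. *)
have mV : measurable_fun setT (fun w => - x + S0' w) by exact: measurable_funD.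
have iV := indep_of_process_shift iS (- x).
have := window_hits_never_cvg mX iX idX A_gt0 eta0 C0 s0 re_cvg dom A_inf gap recX A2 A2'
  Ninf Ncvg mV iV tg.
rewrite /= -f00 -never0.
(* The normalisation by gamma is made so that the parameter q of the conditional limit q / (1 + q)
   is t itself. *)
have -> : 2 * f 0 * (t / gamma) * pr P (never_hits (walk X) 0) = t.
  have -> : 2 * f 0 * (t / gamma) * pr P (never_hits (walk X) 0) = gamma * (t / gamma).
    by rewrite {2}/gamma; ring.
  by rewrite mulrC divfK// gt_eqF.
have Wx n w : - x + S0' w + walk X n w = S' n w - x by rewrite /S'; ring.
move=> cv; apply: cvg_trans cv; apply: near_eq_cvg; near=> e.
have e0 : 0 < e by near: e; exact: nbhs_right_gt.
(* For each eps > 0 the events coincide exactly: if the window is visited by time N(eps), a first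
   visit exists and comes no later. *)
congr (cond_pr P _ _).
  apply/seteqP; split => w /=.
    move=> [k /= /andP[k1 kN]]; rewrite /hits_at/= Wx => hk.
    have ex : exists j, (1 <= j)%N && (`|S' j w - x| < e) by exists k; rewrite k1.
    case: (ex_minnP ex) => j /andP[j1 hj] jmin; exists j; split.
      split=> // i i1 ij; rewrite leNgt; apply/negP => hi.
      by have := jmin i; rewrite i1 hi => /(_ isT); rewrite leqNgt ij.
    rewrite Gfun_nat (last_index_le A_gt0 g0 hN)//.
    by apply: leq_trans kN; apply: jmin; rewrite k1.
  move=> [k [[k1 hk _]]]; rewrite Gfun_nat (last_index_le A_gt0 g0 hN)// => kN.
  by exists k; rewrite /= ?k1 ?kN// /hits_at/= Wx.
by apply/seteqP; split => w /= h n n1; have := h n n1; rewrite Wx subr_eq0.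
Unshelve. all: end_near. Qed.
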